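(* For every nonzero $\lambda\in Q^+$, $$m_\lambda(t)=\sum_{\kappa\mid\lambda}\mu(\lambda/\kappa)\left(\frac{\lambda}{\kappa}\right)^{-1}\sum_{\underline{\kappa}\in \mathrm{Par}(\kappa)}(-1)^{|\underline{\kappa}|}\,\frac{B(\underline{\kappa})}{|\underline{\kappa}|}\prod_{i=1}^{|\underline{\kappa}|}P_{\kappa_i}\!\left(t^{\lambda/\kappa}\right),$$ where the outer sum is over all $\kappa\in Q^+$ dividing $\lambda$.
   Context: Setting. $\Phi$ is a Kac-Moody root system (the root system of the Kac-Moody algebra of a generalized Cartan matrix), with simple roots $\alpha_1,\dots,\alpha_r$, simple reflections $s_1,\dots,s_r$, Weyl group $W$ with length function $\ell$, positive and negative roots $\Phi^{\pm}$, and positive real roots $\Phi^+_{\mathrm{re}}$. $Q=\bigoplus_i\mathbb{Z}\alpha_i$ is the root lattice, $Q^+=\bigoplus_i\mathbb{Z}_{\ge0}\alpha_i$. $Q^+_{\mathrm{im}}$ is the set of non-negative integer combinations of positive imaginary roots (equivalently, the elements of $Q^+$ whose whole $W$-orbit lies in $Q^+$). For $w\in W$, $\Phi(w)=\Phi^+\cap w^{-1}(\Phi^-)$, a set of $\ell(w)$ real roots; so $\Phi(w^{-1})=\Phi^+\cap w(\Phi^-)$. For a commutative ring $R$, $R[[Q^+]]$ is the ring of formal sums $\sum_{\lambda\in Q^+}c_\lambda e^\lambda$, $c_\lambda\in R$. Put $\Delta_{\mathrm{re}}=\prod_{\alpha\in\Phi^+_{\mathrm{re}}}(1-e^\alpha)$,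 $\Delta_{t,\mathrm{re}}=\prod_{\alpha\in\Phi^+_{\mathrm{re}}}(1-te^\alpha)$, and $P(t)=\sum_{w\in W}t^{\ell(w)}\in\mathbb{Z}[[t]]$. Definition of $\mathfrak m$. For $\alpha\in\Phi^+_{\mathrm{re}}$ and $w\in W$ set $w(1-t^ne^\alpha)=1-t^ne^{w(\alpha)}$ if $w(\alpha)>0$, and $w(1-t^ne^\alpha)=(-t^ne^{w(\alpha)})(1-t^{-n}e^{-w(\alpha)})$ if $w(\alpha)<0$; extend multiplicatively to define $w(\Delta_{t,\mathrm{re}}/\Delta_{\mathrm{re}})=\prod_{\alpha\in\Phi^+_{\mathrm{re}}} w(1-te^\alpha)\,w(1-e^\alpha)^{-1}$, an element of $\mathbb{Z}[t,t^{-1}][[Q^+]]$. The sum over $w\in W$ of these converges coefficientwise to a unit of $\mathbb{Z}[[t]][t^{-1}][[Q^+]]$, and $\mathfrak m$ is defined by $$\mathfrak m\sum_{w\in W}w\left(\frac{\Delta_{t,\mathrm{re}}}{\Delta_{\mathrm{re}}}\right)=P(t).$$ The series $\mathfrak m$ has coefficients in $\mathbb{Z}[t]$, constant coefficient $1$, and support in $Q^+_{\mathrm{im}}$, so there are unique integers $m(\lambda,n)$ (for $0\ne\lambda\in Q^+_{\mathrm{im}}$, $n\ge0$), with finitely many nonzero for each $\lambda$, such that $\mathfrak m=\prod_{0\ne\lambda\in Q^+_{\mathrm{im}}}\prod_{n\ge0}(1-t^ne^\lambda)^{-m(\lambda,n)}$. Extend to all nonzero $\lambda\in Q^+$ by: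 $m(\alpha,0)=1$, $m(\alpha,1)=-1$, $m(\alpha,n)=0$ for $n\ge 2$ if $\alpha$ is a positive real root; $m(\lambda,n)=0$ for all $n$ if $\lambda$ is neither in $Q^+_{\mathrm{im}}$ nor a real root. Put $m_\lambda(t)=\sum_{n\ge0}m(\lambda,n)t^n\in\mathbb{Z}[t]$. Definition of $P_\lambda(t)$. For $\lambda\in Q^+$, $P_\lambda(t)$ is the coefficient of $e^\lambda$ in $$\Sigma=P(t)^{-1}\sum_{w\in W}t^{\ell(w)}\prod_{\alpha\in\Phi(w^{-1})}\frac{1-t^{-1}e^\alpha}{1-te^\alpha};$$ it is a polynomial in $t$ (one has $\Sigma=\Delta_{\mathrm{re}}/(\mathfrak m\,\Delta_{t,\mathrm{re}})$). Notation. $\mathrm{Par}(\kappa)$ is the set of vector partitions of $\kappa$: unordered tuples (multisets) $\underline\kappa=(\kappa_i)$ of nonzero vectors of $Q^+$ with $\sum\kappa_i=\kappa$; $|\underline\kappa|$ is the number of components. If $\underline\kappa$ consists of $k$ distinct vectors with multiplicities $r_1,\dots,r_k$ and $r=|\underline\kappa|=\sum r_i$, then $B(\underline\kappa)=\frac{r!}{r_1!\cdots r_k!}$. For $\kappa,\lambda\in Q^+$ nonzero, $\kappa\mid\lambda$ means $\lambda=k\kappa$ for a positive integer $k$, and then $\lambda/\kappa=\frac{\lambda}{\kappa}=k$. $\mu$ is the Möbius function. *)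

(* Defs.v *)
From HB Require Import structures.
From mathcomp Require Import all_boot all_order all_algebra.
From mathcomp Require Import finmap multiset.
From mathcomp Require Import mathcomp_extra boolp classical_sets functions.
From mathcomp Require Import cardinality fsbigop.

Set Implicit Arguments.
Unset Strict Implicit.
Unset Printing Implicit Defensive.

Import Order.TTheory GRing.Theory Num.Theory.

Local Open Scope classical_set_scope.
Local Open Scope ring_scope.

Definition cvle n (a b : 'cV[int]_n) := [forall i, a i 0 <= b i 0].

Definition bounded_below n (R : nmodType) (c : 'cV[int]_n -> R) :=
  exists a, forall x, ~~ cvle a x -> c x = 0.

(* [laurent n R] is the ring of formal sums of c_x e^x over x in Z^n whose
   support lies in a translate of the cone N^n. With n = 1 it is R((t)); in
   general it is the localization of R[[Q^+]] at the monomials e^x. *)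
Record laurent n (R : nmodType) := Laurent {
  lcoef :> 'cV[int]_n -> R;
  lcoef_bounded : bounded_below lcoef }.

Section LaurentBasics.
Variable n : nat.
Implicit Types (a b c x y z : 'cV[int]_n).

Lemma cvleP a b : reflect (forall i, a i 0 <= b i 0) (cvle a b).
Proof. exact: forallP. Qed.

Lemma cvle_refl a : cvle a a.
Proof. by apply/cvleP => i. Qed.

Lemma cvle_trans b a c : cvle a b -> cvle b c -> cvle a c.
Proof.
by move=> /cvleP ab /cvleP bc; apply/cvleP => i; exact: le_trans (bc i).
Qed.

Lemma cvleD a b c d : cvle a b -> cvle c d -> cvle (a + c) (b + d).
Proof.
move=> /cvleP ab /cvleP cd; apply/cvleP => i; rewrite !mxE.
exact: lerD.
Qed.

Lemma cvleN a b : cvle (- a) (- b) = cvle b a.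
Proof. by apply: eq_forallb => i; rewrite !mxE lerN2. Qed.

Lemma cvle_subr a b c : cvle a (b - c) = cvle c (b - a).
Proof. by apply: eq_forallb => i; rewrite !mxE !lerBrDr addrC. Qed.

Definition cvbox a b : set 'cV[int]_n := [set x | cvle a x /\ cvle x b].

Lemma finite_cvbox a b : finite_set (cvbox a b).
Proof.
pose N := (\sum_(i < n) `|(b i ord0 - a i ord0)%R|)%N.
pose h (f : {ffun 'I_n -> 'I_N.+1}) := \col_i (a i 0 + (f i)%:Z).
apply: (@sub_finite_set _ _ (h @` [set: {ffun 'I_n -> 'I_N.+1}])); last first.
  exact/finite_image/finite_finset.
move=> x [/cvleP ax /cvleP xb].
exists [ffun i => inord `|x i ord0 - a i ord0|%N] => //.
apply/colP => i; rewrite !mxE ffunE inordK.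
  by rewrite gez0_abs ?subr_ge0 ?ord1 // subrKC.
rewrite ltnS /N (bigD1 i) //=; apply: leq_trans (leq_addr _ _).
rewrite -lez_nat !gez0_abs ?subr_ge0 ?lerB //.
exact: le_trans (xb i).
Qed.

Variable R : comNzRingType.
Implicit Types f g h : laurent n R.

Lemma laurentP f g : (forall x, f x = g x) -> f = g.
Proof.
case: f g => [f bf] [g bg] /= /funext fg.
by case: _ / fg in bg *; congr Laurent; exact: Prop_irrelevance.
Qed.

Lemma lsuppP f a : (forall x, ~~ cvle a x -> f x = 0) ->
  forall x, f x != 0 -> cvle a x.
Proof. by move=> fa x; apply: contraNT => /fa ->. Qed.

(* The sum has finite support whenever f and g are bounded below. *)
Definition lconv (f g : 'cV[int]_n -> R) x : R :=
  \sum_(y \in [set: 'cV[int]_n]) f y * g (x - y).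

Lemma lconvE f g a b x (D : set 'cV[int]_n) :
    (forall y, ~~ cvle a y -> f y = 0) -> (forall y, ~~ cvle b y -> g y = 0) ->
    cvbox a (x - b) `<=` D ->
  lconv f g x = \sum_(y \in D) f y * g (x - y).
Proof.
move=> fa gb sD; apply/esym/fsbig_widen => // y [_ nDy] /=.
have [ay|/fa->] := boolP (cvle a y); last by rewrite mul0r.
have [bxy|/gb->] := boolP (cvle b (x - y)); last by rewrite mulr0.
by case: nDy; apply: sD; split; rewrite // cvle_subr.
Qed.

Lemma lconv_bounded f g : bounded_below (lconv f g).
Proof.
case: (lcoef_bounded f) (lcoef_bounded g) => [a fa] [b gb].
exists (a + b) => x nx; apply: fsbig1 => y _.
have [ay|/fa->] := boolP (cvle a y); last by rewrite mul0r.
have [bxy|/gb->] := boolP (cvle b (x - y)); last by rewrite mulr0.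
by case/negP: nx; rewrite -(subrKC y x) cvleD.
Qed.

Lemma lzero_bounded : bounded_below (fun _ : 'cV[int]_n => 0 : R).
Proof. by exists 0. Qed.

Lemma lopp_bounded f : bounded_below (fun x => - f x).
Proof. by have [a fa] := lcoef_bounded f; exists a => x /fa ->; rewrite oppr0. Qed.

Lemma ladd_bounded f g : bounded_below (fun x => f x + g x).
Proof.
case: (lcoef_bounded f) (lcoef_bounded g) => [a fa] [b gb].
exists (\col_i Order.min (a i 0) (b i 0)) => x nx.
rewrite fa ?gb ?addr0 //; apply: contra nx => /cvleP le;
  by apply/cvleP => i; rewrite !mxE ge_min le ?orbT.
Qed.

Lemma lmono_bounded x0 (c : R) : bounded_below (fun x => if x == x0 then c else 0).
Proof. by exists x0 => x; case: eqP => // -> /negP[]; exact: cvle_refl. Qed.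

Definition lzero := Laurent lzero_bounded.
Definition lopp f := Laurent (lopp_bounded f).
Definition ladd f g := Laurent (ladd_bounded f g).
Definition lmul f g := Laurent (lconv_bounded f g).

Definition lmono x0 (c : R) := Laurent (lmono_bounded x0 c).

Lemma laddA : associative ladd.
Proof. by move=> f g h; apply: laurentP => x /=; rewrite addrA. Qed.

Lemma laddC : commutative ladd.
Proof. by move=> f g; apply: laurentP => x /=; rewrite addrC. Qed.

Lemma ladd0 : left_id lzero ladd.
Proof. by move=> f; apply: laurentP => x /=; rewrite add0r. Qed.

Lemma laddN : left_inverse lzero lopp ladd.
Proof. by move=> f; apply: laurentP => x /=; rewrite addNr. Qed.

Lemma lmulC : commutative lmul.
Proof.
move=> f g; apply: laurentP => x /=; rewrite /lconv.
rewrite [LHS](reindex_fsbigT (fun y => x - y)); last first.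
  by exists (fun y => x - y) => y; rewrite subKr.
by apply: eq_fsbigr => y _; rewrite subKr mulrC.
Qed.

Lemma lmul1 : left_id (lmono 0 1) lmul.
Proof.
move=> f; apply: laurentP => x /=; rewrite /lconv.
rewrite (fsbigTE [fset 0]%fset) ?big_seq_fset1 ?eqxx ?mul1r ?subr0 // => y.
by rewrite inE => /negbTE ->; rewrite mul0r.
Qed.

Lemma lmulDl : left_distributive lmul ladd.
Proof.
move=> f g h; apply: laurentP => x /=.
case: (lcoef_bounded f) (lcoef_bounded g) => [a fa] [b gb].
case: (lcoef_bounded h) => [c hc].
pose d := \col_i Order.min (a i 0) (b i 0).
have da y : cvle a y -> cvle d y.
  by move=> /cvleP ay; apply/cvleP => i; rewrite mxE ge_min ay.
have db y : cvle b y -> cvle d y.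
  by move=> /cvleP bY; apply/cvleP => i; rewrite mxE ge_min bY orbT.
have fd y : ~~ cvle d y -> f y = 0 by move=> nd; apply/fa/(contra _ nd)/da.
have gd y : ~~ cvle d y -> g y = 0 by move=> nd; apply/gb/(contra _ nd)/db.
rewrite (@lconvE f h d c x (cvbox d (x - c))) //.
rewrite (@lconvE g h d c x (cvbox d (x - c))) //.
rewrite -fsbig_split; last exact: finite_cvbox.
rewrite (@lconvE (ladd f g) h d c x (cvbox d (x - c))) //; last first.
  by move=> y nd /=; rewrite fd ?gd ?addr0.
by apply: eq_fsbigr => y _; rewrite mulrDl.
Qed.

Lemma lmulA : associative lmul.
Proof.
move=> f g h; apply: laurentP => x.
case: (lcoef_bounded f) (lcoef_bounded g) => [a fa] [b gb].
case: (lcoef_bounded h) => [c hc].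
pose D := cvbox a (x - (b + c)).
pose E := cvbox (a + b) (x - c).
have ghb y : ~~ cvle (b + c) y -> lmul g h y = 0.
  move=> ny; apply: fsbig1 => z _.
  have [bz|/gb->] := boolP (cvle b z); last by rewrite mul0r.
  have [cyz|/hc->] := boolP (cvle c (y - z)); last by rewrite mulr0.
  by case/negP: ny; rewrite -(subrKC z y) cvleD.
have fgb y : ~~ cvle (a + b) y -> lmul f g y = 0.
  move=> ny; apply: fsbig1 => z _.
  have [bz|/fa->] := boolP (cvle a z); last by rewrite mul0r.
  have [cyz|/gb->] := boolP (cvle b (y - z)); last by rewrite mulr0.
  by case/negP: ny; rewrite -(subrKC z y) cvleD.
rewrite {1}/lmul /= (@lconvE f (lmul g h) a (b + c) x D) //.
rewrite (@lconvE (lmul f g) h (a + b) c x E) //.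
have finD : finite_set D by exact: finite_cvbox.
have finE : finite_set E by exact: finite_cvbox.
transitivity (\sum_(y \in D) \sum_(z \in E) f y * (g (z - y) * h (x - z))).
  apply: eq_fsbigr => y; rewrite inE => -[ay yx].
  rewrite -fsbig_distrr //; congr (_ * _) => /=.
  rewrite [LHS](reindex_fsbigT (fun z => z - y)); last first.
    by exists (fun z => z + y) => z; rewrite ?subrK ?addrK.
  transitivity (\sum_(z \in [set: 'cV[int]_n]) g (z - y) * h (x - z)).
    by apply: eq_fsbigr => z _; rewrite opprB addrA subrK.
  apply/esym/fsbig_widen => // z [_ nEz] /=.
  have [bz|/gb->] := boolP (cvle b (z - y)); last by rewrite mul0r.
  have [cz|/hc->] := boolP (cvle c (x - z)); last by rewrite mulr0.
  case: nEz; split; last by rewrite cvle_subr.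
  by rewrite -(subrKC y z) cvleD.
rewrite exchange_fsbig //; apply: eq_fsbigr => z; rewrite inE => -[az zx].
rewrite [lmul f g z](@lconvE f g a b z D) //; last first.
  move=> y [ay yz]; split=> //; apply: cvle_trans yz _.
  by rewrite opprD addrA addrAC cvleD // cvle_refl.
rewrite mulrC fsbig_distrr //.
by apply: eq_fsbigr => y _; rewrite mulrA mulrC.
Qed.

Lemma lone_neq0 : lmono 0 1 <> lzero.
Proof.
move=> /(congr1 (fun f : laurent n R => f 0)) /=; rewrite eqxx => /eqP.
by rewrite oner_eq0.
Qed.

End LaurentBasics.

HB.instance Definition _ n (R : nmodType) := gen_eqMixin (laurent n R).
HB.instance Definition _ n (R : nmodType) := gen_choiceMixin (laurent n R).

HB.instance Definition _ n (R : comNzRingType) :=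
  GRing.isZmodule.Build (laurent n R)
    (@laddA n R) (@laddC n R) (@ladd0 n R) (@laddN n R).

Lemma laurent_oner_neq0 n (R : comNzRingType) :
  lmono 0 1 != 0 :> laurent n R.
Proof. exact/eqP/lone_neq0. Qed.

HB.instance Definition _ n (R : comNzRingType) :=
  GRing.Zmodule_isComNzRing.Build (laurent n R)
    (@lmulA n R) (@lmulC n R) (@lmul1 n R) (@lmulDl n R)
    (@laurent_oner_neq0 n R).

Section LaurentUnit.
Variables (n : nat) (R : comNzRingType).
Implicit Types f g : laurent n R.

Definition lunit : pred (laurent n R) := fun f => `[< exists g, g * f = 1 >].
Definition linv f := xget f [set g | g * f = 1].

Lemma lmulV : {in lunit, left_inverse 1 linv *%R}.
Proof.
by move=> f /asboolP[g gf]; exact: (@xgetI _ f [set g | g * f = 1] g).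
Qed.

Lemma lunitPl f g : g * f = 1 -> lunit f.
Proof. by move=> gf; apply/asboolP; exists g. Qed.

Lemma linv_out : {in [predC lunit], linv =1 id}.
Proof.
move=> f /asboolP nf; apply: xgetPN => g gf.
by apply: nf; exists g.
Qed.

End LaurentUnit.

HB.instance Definition _ n (R : comNzRingType) :=
  GRing.ComNzRing_hasMulInverse.Build (laurent n R)
    (@lmulV n R) (@lunitPl n R) (@linv_out n R).

Definition gcm r (A : 'M[int]_r) :=
  [/\ forall i, A i i = 2,
      forall i j, i != j -> A i j <= 0
    & forall i j, A i j = 0 -> A j i = 0].

Record lieAlgebra (K : fieldType) := LieAlgebra {
  lie_sort :> lmodType K;
  bracket : lie_sort -> lie_sort -> lie_sort;
  bracket_linearl : forall a x y z,
    bracket (a *: x + y) z = a *: bracket x z + bracket y z;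
  bracket_linearr : forall a x y z,
    bracket z (a *: x + y) = a *: bracket z x + bracket z y;
  bracketxx : forall x, bracket x x = 0;
  jacobi : forall x y z,
    bracket x (bracket y z) + bracket y (bracket z x)
      + bracket z (bracket x y) = 0 }.

Definition lie_subalgebra (K : fieldType) (g : lieAlgebra K) (S : set g) :=
  [/\ S 0, forall a x y, S x -> S y -> S (a *: x + y)
    & forall x y, S x -> S y -> S (bracket x y)].

Definition lie_ideal (K : fieldType) (g : lieAlgebra K) (I : set g) :=
  [/\ I 0, forall a x y, I x -> I y -> I (a *: x + y)
    & forall x y, I y -> I (bracket x y)].

(* The Kac-Moody algebra g(A) over a field K of characteristic 0 (classically
   K = C), with a realization (h, Pi, Pi^vee) of A.
   The clause [km_no_ideal] encodes that g(A) is the quotient of the Lie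
   algebra presented by the other relations by its largest ideal meeting h
   trivially; together with the other clauses it determines g(A) up to
   isomorphism (Kac, Infinite dimensional Lie algebras, Prop. 1.4). *)
Record kacMoody (K : fieldType) r (A : 'M[int]_r) := KacMoody {
  km_alg :> lieAlgebra K;
  km_h : vectType K;
  km_simple_root : 'I_r -> 'Hom(km_h, K^o);
  km_simple_coroot : 'I_r -> km_h;
  km_incl : {linear km_h -> km_alg};
  km_e : 'I_r -> km_alg;
  km_f : 'I_r -> km_alg;
  km_dim : \dim {: km_h}
    = (r.*2 - \rank (map_mx intr A : 'M[K]_r))%N;
  km_root_free : free [seq km_simple_root i | i : 'I_r];
  km_coroot_free : free [seq km_simple_coroot i | i : 'I_r];
  km_pairing : forall i j,
    km_simple_root j (km_simple_coroot i) = (A i j)%:~R;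
  km_incl_inj : injective km_incl;
  km_hh : forall x y, bracket (km_incl x) (km_incl y) = 0;
  km_he : forall x i,
    bracket (km_incl x) (km_e i) = (km_simple_root i x : K) *: km_e i;
  km_hf : forall x i,
    bracket (km_incl x) (km_f i) = - (km_simple_root i x : K) *: km_f i;
  km_ef : forall i j,
    bracket (km_e i) (km_f j)
      = if i == j then km_incl (km_simple_coroot i) else 0;
  km_generated : forall S : set km_alg, lie_subalgebra S ->
    (forall x, S (km_incl x)) -> (forall i, S (km_e i)) ->
    (forall i, S (km_f i)) -> forall x, S x;
  km_no_ideal : forall I : set km_alg, lie_ideal I ->
    (forall x, I (km_incl x) -> x = 0) -> forall x, I x -> x = 0 }.

Section RootSystem.
Variables (K : fieldType) (r : nat) (A : 'M[int]_r) (g : kacMoody K A).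

(* The root lattice Q is 'cV[int]_r, in coordinates on the simple roots. *)
Definition simple_root (i : 'I_r) : 'cV[int]_r := delta_mx i 0.

Definition Qpos : set 'cV[int]_r := [set x | cvle 0 x].

(* x acts on h as the linear form \sum_i x_i alpha_i. *)
Definition root_space (x : 'cV[int]_r) : set g :=
  [set v | forall y : km_h g,
     bracket (km_incl g y) v
       = (\sum_i (x i 0)%:~R * (km_simple_root g i y : K)) *: v].

Definition roots : set 'cV[int]_r :=
  [set x | x != 0 /\ exists2 v, root_space x v & v != 0].

Definition pos_roots := roots `&` Qpos.
Definition neg_roots := roots `&` [set x | Qpos (- x)].

(* The simple reflection x |-> x - <x, alpha_i^vee> alpha_i *)
Definition srefl (i : 'I_r) : 'M[int]_r := 1%:M - delta_mx i i *m A.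

Definition word_prod (s : seq 'I_r) : 'M[int]_r :=
  \big[mulmx/1%:M]_(i <- s) srefl i.

(* The Weyl group, acting on Q by left multiplication of column vectors *)
Definition weyl : set 'M[int]_r := [set w | exists s, w = word_prod s].

Definition wlength (w : 'M[int]_r) : nat :=
  xget 0%N [set n | (exists2 s, size s = n & w = word_prod s) /\
                    (forall s, w = word_prod s -> (n <= size s)%N)].

Definition real_roots : set 'cV[int]_r :=
  [set x | exists2 w, weyl w & exists i, x = w *m simple_root i].

Definition pos_real_roots := real_roots `&` Qpos.

Definition pos_imag_roots := pos_roots `\` real_roots.

Definition Qim : set 'cV[int]_r :=
  [set x | exists2 s : seq 'cV[int]_r,
     {in s, forall y, pos_imag_roots y} & x = \sum_(y <- s) y].

(* Phi(w) = Phi^+ :&: w^-1 Phi^- *)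
Definition inversions (w : 'M[int]_r) : set 'cV[int]_r :=
  pos_roots `&` [set x | neg_roots (w *m x)].

End RootSystem.

(* Contains Z[[t]][t^-1][[Q^+]] as the series supported on Q^+. Monomials e^x
   with x outside Q^+, which occur in w(1 - t^n e^alpha), also belong to it. *)
Definition Qseries r := laurent r (laurent 1 int).

(* coefficient of t^k e^x *)
Definition tecoef r (f : Qseries r) (x : 'cV[int]_r) (k : int) : int :=
  f x (const_mx k).

(* t^k e^x *)
Definition te r (k : int) (x : 'cV[int]_r) : Qseries r :=
  lmono x (lmono (const_mx k) 1).

(* Coefficientwise convergence of the net of finite partial sums or products;
   such a limit is unique. *)
Definition big_cvg r (op : Qseries r -> Qseries r -> Qseries r) (idx : Qseries r)
    (I : choiceType) (D : set I) (F : I -> Qseries r) (f : Qseries r) :=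
  forall x k, exists2 X0 : {fset I}, [set` X0] `<=` D &
    forall X : {fset I}, (X0 `<=` X)%fset -> [set` X] `<=` D ->
      tecoef (\big[op/idx]_(i <- X) F i) x k = tecoef f x k.

Definition big_lim r op idx (I : choiceType) (D : set I) (F : I -> Qseries r) :=
  xget 0 [set f | big_cvg op idx D F f].

Notation sum_lim := (big_lim +%R 0).
Notation prod_lim := (big_lim *%R 1).
Notation prod_cvg := (big_cvg *%R 1).

Section CorrectionFactor.
Variables (K : fieldType) (r : nat) (A : 'M[int]_r) (g : kacMoody K A).

Definition poincare : Qseries r :=
  sum_lim (weyl A) (fun w => te (wlength A w)%:Z 0).

(* w (1 - t^n e^x) *)
Definition act_factor (w : 'M[int]_r) (n : nat) (x : 'cV[int]_r) : Qseries r :=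
  if cvle 0 (w *m x) then 1 - te n%:Z (w *m x)
  else - te n%:Z (w *m x) * (1 - te (- n%:Z) (- (w *m x))).

(* w (Delta_{t,re} / Delta_re) *)
Definition act_Delta_ratio (w : 'M[int]_r) : Qseries r :=
  prod_lim (pos_real_roots A) (fun x => act_factor w 1 x / act_factor w 0 x).

Definition is_correction_factor (mm : Qseries r) :=
  mm * sum_lim (weyl A) act_Delta_ratio = poincare.

(* m x is the polynomial m_x(t), so that the integer m(x, n) is (m x)`_n. *)
Definition is_multiplicity (m : 'cV[int]_r -> {poly int}) :=
  exists mm : Qseries r,
  [/\ is_correction_factor mm,
      prod_cvg [set p : 'cV[int]_r * nat | Qim g p.1 /\ p.1 != 0]
        (fun p => (1 - te p.2%:Z p.1) ^ (- (m p.1)`_p.2)) mm,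
      forall x, pos_real_roots A x -> m x = 1 - 'X
    & forall x, Qpos x -> x != 0 -> ~ Qim g x -> ~ real_roots A x -> m x = 0].

Definition Sigma : Qseries r :=
  poincare^-1 * sum_lim (weyl A) (fun w =>
    te (wlength A w)%:Z 0 *
    \big[*%R/1]_(x \in inversions g (invmx w)) ((1 - te (-1) x) / (1 - te 1 x))).

(* P_x(t), the coefficient of e^x in Sigma, as an element of Z[t] *)
Definition Pcoef (x : 'cV[int]_r) : {poly int} :=
  xget 0 [set p : {poly int} |
    Sigma x = \sum_(i < size p) lmono (const_mx i%:Z) p`_i].

End CorrectionFactor.

Section Partitions.
Variable r : nat.
Implicit Types (x y : 'cV[int]_r) (M : {mset 'cV[int]_r}%mset).

Definition Par x : set {mset 'cV[int]_r}%mset :=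
  [set M | {in M, forall y, Qpos y /\ y != 0} /\ \sum_(y <- M) y = x].

(* r! / (r_1! ... r_k!); M y is the multiplicity of y in M. *)
Definition Bcoef M : nat := ((size M)`! %/ \prod_(y <- finsupp M) (M y)`!)%N.

Definition Qdivisors x : set 'cV[int]_r :=
  [set y | [/\ Qpos y, y != 0 & exists2 k, (0 < k)%N & x = y *+ k]].

Definition Qquot x y : nat := xget 0%N [set k | (0 < k)%N /\ x = y *+ k].

End Partitions.

Definition moebius (n : nat) : int :=
  if all (fun p => logn p n == 1%N) (primes n) then (-1) ^+ size (primes n)
  else 0.

(* Main.v *)
Require Import Defs.
From mathcomp Require Import all_boot all_order all_algebra.
From mathcomp Require Import finmap multiset boolp classical_sets.
From mathcomp Require Import cardinality fsbigop zify.

Set Implicit Arguments.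
Unset Strict Implicit.
Unset Printing Implicit Defensive.

Import Order.TTheory GRing.Theory Num.Theory.

Local Open Scope classical_set_scope.
Local Open Scope ring_scope.

(* Write T_w for t^l(w) prod_(x in Phi(w^-1)) (1 - t^-1 e^x)/(1 - t e^x). As Phi(w^-1) consists
   of l(w) real roots, w(Delta_t,re / Delta_re) = T_w * (Delta_t,re / Delta_re), so
   the defining equation of the correction factor mm says that Sigma is the inverse
   of mm * Delta_t,re / Delta_re, that is, of the product over all nonzero y in Q^+
   of prod_n (1 - t^n e^y)^(-m(y,n)). Comparing logarithms gives
   \sum_(k | x) m_(x/k)(t^k) / k = \sum_(M in Par x) (-1)^|M| B(M)/|M| prod P_y(t),
   through the logarithmic derivative for e^x |-> height(x) e^x on the left and the
   multinomial expansion of - log Sigma on the right; Moebius inversion concludes.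
   That Phi(w^-1) consists of l(w) real roots needs the Weyl group to permute the
   roots, which follows from the local nilpotency of ad e_i. *)

(** * Roots of Kac-Moody algebras *)

(** A divergent [big_lim] is 0 by default, so convergence has to be settled before any identity. For
    the Poincare series and for each w(Delta_t,re / Delta_re) the limit is exhibited. For the sum
    over W it follows from the defining equation of mm: the sum divides the unit [poincare], so it
    is nonzero and thus a true limit. Infinite products are handled by truncation: modulo the e^x
    with x not below a, a product over Q^+ is a finite product over [box a]. That finite product
    makes sense over any ring and for any t. Over Z((t)) it computes Sigma, over Z[X] it shows that
    the coefficients of Sigma are polynomials, and over Q[X] its logarithmic derivative is taken;
    dividing by the height of x then recovers the coefficient of the logarithm. On the Lie algebra
    side, [KacMoody] has [km_no_ideal] instead of the Serre relations, so these are derived first: a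
    vector killed by all f_k generates an ideal which, for weight reasons, cannot meet h. *)

Section LieBasics.
Variables (K : fieldType) (g : lieAlgebra K).
Implicit Types (x y z : g) (a : K).

Lemma bracketDl x y z : bracket (x + y) z = bracket x z + bracket y z.
Proof. by rewrite -[x in LHS]scale1r bracket_linearl scale1r. Qed.

Lemma bracketDr x y z : bracket z (x + y) = bracket z x + bracket z y.
Proof. by rewrite -[x in LHS]scale1r bracket_linearr scale1r. Qed.

Lemma bracket0r z : bracket z 0 = 0.
Proof. by apply: (addrI (bracket z 0)); rewrite -bracketDr !addr0. Qed.

Lemma bracket0l z : bracket 0 z = 0.
Proof. by apply: (addrI (bracket 0 z)); rewrite -bracketDl !addr0. Qed.

Lemma bracketZl a x z : bracket (a *: x) z = a *: bracket x z.
Proof. by rewrite -[a *: x]addr0 bracket_linearl bracket0l addr0. Qed.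

Lemma bracketZr a x z : bracket z (a *: x) = a *: bracket z x.
Proof. by rewrite -[a *: x]addr0 bracket_linearr bracket0r addr0. Qed.

Lemma bracketNl x z : bracket (- x) z = - bracket x z.
Proof. by rewrite -scaleN1r bracketZl scaleN1r. Qed.

Lemma bracketNr x z : bracket z (- x) = - bracket z x.
Proof. by rewrite -scaleN1r bracketZr scaleN1r. Qed.

Lemma bracketC x y : bracket x y = - bracket y x.
Proof.
apply/eqP; rewrite -addr_eq0; apply/eqP.
have := bracketxx (x + y).
by rewrite bracketDl !bracketDr !bracketxx addr0 add0r.
Qed.

Lemma bracket_derivation x y z :
  bracket x (bracket y z) = bracket (bracket x y) z + bracket y (bracket x z).
Proof.
have /eqP := jacobi x y z.
rewrite (bracketC z (bracket x y)) (bracketC z x) bracketNr addrAC.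
by rewrite addr_eq0 opprK => /eqP <-; rewrite subrKC.
Qed.

End LieBasics.

Section Opposite.
Variables (K : fieldType) (r : nat) (A : 'M[int]_r) (g : kacMoody K A).

(** The sign gives [h, f_i] and [h, e_i] the form of [km_he] and [km_hf] after the exchange, and it
    absorbs the sign of [f_i, e_i]. *)
Definition opp_incl : {linear km_h g -> km_alg g} := \- (@km_incl _ _ _ g).

Lemma opp_inclE h : opp_incl h = - km_incl g h. Proof. by []. Qed.

Lemma opp_incl_inj : injective opp_incl.
Proof. by move=> x y /oppr_inj /km_incl_inj. Qed.

Lemma opp_hh x y : bracket (opp_incl x) (opp_incl y) = 0.
Proof. by rewrite !opp_inclE bracketNl bracketNr km_hh !oppr0. Qed.

Lemma opp_he x i :
  bracket (opp_incl x) (km_f g i) = (km_simple_root g i x : K) *: km_f g i.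
Proof. by rewrite opp_inclE bracketNl km_hf scaleNr opprK. Qed.

Lemma opp_hf x i :
  bracket (opp_incl x) (km_e g i) = - (km_simple_root g i x : K) *: km_e g i.
Proof. by rewrite opp_inclE bracketNl km_he scaleNr. Qed.

Lemma opp_ef i j : bracket (km_f g i) (km_e g j)
  = if i == j then opp_incl (km_simple_coroot g i) else 0.
Proof.
by rewrite bracketC km_ef eq_sym opp_inclE; case: eqP => [->|]; rewrite ?oppr0.
Qed.

Lemma opp_generated (S : set g) : lie_subalgebra S ->
  (forall x, S (opp_incl x)) -> (forall i, S (km_f g i)) ->
  (forall i, S (km_e g i)) -> forall x, S x.
Proof.
move=> sS Sh Sf Se; apply: km_generated => // x.
by have := Sh (- x); rewrite opp_inclE linearN opprK.
Qed.

Lemma opp_no_ideal (I : set g) : lie_ideal I ->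
  (forall x, I (opp_incl x) -> x = 0) -> forall x, I x -> x = 0.
Proof.
move=> idI Ih; apply: km_no_ideal => // x Ix; apply/eqP.
by rewrite -oppr_eq0 (Ih (- x)) // opp_inclE linearN opprK.
Qed.

(* The same Lie algebra with e_i and f_i exchanged: facts about e_i transfer to f_i. *)
Definition opp_km : kacMoody K A :=
  KacMoody (km_dim g) (km_root_free g) (km_coroot_free g) (km_pairing g)
    opp_incl_inj opp_hh opp_he opp_hf opp_ef opp_generated opp_no_ideal.

End Opposite.

(** * Weight spaces and their linear independence *)

Section Weights.
Variables (K : fieldType) (r : nat) (A : 'M[int]_r) (g : kacMoody K A).
Implicit Types (x y z : 'cV[int]_r) (u v w : g) (h : km_h g).

Definition weight x h : K :=
  \sum_i (x i 0)%:~R * (km_simple_root g i h : K).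

Lemma root_spaceE x v h :
  root_space x v -> bracket (km_incl g h) v = weight x h *: v.
Proof. by move/(_ h). Qed.

Lemma root_spaceI x v :
  (forall h, bracket (km_incl g h) v = weight x h *: v) -> root_space x v.
Proof. by []. Qed.

Lemma weightD x y h : weight (x + y) h = weight x h + weight y h.
Proof.
rewrite -big_split; apply: eq_bigr => i _.
by rewrite mxE rmorphD mulrDl.
Qed.

Lemma weight0 h : weight 0 h = 0.
Proof. by apply: big1 => i _; rewrite mxE mul0r. Qed.

Lemma weightN x h : weight (- x) h = - weight x h.
Proof. by apply/eqP; rewrite -addr_eq0 -weightD addNr weight0. Qed.

Lemma weight_simple i h : weight (simple_root i) h = km_simple_root g i h.
Proof.
rewrite /weight (bigD1 i) //= mxE !eqxx mul1r big1 ?addr0 // => j ji.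
by rewrite mxE (negbTE ji) mul0r.
Qed.

Lemma weight_coroot x i :
  weight x (km_simple_coroot g i) = ((A *m x) i 0)%:~R.
Proof.
rewrite mxE rmorph_sum; apply: eq_bigr => j _.
by rewrite km_pairing rmorphM mulrC.
Qed.

Lemma root_spaceZ x a v : root_space x v -> root_space x (a *: v).
Proof. by move=> xv h; rewrite bracketZr xv !scalerA mulrC. Qed.

Lemma root_space_bracket x y u v :
  root_space x u -> root_space y v -> root_space (x + y) (bracket u v).
Proof.
move=> xu yv; apply: root_spaceI => h.
by rewrite bracket_derivation (root_spaceE _ xu) (root_spaceE _ yv) bracketZl bracketZr weightD scalerDl.
Qed.

Lemma root_space_e i : root_space (simple_root i) (km_e g i).
Proof. by apply: root_spaceI => h; rewrite weight_simple km_he. Qed.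

Lemma root_space_incl h : root_space 0 (km_incl g h).
Proof. by apply: root_spaceI => h'; rewrite weight0 scale0r km_hh. Qed.

Lemma root_space_opp x (v : opp_km g) :
  root_space x v <-> root_space (- x) (v : g).
Proof.
have opE h : bracket (km_incl (opp_km g) h) v = - bracket (km_incl g h) (v : g).
  by rewrite -bracketNl.
split=> xv; first apply: root_spaceI => h.
  by rewrite -[LHS]opprK -opE (xv h) weightN scaleNr.
move=> h; change (bracket (km_incl (opp_km g) h) v = weight x h *: (v : g)).
by rewrite opE (root_spaceE h xv) weightN scaleNr opprK.
Qed.

Hypothesis K_char0 : [pchar K] =i pred0.

Lemma intr_inj0 (n : int) : (n%:~R == 0 :> K) = (n == 0).
Proof.
have nat0 k : (k%:R == 0 :> K) = (k == 0)%N by have /pcharf0P -> := K_char0.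
case: n => n; first by rewrite -pmulrn nat0.
by rewrite NegzE rmorphN /= oppr_eq0 -pmulrn nat0 oppr_eq0.
Qed.

(** The simple roots are free in the dual of h and Z embeds in K, so Q embeds in the dual of h. *)
Lemma weight_neq x y : x != y -> exists h, weight x h != weight y h.
Proof.
move=> xy; apply: contrapT => /forallNP wxy; case/eqP: xy.
have {}wxy h : weight (x - y) h = 0.
  by have /negP/negPn/eqP := wxy h; rewrite weightD weightN => ->; rewrite subrr.
apply/subr0_eq/colP => i; rewrite [RHS]mxE; apply/eqP.
rewrite -intr_inj0; apply/eqP.
have fr := km_root_free g.
set X := (X in free X) in fr.
have sX : size X = r by rewrite size_map -cardE card_ord.
pose k (j : 'I_(size X)) : K := ((x - y) (cast_ord sX j) 0)%:~R.
have /freeP fr0 : free (in_tuple X) := fr.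
suff : k (cast_ord (esym sX) i) = 0.
  by rewrite /k; congr (_ = _); congr (((x - y) _ 0)%:~R); exact: val_inj.
have XE (j : 'I_(size X)) : X`_j = km_simple_root g (cast_ord sX j).
  have jr : (j < r)%N := ltn_ord (cast_ord sX j).
  rewrite (nth_map (cast_ord sX j)) ?size_enum_ord //.
  by congr (km_simple_root g _); apply: val_inj; rewrite /= nth_enum_ord.
apply: (fr0 k); apply/lfunP => h; rewrite sum_lfunE lfunE /=.
rewrite -[RHS](wxy h) /weight (reindex (cast_ord sX)); last first.
  by exists (cast_ord (esym sX)) => j _; exact: val_inj.
by apply: eq_bigr => j _; rewrite scale_lfunE XE.
Qed.

(** Induction on the number of summands: ad h - y(h) kills a summand of weight y, rescales the
    others, and multiplies the whole sum by x(h) - y(h), which is nonzero for a suitable h. *)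
Lemma root_space_sum0 x (us : seq g) :
    (forall u, u \in us -> exists2 y, y != x & root_space y u) ->
  root_space x (\sum_(u <- us) u) -> \sum_(u <- us) u = 0.
Proof.
pose P s v := \sum_(u <- s) u = v :> g.
have [n] := ubnP (size us); elim: n us => // n IH [|u us] /= ltn uw.
  by rewrite big_nil.
have [y yx yu] := uw u (mem_head _ _).
have [h hxy] := weight_neq yx.
pose c (w : g) := bracket (km_incl g h) w - weight y h *: w.
have cD w w' : c (w + w') = c w + c w'.
  by rewrite /c bracketDr scalerDr opprD addrACA.
have csum s : c (\sum_(w <- s) w) = \sum_(w <- [seq c w | w <- s]) w.
  elim: s => [|w s IHs]; last by rewrite /= !big_cons cD IHs.
  by rewrite !big_nil /c bracket0r scaler0 subr0.
have cw z w : root_space z w -> c w = (weight z h - weight y h) *: w.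
  by move=> zw; rewrite /c (root_spaceE _ zw) scalerBl.
set v := (X in root_space x X) => xv.
have cv : c v = \sum_(w <- [seq c w | w <- us]) w.
  by rewrite /v big_cons cD csum (cw _ _ yu) subrr scale0r add0r.
have : c v = 0.
  rewrite cv; apply: IH.
  - by rewrite size_map.
  - move=> _ /mapP[w wus ->].
    have [z zx zw] := uw w (mem_behead (wus : w \in behead (u :: us))).
    by exists z; rewrite // (cw _ _ zw); exact: root_spaceZ.
  - by rewrite -cv (cw _ _ xv); exact: root_spaceZ.
rewrite (cw _ _ xv) => /eqP; rewrite scaler_eq0 => /orP[|/eqP//].
by rewrite subr_eq0 eq_sym (negbTE hxy).
Qed.

End Weights.

Section LinearSpan.
Variables (K : fieldType) (r : nat) (A : 'M[int]_r) (g : kacMoody K A).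
Implicit Types (x y z : 'cV[int]_r) (u v w : g) (h : km_h g) (S G : set g).

(** The impredicative form turns membership in a span into an induction principle, which is how it
    is used; the algebra may have infinite dimension. *)
Definition lspan G : set g := [set w | forall S, S 0 ->
  (forall a u v, S u -> S v -> S (a *: u + v)) -> G `<=` S -> S w].

Lemma lspan0 G : lspan G 0.
Proof. by move=> S S0. Qed.

Lemma lspan_lin G a u v : lspan G u -> lspan G v -> lspan G (a *: u + v).
Proof.
by move=> Gu Gv S S0 SD GS; exact: SD (Gu S S0 SD GS) (Gv S S0 SD GS).
Qed.

Lemma lspanD G u v : lspan G u -> lspan G v -> lspan G (u + v).
Proof. by move=> Gu Gv; rewrite -[u]scale1r; exact: lspan_lin. Qed.

Lemma lspanZ G a u : lspan G u -> lspan G (a *: u).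
Proof. by move=> Gu; rewrite -[_ *: _]addr0; apply: lspan_lin Gu _; exact: lspan0. Qed.

Lemma lspan_gen G u : G u -> lspan G u.
Proof. by move=> Gu S _ _; exact. Qed.

Lemma lspanS G S : G `<=` lspan S -> lspan G `<=` lspan S.
Proof. by move=> GS u /(_ (lspan S)); apply; [exact: lspan0|exact: lspan_lin|]. Qed.

Lemma lspan_ad t G S : (forall u, G u -> lspan S (bracket t u)) ->
  forall u, lspan G u -> lspan S (bracket t u).
Proof.
move=> GS u /(_ [set u | lspan S (bracket t u)]); apply => [|a v w Sv Sw|//] /=; first by rewrite bracket0r; exact: lspan0.
by rewrite bracketDr bracketZr; exact: lspan_lin.
Qed.

(** By the Jacobi identity the t with [t, S] inside S form a subalgebra, so a subspace stable under
    the generators is an ideal. *)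
Lemma lie_normalizer S : S 0 ->
    (forall a u v, S u -> S v -> S (a *: u + v)) ->
    (forall h u, S u -> S (bracket (km_incl g h) u)) ->
    (forall i u, S u -> S (bracket (km_e g i) u)) ->
    (forall i u, S u -> S (bracket (km_f g i) u)) ->
  forall t u, S u -> S (bracket t u).
Proof.
move=> S0 SD Sh Se Sf t.
apply: (@km_generated _ _ _ g [set t | forall u, S u -> S (bracket t u)]) => //.
split=> /= [w _|a y z Sy Sz w Sw|y z Sy Sz w Sw].
- by rewrite bracket0l.
- by rewrite bracketDl bracketZl; apply: SD; [exact: Sy|exact: Sz].
- have -> : bracket (bracket y z) w
      = (- 1) *: bracket z (bracket y w) + bracket y (bracket z w).
    by rewrite (bracket_derivation y) scaleN1r addrC addrK.
  by apply: SD; [exact/Sz/Sy|exact/Sy/Sz].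
Qed.

Hypothesis K_char0 : [pchar K] =i pred0.

Lemma lspan_root_space0 G x :
    (forall u, G u -> u = 0 \/ exists2 y, y != x & root_space y u) ->
  forall w, lspan G w -> root_space x w -> w = 0.
Proof.
move=> Gx w Gw.
pose S : set g := [set w | exists2 us : seq g,
    (forall u, u \in us -> exists2 y, y != x & root_space y u)
    & w = \sum_(u <- us) u].
suff [us usx ->] : S w by exact: root_space_sum0.
apply: (Gw S) => [|a u v [us ux ->] [vs vx ->]|u /Gx[->|[y yx yu]]].
- by exists nil; rewrite ?big_nil.
- exists ([seq a *: u | u <- us] ++ vs); last first.
    by rewrite big_cat big_map scaler_sumr.
  move=> t; rewrite mem_cat => /orP[/mapP[t' /ux[y yx yt] ->]|/vx//].
  by exists y => //; exact: root_spaceZ.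
- by exists nil; rewrite ?big_nil.
- exists [:: u]; last by rewrite big_seq1.
  by move=> t; rewrite inE => /eqP ->; exists y.
Qed.

End LinearSpan.

Definition root_sum r (s : seq 'I_r) : 'cV[int]_r := \sum_(j <- s) simple_root j.

Lemma root_sum_cons r j (s : seq 'I_r) :
  root_sum (j :: s) = simple_root j + root_sum s.
Proof. exact: big_cons. Qed.

Lemma simple_rootE r (i j : 'I_r) : simple_root i j 0 = (j == i)%:R.
Proof. by rewrite mxE eqxx andbT. Qed.

Lemma root_sum_ge0 r (s : seq 'I_r) : cvle 0 (root_sum s).
Proof.
elim: s => [|j s IH]; first by rewrite /root_sum big_nil cvle_refl.
rewrite root_sum_cons -[0]addr0; apply: cvleD => //.
by apply/cvleP => i; rewrite simple_rootE mxE ler0n.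
Qed.

Section Words.
Variables (K : fieldType) (r : nat) (A : 'M[int]_r) (g : kacMoody K A).
Implicit Types (x y z : 'cV[int]_r) (u v w : g) (h : km_h g) (i j k : 'I_r).

Definition ad_word v (s : seq 'I_r) : g :=
  foldr (fun j w => bracket (km_e g j) w) v s.

Lemma root_space_ad_word x v s :
  root_space x v -> root_space (x + root_sum s) (ad_word v s).
Proof.
move=> xv; elim: s => [|j s IH]; first by rewrite /root_sum big_nil addr0.
rewrite root_sum_cons addrCA /=.
by apply: root_space_bracket IH; exact: root_space_e.
Qed.

Hypothesis K_char0 : [pchar K] =i pred0.

(* The ideal generated by v is spanned by the ad_word v s, hence meets h trivially. *)
Lemma lowest_weight_eq0 x v : root_space x v ->
    (forall s, x + root_sum s != 0) ->
    (forall k, bracket (km_f g k) v = 0) -> v = 0.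
Proof.
move=> xv x0 fv; pose G := range (ad_word v).
have Gw s : lspan G (ad_word v s) by apply: lspan_gen; exists s.
have Gx s h : bracket (km_incl g h) (ad_word v s)
    = weight (x + root_sum s) h *: ad_word v s.
  exact/root_spaceE/root_space_ad_word.
apply: (@km_no_ideal _ _ _ g (lspan G)); last exact: (Gw [::]).
  split; [exact: lspan0|exact: lspan_lin|].
  apply: lie_normalizer; [exact: lspan0|exact: lspan_lin| | |].
  - move=> h; apply: lspan_ad => _ [s _ <-].
    by rewrite Gx; apply: lspanZ.
  - by move=> i; apply: lspan_ad => _ [s _ <-]; exact: (Gw (i :: s)).
  - move=> k; apply: lspan_ad => _ [s _ <-].
    (* [f_k, e_j] is 0 or minus a coroot, and h only rescales the weight vector [ad_word v s]. *)
    elim: s => [|j s IH] /=; first by rewrite fv; exact: lspan0.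
    rewrite bracket_derivation; apply: lspanD; last first.
      by apply: lspan_ad IH => _ [t _ <-]; exact: (Gw (j :: t)).
    rewrite (bracketC (km_f g k)) km_ef.
    case: ifP => _; last by rewrite oppr0 bracket0l; exact: lspan0.
    by rewrite -linearN Gx; exact: lspanZ.
(* h has weight 0, which by [x0] no spanning vector has. *)
move=> h Gh; apply: (@km_incl_inj _ _ _ g); rewrite linear0.
apply: (lspan_root_space0 K_char0 (x := 0) _ Gh); last exact: root_space_incl.
move=> _ [s _ <-]; right; exists (x + root_sum s); first exact: x0.
exact: root_space_ad_word.
Qed.

End Words.

Lemma root_sumE r (s : seq 'I_r) i : root_sum s i 0 = (count_mem i s)%:Z.
Proof.
elim: s => [|j s IH]; first by rewrite /root_sum big_nil mxE.
rewrite root_sum_cons mxE IH simple_rootE /= PoszD eq_sym.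
by case: eqP.
Qed.

(** * Triangular decomposition and the signs of roots *)

Section Triangular.
Variables (K : fieldType) (r : nat) (A : 'M[int]_r).
Implicit Types (x y z : 'cV[int]_r) (i j k : 'I_r).

(** Spans h + n_+, and for [opp_km g] it spans h + n_-. *)
Definition borel_words (g : kacMoody K A) : set g := [set u |
  (exists h, u = km_incl g h) \/ (exists i s, u = ad_word (km_e g i) s)].

Lemma ad_f_word (g : kacMoody K A) k i s :
  lspan (@borel_words g) (bracket (km_f g k) (ad_word (km_e g i) s)).
Proof.
have Bh h : lspan (@borel_words g) (km_incl g h).
  by apply: lspan_gen; left; exists h.
have Bw j t : lspan (@borel_words g) (ad_word (km_e g j) t).
  by apply: lspan_gen; right; exists j, t.
elim: s => [|j s IH] /=.
  rewrite bracketC km_ef; case: ifP => _; last by rewrite oppr0; exact: lspan0.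
  by rewrite -linearN.
rewrite bracket_derivation; apply: lspanD.
  rewrite (bracketC (km_f g k)) km_ef.
  case: ifP => _; last by rewrite oppr0 bracket0l; exact: lspan0.
  rewrite -linearN.
  rewrite (root_spaceE _ (root_space_ad_word s (root_space_e (g:=g) i))).
  exact: lspanZ.
apply: lspan_ad IH => _ [[h ->]|[i' [t ->]]]; last exact: (Bw i' (j :: t)).
by rewrite bracketC km_he -scaleNr; apply: lspanZ; exact: (Bw j [::]).
Qed.

Definition triangular_words (g : kacMoody K A) : set g :=
  @borel_words g `|` (@borel_words (opp_km g) : set g).

(** Stability under the e_i thereby follows from stability under the f_i in [opp_km g]. *)
Lemma triangular_words_opp (g : kacMoody K A) :
  @triangular_words (opp_km g) = @triangular_words g.
Proof.
have oppB (g' : kacMoody K A) :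
    @borel_words (opp_km (opp_km g')) `<=` @borel_words g'.
  move=> u [[h ->]|[i [s ->]]]; last by right; exists i, s.
  by left; exists h; rewrite /= opprK.
rewrite /triangular_words setUC; apply/seteqP; split=> u [].
- by move=> /oppB; left.
- by right.
- move=> [[h ->]|[i [s ->]]]; left.
    by left; exists h; rewrite /= opprK.
  by right; exists i, s.
- by right.
Qed.

Lemma triangular_ad_f (g : kacMoody K A) k u :
  triangular_words u -> lspan (@triangular_words g) (bracket (km_f g k) u).
Proof.
move=> [[[h ->]|[i [s ->]]]|[[h ->]|[i [s ->]]]].
- rewrite bracketC km_hf scaleNr opprK; apply: lspanZ; apply: lspan_gen.
  by right; right; exists k, [::].
- by apply: lspanS (ad_f_word k i s) => v Bv; apply: lspan_gen; left.
- rewrite bracketC bracketNl km_hf scaleNr !opprK -scaleNr.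
  by apply: lspanZ; apply: lspan_gen; right; right; exists k, [::].
- by apply: lspan_gen; right; right; exists i, (k :: s).
Qed.

(** The span of the words is stable under every generator, hence under all brackets by
    [lie_normalizer]; as it contains the generators, it is everything. *)
Lemma triangular_decomposition (g : kacMoody K A) u :
  lspan (@triangular_words g) u.
Proof.
have Th h : lspan (@triangular_words g) (km_incl g h).
  by apply: lspan_gen; left; left; exists h.
have Te i : lspan (@triangular_words g) (km_e g i).
  by apply: lspan_gen; left; right; exists i, [::].
have Tf i : lspan (@triangular_words g) (km_f g i).
  by apply: lspan_gen; right; right; exists i, [::].
apply: (@km_generated _ _ _ g (lspan (@triangular_words g))) => //.
split; [exact: lspan0|exact: lspan_lin|move=> v w _].
move: v w; apply: lie_normalizer; [exact: lspan0|exact: lspan_lin| | |].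
- move=> h; apply: lspan_ad => _ [[[h' ->]|[i [s ->]]]|[[h' ->]|[i [s ->]]]].
  + by rewrite km_hh; exact: lspan0.
  + rewrite (root_spaceE _ (root_space_ad_word s (root_space_e (g:=g) i))).
    by apply: lspanZ; apply: lspan_gen; left; right; exists i, s.
  + by rewrite bracketNr km_hh oppr0; exact: lspan0.
  + have := root_space_ad_word s (root_space_e (g:=opp_km g) i).
    move=> /root_space_opp/root_spaceE ->.
    by apply: lspanZ; apply: lspan_gen; right; right; exists i, s.
- move=> i; apply: lspan_ad => v; rewrite -triangular_words_opp.
  exact: triangular_ad_f.
- by move=> i; apply: lspan_ad => v; exact: triangular_ad_f.
Qed.

Hypothesis K_char0 : [pchar K] =i pred0.

Lemma roots_opp (g : kacMoody K A) x : Defs.roots (opp_km g) x <-> Defs.roots g (- x).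
Proof.
split=> -[x0 [v xv v0]].
  by split; [rewrite oppr_eq0|exists v => //; apply/root_space_opp].
by split; [rewrite -oppr_eq0|exists v => //; apply/root_space_opp].
Qed.

(** The words span the algebra and are weight vectors, so a root vector of weight x requires a
    nonzero word of that weight; x != 0 rules out h. *)
Lemma roots_word (g : kacMoody K A) x : Defs.roots g x ->
  (exists i s, x = simple_root i + root_sum s /\ ad_word (km_e g i) s != 0) \/
  (exists i s, - x = simple_root i + root_sum s
     /\ ad_word (km_e (opp_km g) i) s != 0).
Proof.
move=> [x0 [v xv v0]]; apply: contrapT => /not_orP[nE nF]; case/eqP: v0.
apply: (lspan_root_space0 K_char0 _ (triangular_decomposition v) xv).
move=> _ [[[h ->]|[i [s ->]]]|[[h ->]|[i [s ->]]]].
- by right; exists 0; [rewrite eq_sym|exact: root_space_incl].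
- have [->|w0] := eqVneq (ad_word (km_e g i) s) 0; [by left|right].
  exists (simple_root i + root_sum s).
    by apply/eqP => ix; apply: nE; exists i, s.
  exact/root_space_ad_word/root_space_e.
- right; exists 0; [by rewrite eq_sym|rewrite -[X in root_space X]oppr0].
  exact/root_space_opp/root_space_incl.
- have [->|w0] := eqVneq (ad_word (km_e (opp_km g) i) s) 0; [by left|right].
  exists (- (simple_root i + root_sum s)).
    by apply/eqP => ix; apply: nF; exists i, s; rewrite -ix opprK.
  exact/root_space_opp/root_space_ad_word/root_space_e.
Qed.

Lemma roots_signed (g : kacMoody K A) x :
  Defs.roots g x -> Qpos x \/ Qpos (- x).
Proof.
have pos i s : cvle 0 (simple_root i + root_sum s : 'cV[int]_r).
  by rewrite -[simple_root i + _]root_sum_cons root_sum_ge0.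
by case/roots_word=> [[i [s [-> _]]]|[i [s [-> _]]]]; [left|right]; apply: pos.
Qed.

(** The innermost bracket is [e_i, e_i]. *)
Lemma ad_word_constant (g : kacMoody K A) i (s : seq 'I_r) :
  s != [::] -> all (pred1 i) s -> ad_word (km_e g i) s = 0.
Proof.
elim: s => // j [|k s] IH _ /= /andP[/eqP-> si]; first by rewrite bracketxx.
by rewrite [X in bracket _ X]IH // bracket0r.
Qed.

(** Coordinates of the weight count letters, so every letter is i, and such a word is nonzero only
    when it has one letter. *)
Lemma word_multiple (g : kacMoody K A) i j s (n : int) :
    simple_root i *~ n = simple_root j + root_sum s ->
  ad_word (km_e g j) s != 0 -> n = 1.
Proof.
move=> eqn w0.
have cnt k : n * (k == i)%:Z = (count_mem k (j :: s))%:Z.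
  by rewrite -root_sumE root_sum_cons -eqn -scaler_int intz mxE simple_rootE natz.
have all_i : all (pred1 i) (j :: s).
  apply/allP => k kjs; apply: contraTT kjs => /= ki; rewrite -has_pred1 has_count.
  have := cnt k; rewrite (negbTE ki) mulr0 => /esym/eqP.
  by rewrite eqz_nat => /eqP ->.
case/andP: (all_i) => /eqP ji sj; rewrite {j}ji in eqn w0 cnt all_i *.
have s0 : s = [::] by apply/eqP; apply: contraNT w0 => s0; rewrite ad_word_constant.
by have := cnt i; rewrite s0 /= eqxx mulr1.
Qed.

Lemma roots_multiple (g : kacMoody K A) i (n : int) :
  Defs.roots g (simple_root i *~ n) -> n = 1 \/ n = - 1.
Proof.
case/roots_word=> [[j [s [eqn w0]]]|[j [s [eqn w0]]]].
  by left; exact: word_multiple eqn w0.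
by right; rewrite -mulrNz in eqn; rewrite -(word_multiple eqn w0) opprK.
Qed.

End Triangular.

Section SimpleReflections.
Variables (r : nat) (A : 'M[int]_r).
Hypothesis A_gcm : gcm A.
Implicit Types (x y : 'cV[int]_r) (i j : 'I_r).

Lemma srefl_mulE i x : srefl A i *m x = x - simple_root i *~ (A *m x) i 0.
Proof.
rewrite mulmxBl mul1mx -mulmxA; congr (_ - _); apply/colP => j.
rewrite -scaler_int intz [RHS]mxE simple_rootE natz mxE.
rewrite (bigD1 i) //= big1 ?addr0 => [|k ki]; last first.
  by rewrite mxE (negbTE ki) andbF mul0r.
by rewrite mxE eqxx andbT mulrC natz.
Qed.

Lemma cartan_simple i j : (A *m simple_root j) i 0 = A i j.
Proof.
rewrite mxE (bigD1 j) //= big1 ?addr0 => [|k kj].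
  by rewrite simple_rootE eqxx mulr1.
by rewrite simple_rootE (negbTE kj) mulr0.
Qed.

Lemma cartan_shift i j n x :
  (A *m (x + simple_root j *+ n)) i 0 = (A *m x) i 0 + n%:Z * A i j.
Proof.
rewrite mulmxDr [LHS]mxE; congr (_ + _).
by rewrite -scaler_nat -scalemxAr [LHS]mxE cartan_simple natz.
Qed.

Lemma cartan_diag i : A i i = 2. Proof. by have [->] := A_gcm. Qed.

Lemma srefl_simple i : srefl A i *m simple_root i = - simple_root i.
Proof.
rewrite srefl_mulE cartan_simple cartan_diag.
by rewrite -[2]/(2%:Z) -pmulrn mulr2n opprD addNKr.
Qed.

Lemma cartan_srefl i x : (A *m (srefl A i *m x)) i 0 = - (A *m x) i 0.
Proof.
rewrite srefl_mulE mulmxBr -scaler_int intz -scalemxAr !mxE.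
have := cartan_simple i i; rewrite mxE => ->; rewrite cartan_diag; lia.
Qed.

Lemma sreflK i x : srefl A i *m (srefl A i *m x) = x.
Proof. by rewrite srefl_mulE cartan_srefl mulrNz opprK srefl_mulE subrK. Qed.

Lemma srefl_sqr i : srefl A i *m srefl A i = 1%:M.
Proof.
apply/matrixP => a b.
have := congr1 (fun v : 'cV_r => v a 0) (sreflK i (delta_mx b 0)).
by rewrite mulmxA -colE mxE => ->; rewrite !mxE eqxx andbT.
Qed.

End SimpleReflections.

(** * sl_2-strings, Serre relations and local nilpotency *)

Section Sl2.
Variables (K : fieldType) (r : nat) (A : 'M[int]_r) (g : kacMoody K A).
Hypothesis A_gcm : gcm A.
Implicit Types (x y z : 'cV[int]_r) (u v w : g) (h : km_h g) (i j k : 'I_r).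

Notation ade i n v := (iter n (bracket (km_e g i)) v).

Lemma root_space_iter x i n v :
  root_space x v -> root_space (x + simple_root i *+ n) (ade i n v).
Proof.
move=> xv; elim: n => [|n IH]; first by rewrite addr0.
rewrite mulrS addrCA /=.
by apply: root_space_bracket IH; exact: root_space_e.
Qed.

Lemma coroot_iter x i n v : root_space x v ->
  bracket (km_incl g (km_simple_coroot g i)) (ade i n v)
    = ((A *m x) i 0 + n%:Z * 2)%:~R *: ade i n v.
Proof.
move=> xv; rewrite (root_spaceE _ (root_space_iter i n xv)) weight_coroot.
by rewrite cartan_shift (cartan_diag A_gcm).
Qed.

(** The sl_2 computation on a lowest weight vector: with p = <x, alpha_i^vee>, moving f_i past the
    e_i collects the coroot eigenvalues p + 2k for k <= n, whose sum is (n+1)(p+n). *)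
Lemma ad_f_iter_e x i n v : root_space x v -> bracket (km_f g i) v = 0 ->
  bracket (km_f g i) (ade i n.+1 v)
    = - (n.+1%:Z * ((A *m x) i 0 + n%:Z))%:~R *: ade i n v.
Proof.
move=> xv fv; elim: n => [|n IH] /=.
  rewrite bracket_derivation fv bracket0r addr0 (bracketC (km_f g i)) km_ef eqxx.
  by rewrite bracketNl (coroot_iter i 0 xv) -scaleNr; congr (- _%:~R *: _); rewrite mul1r mul0r.
rewrite bracket_derivation IH bracketZr (bracketC (km_f g i)) km_ef eqxx.
rewrite bracketNl (coroot_iter i n.+1 xv) -scaleNr -scalerDl -!rmorphN -rmorphD.
congr (_%:~R *: _); move: ((A *m x) i 0) => p.
by rewrite !intS; move: n%:Z => q; nia.
Qed.

Lemma iter_bracket0 i n : ade i n 0 = 0.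
Proof. by elim: n => //= n ->; rewrite bracket0r. Qed.

Lemma ad_f_iter_e_neq i k n v : k != i ->
  bracket (km_f g k) (ade i n v) = ade i n (bracket (km_f g k) v).
Proof.
move=> ki; elim: n => //= n IH.
rewrite bracket_derivation IH (bracketC (km_f g k)) km_ef eq_sym (negbTE ki).
by rewrite oppr0 bracket0l add0r.
Qed.

Hypothesis K_char0 : [pchar K] =i pred0.

(** The vector is killed by every f_k, and its weight has j-coordinate 1, which adding simple roots
    cannot bring down to 0; so [lowest_weight_eq0] applies. *)
Lemma serre_relation i j : i != j ->
  iter `|1 - A i j|%N (bracket (km_e g i)) (km_e g j) = 0.
Proof.
move=> ij; have [_ Aneg A0] := A_gcm.
set n := `|_|%N; have nE : n%:Z = 1 - A i j.
  by rewrite /n gez0_abs //; have := Aneg _ _ ij; lia.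
apply: (lowest_weight_eq0 K_char0 (root_space_iter i n (root_space_e (g:=g) j))).
  move=> s; apply/eqP => /(congr1 (fun x : 'cV_r => x j 0)).
  rewrite !mxE !eqxx root_sumE mulmxnE simple_rootE eq_sym (negbTE ij) mul0rn.
  by rewrite addr0.
move=> k; have [->|ki] := eqVneq k i.
  (* Case k = i: the sl_2 factor A i j + n' vanishes, because n' + 1 = 1 - A i j. *)
  have [n' n'E] : {n' | n = n'.+1}.
    exists n.-1; rewrite prednK // -ltz_nat nE.
    by have := Aneg _ _ ij; lia.
  rewrite n'E (ad_f_iter_e _ (root_space_e (g:=g) j)); last first.
    by rewrite bracketC km_ef eq_sym (negbTE ij) oppr0.
  rewrite cartan_simple (_ : A i j + n'%:Z = 0) ?mulr0 ?oppr0 ?scale0r //.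
  by move: nE; rewrite n'E; lia.
rewrite ad_f_iter_e_neq // bracketC km_ef.
have [jk|] := eqVneq j k; last by rewrite oppr0 iter_bracket0.
(* Case k = j: one ad e_i sends the coroot of j to a multiple of e_i, and a second one sends that to
   0. When n = 1 the multiple is A j i, which vanishes together with A i j. *)
case: n nE => [|[|n]] nE; first by have := Aneg _ _ ij; lia.
  have Aij : A i j = 0 by lia.
  rewrite /= bracketNr -bracketC km_he km_pairing (A0 _ _ Aij).
  by rewrite scale0r.
rewrite !iterSr bracketNr -bracketC km_he bracketZr bracketxx scaler0.
exact: iter_bracket0.
Qed.

Lemma iter_bracketD i n u v : ade i n (u + v) = ade i n u + ade i n v.
Proof. by elim: n => //= n ->; rewrite bracketDr. Qed.

Lemma iter_bracketZ i n a v : ade i n (a *: v) = a *: ade i n v.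
Proof. by elim: n => //= n ->; rewrite bracketZr. Qed.

Lemma iter_bracket_eq0 i n m v : (n <= m)%N -> ade i n v = 0 -> ade i m v = 0.
Proof. by move=> /subnK <- v0; rewrite iterD v0 iter_bracket0. Qed.

(** By the Leibniz rule each ad e_i falls on one of the two factors, and among n + m of them one
    factor is hit often enough. *)
Lemma iter_bracket_bracket i n m u v :
  ade i n u = 0 -> ade i m v = 0 -> ade i (n + m) (bracket u v) = 0.
Proof.
elim: n m u v => [|n IHn] m u v; first by move=> /= ->; rewrite bracket0l iter_bracket0.
elim: m u v => [|m IHm] u v nu.
  by move=> v0; rewrite (v0 : v = 0) bracket0r iter_bracket0.
move=> mv; rewrite addSn iterSr bracket_derivation iter_bracketD.
rewrite IHn //; last by rewrite -iterSr.
by rewrite add0r addnS -addSn IHm // -iterSr.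
Qed.

(** By [iter_bracket_bracket] the vectors killed by some power of ad e_i form a subalgebra; it
    contains the generators, the e_j by the Serre relations. *)
Lemma ad_e_nilpotent i v : exists n, ade i n v = 0.
Proof.
apply: (@km_generated _ _ _ g [set v | exists n, ade i n v = 0]) => /=.
- split=> /=; first by exists 0%N.
    move=> a u w [n un] [m wm]; exists (n + m)%N.
    rewrite iter_bracketD iter_bracketZ.
    rewrite (iter_bracket_eq0 _ un) ?leq_addr // (iter_bracket_eq0 _ wm) ?leq_addl //.
    by rewrite scaler0 addr0.
  by move=> u w [n un] [m wm]; exists (n + m)%N; exact: iter_bracket_bracket.
- move=> h; exists 2%N.
  by rewrite /= (bracketC _ (km_incl g h)) km_he -scaleNr bracketZr bracketxx scaler0.
- move=> j; have [->|ij] := eqVneq i j; first by exists 1%N; rewrite /= bracketxx.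
  by exists `|1 - A i j|%N; exact: serre_relation.
- move=> j; exists 3%N; rewrite /= km_ef; case: eqP => [->|_].
    rewrite (bracketC _ (km_incl g _)) km_he -scaleNr bracketZr.
    by rewrite bracketxx scaler0.
  by rewrite !bracket0r.
Qed.

Lemma ad_e_last i v : v != 0 ->
  exists2 n, ade i n v != 0 & bracket (km_e g i) (ade i n v) = 0.
Proof.
move=> v0; have ex : exists n, ade i n v == 0.
  by have [n vn] := ad_e_nilpotent i v; exists n; apply/eqP.
case: (ex_minnP ex) => -[|n] /eqP vn min; first by rewrite (vn : v = 0) eqxx in v0.
by exists n => //; apply/negP => /min; rewrite ltnn.
Qed.

End Sl2.

(** * Stability of the roots under simple reflections *)

Section RootReflection.
Variables (K : fieldType) (r : nat) (A : 'M[int]_r).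
Hypotheses (A_gcm : gcm A) (K_char0 : [pchar K] =i pred0).

Lemma srefl_neq0 i (x : 'cV[int]_r) : x != 0 -> srefl A i *m x != 0.
Proof. by apply: contra => /eqP x0; rewrite -(sreflK A_gcm i x) x0 mulmx0. Qed.

(** Climb n steps with e_i from v to the top u of its string, then descend p + n steps with f_i,
    where p = <x, alpha_i^vee>: this ends in weight x - p alpha_i = s_i x. *)
Lemma srefl_roots_ge0 (g : kacMoody K A) i x :
  Defs.roots g x -> 0 <= (A *m x) i 0 -> Defs.roots g (srefl A i *m x).
Proof.
move=> [x0 [v xv v0]]; case pE: ((A *m x) i 0) => [p|//] _.
split; first exact: srefl_neq0.
have [n un eu] := ad_e_last A_gcm K_char0 i v0.
set u := iter n _ _ in un eu.
have xu : root_space (x + simple_root i *+ n) u by exact: root_space_iter.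
(* In [opp_km g] the vector u is of lowest weight, so [ad_f_iter_e] governs the descent. *)
pose G := opp_km g.
have xu' : root_space (g := G) (- (x + simple_root i *+ n)) u.
  by apply/root_space_opp; rewrite opprK.
exists (iter (p + n) (bracket (km_e G i)) u).
  have := root_space_iter i (p + n) xu' => /root_space_opp.
  suff <- : srefl A i *m x = - (- (x + simple_root i *+ n) + simple_root i *+ (p + n)).
    exact.
  by rewrite srefl_mulE pE opprD opprK -pmulrn mulrnDr [simple_root i *+ p + _]addrC opprD addrA addrK.
(* The vector after k < p + n steps is recovered from the next one with the factor (k+1)(p + 2n -
   k), which is nonzero in characteristic 0. *)
have : (p + n <= p + n)%N by [].
elim: {-2}(p + n)%N => [//|k IH] kpn.
have /eqP := IH (ltnW kpn); apply: contra_not_neq => k0.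
have := ad_f_iter_e A_gcm k xu' (eu : bracket (km_f G i) u = 0).
rewrite k0 bracket0r => /esym/eqP; rewrite scaler_eq0 oppr_eq0 => /orP[|/eqP//].
rewrite (intr_inj0 K_char0) mulmxN mxE cartan_shift (cartan_diag A_gcm) pE.
by rewrite mulf_eq0 => /orP[|] /eqP; move: kpn; lia.
Qed.

Lemma srefl_roots (g : kacMoody K A) i x :
  Defs.roots g x -> Defs.roots g (srefl A i *m x).
Proof.
move=> gx; have [/srefl_roots_ge0|p0] := lerP 0 ((A *m x) i 0); first exact.
have := @srefl_roots_ge0 (opp_km g) i (- x).
rewrite mulmxN mxE oppr_ge0 => /(_ _ (ltW p0)) opp.
have /opp/roots_opp : Defs.roots (opp_km g) (- x) by apply/roots_opp; rewrite opprK.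
by rewrite mulmxN opprK.
Qed.

(** If e_i were 0, so would be alpha_i^vee = [e_i, f_i], against <alpha_i, alpha_i^vee> = 2. *)
Lemma simple_root_roots (g : kacMoody K A) i : Defs.roots g (simple_root i).
Proof.
split.
  apply/eqP => /(congr1 (fun x : 'cV_r => x i 0)); rewrite simple_rootE mxE eqxx.
  by [].
exists (km_e g i); first exact: root_space_e.
apply/eqP => e0; have := km_ef g i i; rewrite e0 bracket0l eqxx => /esym.
rewrite -(linear0 (km_incl g)) => /km_incl_inj h0.
have := km_pairing g i i; rewrite h0 linear0 (cartan_diag A_gcm) => /esym/eqP.
by rewrite (intr_inj0 K_char0).
Qed.

(** s_i changes only the i-th coordinate, so if s_i x were negative, x would be a multiple of
    alpha_i, hence alpha_i itself by [roots_multiple]. *)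
Lemma pos_roots_srefl (g : kacMoody K A) i x :
  pos_roots g x -> x != simple_root i -> pos_roots g (srefl A i *m x).
Proof.
move=> [gx /cvleP x0] xi; split; first exact: srefl_roots.
have [//|/cvleP sx0] := roots_signed K_char0 (srefl_roots i gx).
have xj j : j != i -> x j 0 = 0.
  move=> ji; have := sx0 j; have := x0 j.
  rewrite srefl_mulE !mxE -scaler_int intz !mxE (negbTE ji) mulr0 subr0.
  by rewrite oppr_ge0 => h1 h2; apply/eqP; rewrite eq_le h2.
have xE : x = simple_root i *~ x i 0.
  apply/colP => j; rewrite -scaler_int intz mxE simple_rootE natz.
  have [->|ji] := eqVneq j i; first by rewrite mulr1.
  by rewrite mulr0 xj.
case/eqP: xi; rewrite xE in gx *; have := x0 i; rewrite mxE.
by case: (roots_multiple K_char0 gx) => ->; rewrite ?mulr1z.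
Qed.

End RootReflection.

(** * The Weyl group and its inversion sets *)

Section WordProducts.
Variables (r : nat) (A : 'M[int]_r).
Hypothesis A_gcm : gcm A.
Implicit Types (s t : seq 'I_r) (i j : 'I_r) (w : 'M[int]_r).

Lemma word_prod_cons i s : word_prod A (i :: s) = srefl A i *m word_prod A s.
Proof. exact: big_cons. Qed.

Lemma word_prod_nil : word_prod A [::] = 1%:M.
Proof. exact: big_nil. Qed.

Lemma word_prod_cat s t : word_prod A (s ++ t) = word_prod A s *m word_prod A t.
Proof.
elim: s => [|i s IH]; first by rewrite word_prod_nil mul1mx.
by rewrite /= !word_prod_cons IH mulmxA.
Qed.

Lemma word_prod_rcons s i : word_prod A (rcons s i) = word_prod A s *m srefl A i.
Proof. by rewrite -cats1 word_prod_cat word_prod_cons word_prod_nil mulmx1. Qed.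

Lemma word_prod_rev s : word_prod A (rev s) *m word_prod A s = 1%:M.
Proof.
elim: s => [|i s IH]; first by rewrite !word_prod_nil mul1mx.
rewrite rev_cons word_prod_rcons word_prod_cons -mulmxA (mulmxA (srefl A i)).
by rewrite srefl_sqr // mul1mx.
Qed.

Lemma word_prodV s : word_prod A s *m word_prod A (rev s) = 1%:M.
Proof. by rewrite -{1}(revK s) word_prod_rev. Qed.

Lemma invmx_word_prod s : invmx (word_prod A s) = word_prod A (rev s).
Proof.
have [u _] := mulmx1_unit (word_prodV s).
by rewrite -[RHS]mul1mx -(mulVmx u) -mulmxA word_prodV mulmx1.
Qed.

Lemma weyl_word s : weyl A (word_prod A s). Proof. by exists s. Qed.

Lemma weyl_mul w w' : weyl A w -> weyl A w' -> weyl A (w *m w').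
Proof. by move=> [s ->] [t ->]; rewrite -word_prod_cat; exact: weyl_word. Qed.

Lemma weyl_inv w : weyl A w -> weyl A (invmx w).
Proof. by move=> [s ->]; rewrite invmx_word_prod; exact: weyl_word. Qed.

Lemma weyl_unit w : weyl A w -> w \in unitmx.
Proof. by move=> [s ->]; have [] := mulmx1_unit (word_prodV s). Qed.

Lemma weyl_srefl i : weyl A (srefl A i).
Proof. by exists [:: i]; rewrite word_prod_cons word_prod_nil mulmx1. Qed.

Definition reduced s := forall t, word_prod A t = word_prod A s -> (size s <= size t)%N.

Lemma reduced_rcons s i : reduced (rcons s i) -> reduced s.
Proof.
move=> red t ts; have := red (rcons t i).
by rewrite !word_prod_rcons ts !size_rcons ltnS; exact.
Qed.

Lemma wlengthP w : weyl A w ->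
  exists2 s, w = word_prod A s & reduced s /\ size s = wlength A w.
Proof.
move=> [s0 ws0]; have ex : exists n, `[< exists2 s, size s = n & w = word_prod A s >].
  by exists (size s0); apply/asboolP; exists s0.
case: (ex_minnP ex) => n /asboolP[s sn ws] nmin.
have nP : (exists2 s, size s = n & w = word_prod A s) /\
    (forall t, w = word_prod A t -> (n <= size t)%N).
  by split=> [|t wt]; [exists s|apply: nmin; apply/asboolP; exists t].
have := xgetPex 0%N (ex_intro _ n nP : [set n | _] !=set0).
rewrite -/(wlength A w) => -[[t tn wt] tmin]; exists t; rewrite ?tn //.
by split=> // t' t't; rewrite tn; apply: tmin; rewrite t't.
Qed.

Lemma wlength_le s : (wlength A (word_prod A s) <= size s)%N.
Proof. by have [t st [red <-]] := wlengthP (weyl_word s); exact: red. Qed.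

Lemma wlength_inv w : weyl A w -> wlength A (invmx w) = wlength A w.
Proof.
have le w' : weyl A w' -> (wlength A (invmx w') <= wlength A w')%N.
  move=> /wlengthP[s -> [_ <-]].
  by rewrite invmx_word_prod -(size_rev s) wlength_le.
move=> Ww; apply/eqP; rewrite eqn_leq le //=.
by have := le _ (weyl_inv Ww); rewrite invmxK.
Qed.

Lemma finite_wlength_le n : finite_set (weyl A `&` [set w | (wlength A w <= n)%N]).
Proof.
pose f (p : {k : 'I_n.+1 & k.-tuple 'I_r}) := word_prod A (tagged p).
apply: (@sub_finite_set _ _ (f @` setT)); last exact/finite_image/finite_finset.
move=> w [/wlengthP[s -> [_ sl]] /=]; rewrite -sl -ltnS => sn.
by exists (Tagged (fun k : 'I_n.+1 => k.-tuple 'I_r) (in_tuple s : (Ordinal sn).-tuple _)).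
Qed.

Lemma real_roots_weyl w x : weyl A w -> real_roots A x -> real_roots A (w *m x).
Proof.
move=> Ww [w' Ww' [i ->]]; exists (w *m w'); first exact: weyl_mul.
by exists i; rewrite mulmxA.
Qed.

Lemma real_root_simple i : real_roots A (simple_root i).
Proof. by exists 1%:M; [exists [::]; rewrite word_prod_nil|exists i; rewrite mul1mx]. Qed.

Lemma real_rootN x : real_roots A x -> real_roots A (- x).
Proof.
move=> [w Ww [i ->]]; exists (w *m srefl A i); first exact/weyl_mul/weyl_srefl.
by exists i; rewrite -mulmxA srefl_simple // mulmxN.
Qed.

End WordProducts.

Lemma Qpos_anti r (x : 'cV[int]_r) : Qpos x -> Qpos (- x) -> x = 0.
Proof.
move=> /cvleP x0 /cvleP nx0; apply/colP => i; apply/eqP.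
by have := nx0 i; have := x0 i; rewrite !mxE oppr_ge0 eq_le => -> ->.
Qed.

Lemma Qpos_simple r (i : 'I_r) : Qpos (simple_root i).
Proof. by apply/cvleP => j; rewrite simple_rootE mxE ler0n. Qed.

(** * The exchange condition and inversion sets *)

Section Inversions.
Variables (K : fieldType) (K_char0 : [pchar K] =i pred0).
Variables (r : nat) (A : 'M[int]_r) (A_gcm : gcm A) (g : kacMoody K A).
Implicit Types (s t : seq 'I_r) (i j : 'I_r) (w : 'M[int]_r) (x y : 'cV[int]_r).

Lemma roots_word_prod s x : Defs.roots g x -> Defs.roots g (word_prod A s *m x).
Proof.
elim: s => [|i s IH] gx; first by rewrite word_prod_nil mul1mx.
by rewrite word_prod_cons -mulmxA; apply: srefl_roots => //; exact: IH.
Qed.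

Lemma roots_weyl w x : weyl A w -> Defs.roots g x -> Defs.roots g (w *m x).
Proof. by move=> [s ->]; exact: roots_word_prod. Qed.

Lemma real_roots_roots x : real_roots A x -> Defs.roots g x.
Proof. by move=> [w Ww [i ->]]; apply: roots_weyl => //; exact: simple_root_roots. Qed.

Lemma pos_root_simple i : pos_roots g (simple_root i).
Proof. by split; [exact: simple_root_roots|exact: Qpos_simple]. Qed.

Lemma pos_neg_roots x : pos_roots g x -> ~ neg_roots g x.
Proof. by move=> [[/eqP x0 _] px] [_ nx]; apply: x0; exact: Qpos_anti. Qed.

Lemma neg_rootsP x : Defs.roots g x -> ~ pos_roots g x -> neg_roots g x.
Proof. by move=> gx npx; have [px|nx] := roots_signed K_char0 gx; [case: npx|]. Qed.

(* The two sides agree up to a transvection along alpha_j; were it nontrivial, it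
   or its inverse would send some simple root to a vector of mixed signs. *)
Lemma conj_srefl s i j : word_prod A s *m simple_root i = simple_root j ->
  word_prod A s *m srefl A i = srefl A j *m word_prod A s.
Proof.
set u := word_prod A s => uij; pose u' := word_prod A (rev s).
have uu' : u *m u' = 1%:M by exact: word_prodV.
have u'ji : u' *m simple_root j = simple_root i.
  by rewrite -uij mulmxA word_prod_rev // mul1mx.
pose a y := (A *m (u' *m y)) i 0; pose b y := (A *m y) j 0.
have rhoE y : u *m srefl A i *m (u' *m y) = y - simple_root j *~ a y.
  rewrite -mulmxA srefl_mulE mulmxBr (mulmxA u u') uu' mul1mx; congr (_ - _).
  by rewrite -!scaler_int -scalemxAr uij.
have aD y c : a (y - simple_root j *~ c) = a y - c * 2.
  rewrite /a mulmxBr -scaler_int intz -scalemxAr u'ji mulmxBr -scalemxAr.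
  by rewrite [LHS]mxE [in X in _ + X]mxE [in X in - X]mxE cartan_simple cartan_diag.
have bD y c : b (y - simple_root j *~ c) = b y - c * 2.
  rewrite /b mulmxBr -scaler_int intz -scalemxAr.
  by rewrite [LHS]mxE [in X in _ + X]mxE [in X in - X]mxE cartan_simple cartan_diag.
have mixed l (c : int) : l != j ->
    Defs.roots g (simple_root l + simple_root j *~ c) -> 0 <= c.
  move=> lj /(roots_signed K_char0)[/cvleP/(_ j)|/cvleP/(_ l)].
    rewrite -scaler_int intz !mxE !eqxx /= eq_sym (negbTE lj) add0r mulr1.
    exact.
  by rewrite -scaler_int intz !mxE !eqxx /= (negbTE lj) mulr0 addr0.
have subr_mulz (x y : 'cV[int]_r) c d : x - y *~ c - y *~ d = x + y *~ (- (c + d)).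
  by rewrite -addrA -opprD mulrNz mulrzDr.
have ab l : a (simple_root l) = b (simple_root l).
  have [->|lj] := eqVneq l j.
    by rewrite /a u'ji /b !cartan_simple !cartan_diag.
  have gl := simple_root_roots A_gcm K_char0 g l.
  (* With rho = u s_i u', the root s_j rho(alpha_l) is alpha_l + (a - b) alpha_j, so a >= b at
     alpha_l. *)
  have := srefl_roots A_gcm K_char0 j (roots_word_prod s (srefl_roots A_gcm K_char0 i
    (roots_word_prod (rev s) gl))).
  rewrite -/u -/u' (mulmxA u) rhoE srefl_mulE -/(b _) bD.
  rewrite subr_mulz => /(mixed _ _ lj) h1.
  (* In the other order, rho s_j(alpha_l) = alpha_l + (b - a) alpha_j gives b >= a. *)
  have := roots_word_prod s (srefl_roots A_gcm K_char0 i (roots_word_prod (rev s)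
    (srefl_roots A_gcm K_char0 j gl))).
  rewrite -/u -/u' (mulmxA u) rhoE srefl_mulE -/(b _) aD.
  rewrite subr_mulz => /(mixed _ _ lj) h2.
  by move: h1 h2; lia.
suff rho : u *m srefl A i *m u' = srefl A j.
  by rewrite -[LHS]mulmx1 -(word_prod_rev A_gcm s) mulmxA rho.
apply/matrixP => k l.
have : (u *m srefl A i *m u') *m simple_root l = srefl A j *m simple_root l.
  by rewrite -mulmxA rhoE srefl_mulE ab.
by rewrite -!colE => /colP/(_ k); rewrite !mxE.
Qed.

(** Reading the word from the right, some letter j first makes the image of alpha_i negative. The
    only positive root that s_j makes negative is alpha_j, so the image was alpha_j, and
    [conj_srefl] carries s_i to the left where it cancels s_j. *)
Lemma exchange s i : neg_roots g (word_prod A s *m simple_root i) ->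
  exists2 t, (size t).+1 = size s & word_prod A (rcons s i) = word_prod A t.
Proof.
elim: s => [|j s IH].
  rewrite word_prod_nil mul1mx => /pos_neg_roots[].
  exact: pos_root_simple.
rewrite word_prod_cons -mulmxA => neg.
have [pos|] := EM (pos_roots g (word_prod A s *m simple_root i)).
  have [yj|/(pos_roots_srefl A_gcm K_char0 pos)/pos_neg_roots//] :=
    eqVneq (word_prod A s *m simple_root i) (simple_root j).
  exists s => //; rewrite rcons_cons word_prod_cons word_prod_rcons.
  by rewrite (conj_srefl yj) mulmxA srefl_sqr // mul1mx.
move=> /neg_rootsP -/(_ (roots_word_prod _ (simple_root_roots A_gcm K_char0 g i))).
move=> /IH[t ts st]; exists (j :: t); first by rewrite /= ts.
by rewrite rcons_cons !word_prod_cons st.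
Qed.

Lemma reduced_pos s i : reduced A (rcons s i) ->
  pos_roots g (word_prod A s *m simple_root i).
Proof.
move=> red; apply: contrapT => /neg_rootsP -/(_
  (roots_word_prod _ (simple_root_roots A_gcm K_char0 g i))) /exchange[t st e].
by have := red t (esym e); rewrite size_rcons -st; lia.
Qed.

(** Lists alpha_i1, s_i1 alpha_i2, s_i1 s_i2 alpha_i3 and so on. The lemmas about it use [rev s]
    because Phi(u s_i) consists of alpha_i and s_i Phi(u) when u alpha_i > 0. *)
Fixpoint inversion_seq s : seq 'cV[int]_r :=
  if s is i :: s' then simple_root i :: [seq srefl A i *m x | x <- inversion_seq s']
  else [::].

Lemma mem_inversion_seq s : reduced A (rev s) ->
  inversions g (word_prod A (rev s)) = [set` inversion_seq s].
Proof.
elim: s => [|i s IH].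
  move=> _; apply/seteqP; split=> x //= [px].
  by rewrite word_prod_nil /= mul1mx => /pos_neg_roots[].
rewrite rev_cons => red; have := IH (reduced_rcons red).
have := reduced_pos red; set u := word_prod A _ => pos /seteqP[inv1 inv2].
have simple_neg : neg_roots g (u *m srefl A i *m simple_root i).
  rewrite -mulmxA srefl_simple // mulmxN; case: pos => gu pu; split.
    by have := roots_word_prod (rcons (rev s) i) (simple_root_roots A_gcm K_char0 g i);
      rewrite word_prod_rcons -mulmxA srefl_simple // mulmxN.
  by rewrite /= opprK.
rewrite word_prod_rcons -/u; apply/seteqP; split=> x /=.
  move=> [px /= ux]; rewrite inE; have [//|xi] := eqVneq x (simple_root i).
  apply/mapP; exists (srefl A i *m x); last by rewrite sreflK.
  by apply: inv1; split; [exact: pos_roots_srefl|rewrite /= mulmxA].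
rewrite inE => /predU1P[->|/mapP[y ys ->]].
  by split=> //; exact: pos_root_simple.
have [py uy] := inv2 _ ys; split; last by rewrite /= -mulmxA sreflK.
apply: pos_roots_srefl => //; apply/eqP => yi; move: uy; rewrite yi /=.
exact: pos_neg_roots.
Qed.

Lemma size_inversion_seq s : size (inversion_seq s) = size s.
Proof. by elim: s => //= i s IH; rewrite size_map IH. Qed.

Lemma uniq_inversion_seq s : reduced A (rev s) -> uniq (inversion_seq s).
Proof.
elim: s => //= i s IH; rewrite rev_cons => red; have red' := reduced_rcons red.
rewrite map_inj_uniq ?IH // ?andbT; last exact: (can_inj (sreflK A_gcm i)).
apply/mapP => -[y ys yi].
have [[_ py] _] : inversions g (word_prod A (rev s)) y by rewrite mem_inversion_seq.
have yE : y = - simple_root i.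
  by rewrite -(srefl_simple A_gcm) yi sreflK.
have [/eqP si0 _] := simple_root_roots A_gcm K_char0 g i.
by apply: si0; apply: Qpos_anti (Qpos_simple i) _; rewrite -yE.
Qed.

Lemma real_inversion_seq s x : x \in inversion_seq s -> real_roots A x.
Proof.
elim: s x => //= i s IH x; rewrite inE => /predU1P[->|/mapP[y /IH yr ->]].
  exact: real_root_simple.
exact/real_roots_weyl/yr/weyl_srefl.
Qed.

Lemma inversionsP w : weyl A w -> exists l : seq 'cV[int]_r,
  [/\ uniq l, size l = wlength A w, inversions g w = [set` l]
    & forall x, x \in l -> pos_real_roots A x].
Proof.
move=> /wlengthP[s -> [red sl]]; rewrite -(revK s) in red sl *.
exists (inversion_seq (rev s)); split.
- exact: uniq_inversion_seq.
- by rewrite size_inversion_seq -sl !size_rev.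
- exact: mem_inversion_seq.
- move=> x xs; split; first exact: real_inversion_seq xs.
  by have [[]] : inversions g (word_prod A (rev (rev s))) x by rewrite mem_inversion_seq.
Qed.

Lemma pos_imag_roots_srefl i x :
  pos_imag_roots g x -> pos_imag_roots g (srefl A i *m x).
Proof.
move=> [px nrx]; split.
  by apply: pos_roots_srefl => //; apply/eqP => xi; apply: nrx; rewrite xi; exact: real_root_simple.
move=> /(real_roots_weyl (weyl_srefl A i)); rewrite sreflK //.
Qed.

Lemma Qim_weyl w x : weyl A w -> Qim g x -> Qim g (w *m x).
Proof.
move=> [s ->]; elim: s => [|i s IH]; first by rewrite word_prod_nil mul1mx.
move=> /IH[l lim ls]; exists [seq srefl A i *m y | y <- l].
  by move=> _ /mapP[y /lim yl ->]; exact: pos_imag_roots_srefl.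
by rewrite word_prod_cons -mulmxA ls mulmx_sumr big_map.
Qed.

Lemma cvle_sum (l : seq 'cV[int]_r) :
  (forall y, y \in l -> Qpos y) -> Qpos (\sum_(y <- l) y).
Proof.
move=> l0; rewrite big_seq; elim/big_ind: _ => //; first exact: cvle_refl.
by move=> x y px py; rewrite /Qpos /= -[0]addr0; exact: cvleD.
Qed.

Lemma Qim_Qpos x : Qim g x -> Qpos x.
Proof. by move=> [l lim ->]; apply: cvle_sum => y /lim[[]]. Qed.

(** Moving x to a simple root alpha_i by W makes alpha_i a sum of positive imaginary roots; a
    nonzero summand below alpha_i is alpha_i, which is real. So no y contributes both a real and an
    imaginary factor. *)
Lemma Qim_not_real x : Qim g x -> ~ real_roots A x.
Proof.
move=> imx [w Ww [i xE]]; have := Qim_weyl (weyl_inv A_gcm Ww) imx.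
rewrite xE mulmxA mulVmx ?(weyl_unit A_gcm) // mul1mx => -[[|y l] lim].
  rewrite big_nil => /eqP; apply/negP.
  by have [] := simple_root_roots A_gcm K_char0 g i.
have [[[y0 _] /cvleP py] nry] := lim y (mem_head _ _).
have /cvleP : Qpos (\sum_(z <- l) z).
  by apply: cvle_sum => z zl; have [[]] := lim z (mem_behead (zl : z \in behead (y :: l))).
rewrite big_cons; set z := \sum_(z <- l) z => pz iyz.
case: nry; suff -> : y = simple_root i by exact: real_root_simple.
have yz k : y k 0 + z k 0 = (k == i)%:R by rewrite -simple_rootE iyz mxE.
have yk k : k != i -> y k 0 = 0.
  move=> ki; have := yz k; rewrite (negbTE ki) => /eqP.
  by rewrite paddr_eq0; [move=> /andP[/eqP]|have := py k|have := pz k]; rewrite ?mxE.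
have yi : y i 0 != 0.
  apply: contra y0 => /eqP yi0; apply/eqP/colP => k; rewrite mxE.
  by have [->|/yk] := eqVneq k i.
apply/colP => k; rewrite simple_rootE; have [->|/yk//] := eqVneq k i.
have := yz i; have := py i; have := pz i; rewrite !mxE eqxx /=; move: yi.
by move: (y i 0) (z i 0) => a b; lia.
Qed.

Lemma real_roots_signed x : real_roots A x -> Qpos x \/ Qpos (- x).
Proof. by move/real_roots_roots; exact: roots_signed. Qed.

Lemma real_root_neq0 x : real_roots A x -> x != 0.
Proof. by move/real_roots_roots => []. Qed.

End Inversions.

(** * Series supported on a cone *)

Section Subring.
Variable R : pzRingType.
Implicit Type P : set R.

(** A predicate on sets, so that [cone] can be iterated: [cone (cone setT)] in [Qseries r] is
    Z[[t]][[Q^+]]. *)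
Definition subring_set P :=
  [/\ P 1, forall a b, P a -> P b -> P (a - b) & forall a b, P a -> P b -> P (a * b)].

Lemma subring_setT : subring_set setT. Proof. by []. Qed.

Variables (P : set R) (subP : subring_set P).

Lemma subring_set1 : P 1. Proof. by case: subP. Qed.

Lemma subring_setB a b : P a -> P b -> P (a - b). Proof. by case: subP => _ + _; exact. Qed.

Lemma subring_setM a b : P a -> P b -> P (a * b). Proof. by case: subP => _ _; exact. Qed.

Lemma subring_set0 : P 0.
Proof. by rewrite -(subrr 1); apply: subring_setB; exact: subring_set1. Qed.

Lemma subring_setN a : P a -> P (- a).
Proof. by move=> Pa; rewrite -sub0r; apply: subring_setB => //; exact: subring_set0. Qed.

Lemma subring_setD a b : P a -> P b -> P (a + b).
Proof. by move=> Pa Pb; rewrite -[b]opprK; apply/subring_setB/subring_setN. Qed.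

Lemma subring_set_sum (I : Type) (s : seq I) (Q : pred I) (F : I -> R) :
  (forall i, Q i -> P (F i)) -> P (\sum_(i <- s | Q i) F i).
Proof.
move=> PF; elim/big_ind: _ => //; [exact: subring_set0|exact: subring_setD].
Qed.

Lemma subring_set_prod (I : Type) (s : seq I) (Q : pred I) (F : I -> R) :
  (forall i, Q i -> P (F i)) -> P (\prod_(i <- s | Q i) F i).
Proof.
move=> PF; elim/big_ind: _ => //; [exact: subring_set1|exact: subring_setM].
Qed.

Lemma subring_setX a n : P a -> P (a ^+ n).
Proof.
move=> Pa; elim: n => [|n IH]; first exact: subring_set1.
by rewrite exprS; exact: subring_setM.
Qed.

End Subring.

Arguments subring_setT {R}.

Section Height.
Variable n : nat.
Implicit Types x y : 'cV[int]_n.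

(** The usual height on Q^+, where it is additive; absolute values make it a natural number
    everywhere. *)
Definition height x : nat := (\sum_i `|x i ord0|)%N.

Lemma heightD x y : cvle 0 x -> cvle 0 y -> height (x + y) = (height x + height y)%N.
Proof.
move=> /cvleP px /cvleP py; rewrite /height -big_split; apply: eq_bigr => i _ /=.
by have := px i; have := py i; rewrite !mxE; move: (x i _) (y i _) => a b; lia.
Qed.

Lemma height0 : height 0 = 0%N.
Proof. by apply: big1 => i _; rewrite mxE. Qed.

Lemma height_eq0 x : (height x == 0%N) = (x == 0).
Proof.
apply/eqP/eqP => [|->]; last exact: height0.
move=> /eqP; rewrite sum_nat_eq0 => /forallP x0; apply/colP => i.
by apply/eqP; rewrite mxE -absz_eq0; have := x0 i.
Qed.

Lemma heightMn x k : height (x *+ k) = (k * height x)%N.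
Proof.
rewrite /height big_distrr; apply: eq_bigr => i _ /=.
by rewrite mulmxnE -mulr_natl natz abszM.
Qed.

Lemma cvle_anti x y : cvle x y -> cvle y x -> x = y.
Proof.
move=> /cvleP xy /cvleP yx; apply/colP => i.
by apply/eqP; rewrite eq_le xy yx.
Qed.

Lemma cvle_height x y : cvle 0 x -> cvle x y -> (height x <= height y)%N.
Proof.
move=> px xy; rewrite -(subrK x y) heightD ?leq_addl //.
by rewrite cvle_subr subr0.
Qed.

Lemma cvle_subl x y : cvle 0 y -> cvle (x - y) x.
Proof. by move=> py; rewrite -[X in cvle _ X]addr0 cvleD ?cvle_refl // -oppr0 cvleN. Qed.

Definition box x : seq 'cV[int]_n := fset_set (cvbox 0 x).

Lemma mem_box x y : (y \in box x) = cvle 0 y && cvle y x.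
Proof.
rewrite /box in_fset_set; last exact: finite_cvbox.
by apply/idP/andP; rewrite inE.
Qed.

Lemma box_uniq x : uniq (box x). Proof. exact: fset_uniq. Qed.

End Height.

Section ConeSeries.
Variables (n : nat) (R : comNzRingType).
Implicit Types (f g h : laurent n R) (P : set R) (x y a : 'cV[int]_n).

(* The series in P[[N^n]], for P a subring of R. *)
Definition cone P : set (laurent n R) :=
  [set f | (forall x, ~~ cvle 0 x -> f x = 0) /\ forall x, P (f x)].

Lemma lcoefD f g x : (f + g) x = f x + g x. Proof. by []. Qed.
Lemma lcoefN f x : (- f) x = - f x. Proof. by []. Qed.
Lemma lcoefB f g x : (f - g) x = f x - g x. Proof. by []. Qed.
Lemma lcoef1 x : (1 : laurent n R) x = (x == 0)%:R.
Proof. by rewrite /= ; case: ifP. Qed.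

Lemma lcoef_sum (I : Type) (s : seq I) (Q : pred I) (F : I -> laurent n R) x :
  (\sum_(i <- s | Q i) F i) x = \sum_(i <- s | Q i) F i x.
Proof. by elim/big_rec2: _ => // i c f _ <-. Qed.

Lemma lcoefMn f k x : (f *+ k) x = f x *+ k.
Proof. by elim: k => [|k IH]; rewrite ?mulr0n // !mulrS lcoefD IH. Qed.

Lemma lcoefMz f (k : int) x : (f *~ k) x = f x *~ k.
Proof. by case: k => k; rewrite -?pmulrn ?lcoefMn // NegzE !mulrNz lcoefN -!pmulrn lcoefMn. Qed.

Lemma lmonoE x c y : lmono x c y = if y == x then c else 0 :> R.
Proof. by []. Qed.

Lemma coneW P f : cone P f -> cone setT f.
Proof. by move=> [f0 _]; split. Qed.

Lemma lcoefM f g x : cone setT f -> cone setT g ->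
  (f * g) x = \sum_(y <- box x) f y * g (x - y).
Proof.
move=> [f0 _] [g0 _]; rewrite [LHS](@lconvE _ _ f g 0 0 x (cvbox 0 x)) ?subr0 //.
by rewrite fsbig_finite //; exact: finite_cvbox.
Qed.

Lemma lcoefM_notin f g x : cone setT f -> cone setT g -> ~~ cvle 0 x -> (f * g) x = 0.
Proof.
move=> cf cg nx; rewrite lcoefM // big_seq big1 // => y.
by rewrite mem_box => /andP[py yx]; case/negP: nx; exact: cvle_trans yx.
Qed.

Lemma cone_lmono P x c : P 0 -> Qpos x -> P c -> cone P (lmono x c).
Proof.
move=> P0 px Pc; split=> y; rewrite lmonoE; last by case: ifP.
by have [-> /negP|] := eqVneq y x.
Qed.

Lemma cone_subring P : subring_set P -> subring_set (cone P).
Proof.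
move=> subP; have P0 := subring_set0 subP; split.
- by apply: cone_lmono => //; [exact: cvle_refl|exact: subring_set1].
- move=> f g [f0 Pf] [g0 Pg]; split=> x; last exact: subring_setB.
  by move=> nx; rewrite lcoefB f0 ?g0 ?subrr.
- move=> f g cf cg; have cf' := coneW cf; have cg' := coneW cg.
  split=> x; first exact: lcoefM_notin.
  rewrite lcoefM //; case: cf cg => _ Pf [_ Pg].
  by apply: subring_set_sum => // y _; exact: subring_setM.
Qed.

(** Congruence modulo the e^x with x not below a. Within R[[N^n]] these span an ideal, so
    congruences can be multiplied and inverted, and they take the place of limits. *)
Definition agree a f g := forall x, cvle x a -> f x = g x.

Lemma agree_refl a f : agree a f f. Proof. by []. Qed.

Lemma agree_sym a f g : agree a f g -> agree a g f.
Proof. by move=> fg x xa; rewrite fg. Qed.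

Lemma agree_trans a f g h : agree a f g -> agree a g h -> agree a f h.
Proof. by move=> fg gh x xa; rewrite fg ?gh. Qed.

Lemma agreeM a f f' g g' :
    cone setT f -> cone setT f' -> cone setT g -> cone setT g' ->
  agree a f f' -> agree a g g' -> agree a (f * g) (f' * g').
Proof.
move=> cf cf' cg cg' ff' gg' x xa; rewrite !lcoefM // big_seq [RHS]big_seq.
apply: eq_bigr => y; rewrite mem_box => /andP[py yx].
rewrite ff' ?gg' //; apply: cvle_trans xa => //; exact: cvle_subl.
Qed.

Lemma coneT_subring : subring_set (cone setT). Proof. exact/cone_subring/subring_setT. Qed.

Lemma lcoef0M f g : cone setT f -> cone setT g -> (f * g) 0 = f 0 * g 0.
Proof.
move=> cf cg; rewrite lcoefM // (_ : box 0 = [:: 0]) ?big_seq1 ?subr0 //.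
apply: perm_small_eq => //; apply: uniq_perm; rewrite ?box_uniq // => y.
rewrite mem_box inE; apply/andP/eqP => [[y0 y1]|->]; last by rewrite cvle_refl.
exact: cvle_anti.
Qed.

(** Each factor without constant term raises the height by at least one. *)
Lemma lcoef_expr_height f k x :
  cone setT f -> f 0 = 0 -> cvle 0 x -> (height x < k)%N -> (f ^+ k) x = 0.
Proof.
move=> cf f0; elim: k x => // k IH x px hx.
rewrite exprS lcoefM //; last exact: (subring_setX coneT_subring).
rewrite big_seq big1 // => y; rewrite mem_box => /andP[py yx].
have [->|y0] := eqVneq y 0; first by rewrite f0 mul0r.
rewrite IH ?mulr0 //; first by rewrite cvle_subr subr0.
have : (0 < height y)%N by rewrite lt0n height_eq0.
have : height x = (height (x - y) + height y)%N.
  by rewrite -heightD ?subrK // cvle_subr subr0.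
by move: hx; lia.
Qed.

(* \sum_k (1 - f)^k; powers beyond the height of x have no e^x term when f 0 = 1. *)
Definition geometric f x : R :=
  if cvle 0 x then \sum_(k < (height x).+1) ((1 - f) ^+ k) x else 0.

Lemma geometric_bounded f : bounded_below (geometric f).
Proof. by exists 0 => x /negbTE nx; rewrite /geometric nx. Qed.

Definition geometric_series f := Laurent (geometric_bounded f).

Lemma geometric_cone P f : subring_set P -> cone P f -> cone P (geometric_series f).
Proof.
move=> subP cf; split=> x /=; first by rewrite /geometric => /negbTE ->.
rewrite /geometric; case: ifP => _; last exact: subring_set0.
apply: subring_set_sum => // k _.
have [_] : cone P ((1 - f) ^+ k); last exact.
have subC := cone_subring subP; apply: subring_setX => //.
by apply: subring_setB => //; exact: subring_set1.
Qed.

Lemma agree_geometric f x : cone setT f -> f 0 = 1 ->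
  agree x (geometric_series f) (\sum_(k < (height x).+1) (1 - f) ^+ k).
Proof.
move=> cf f1; have cT := coneT_subring; have c1 := subring_set1 cT.
have cu : cone setT (1 - f) by exact: subring_setB.
have u0 : (1 - f) 0 = 0 by rewrite lcoefB lcoef1 eqxx f1 subrr.
move=> y yx; rewrite /= /geometric lcoef_sum; case: ifPn => [py|ny]; last first.
  by rewrite big1 // => k _; have [->] : cone setT ((1 - f) ^+ k) by exact: subring_setX.
have yx' := cvle_height py yx.
rewrite (big_ord_widen (height x).+1 (fun k => ((1 - f) ^+ k) y)) ?ltnS //.
rewrite big_mkcond; apply: eq_bigr => k _; case: ltnP => // hk.
by rewrite lcoef_expr_height.
Qed.

Lemma geometric_inv f : cone setT f -> f 0 = 1 -> geometric_series f * f = 1.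
Proof.
move=> cf f1; have cT := coneT_subring; have c1 := subring_set1 cT.
have cu : cone setT (1 - f) by exact: subring_setB.
have u0 : (1 - f) 0 = 0 by rewrite lcoefB lcoef1 eqxx f1 subrr.
have cg := geometric_cone subring_setT cf.
apply: laurentP => x; have [px|nx] := boolP (cvle 0 x); last first.
  by rewrite (lcoefM_notin _ _ nx) // lcoef1; case: eqP nx => // ->; rewrite cvle_refl.
(* At x the series may be replaced by a partial sum; its product with f telescopes, and the
   remainder (1 - f)^(height x + 1) has no e^x term. *)
pose s := \sum_(k < (height x).+1) (1 - f) ^+ k.
have cs : cone setT s by apply: subring_set_sum => // k _; exact: subring_setX.
have gs : agree x (geometric_series f) s by exact: agree_geometric.
rewrite (agreeM cg cs cf cf gs (agree_refl _)) ?cvle_refl //.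
have -> : s * f = 1 - (1 - f) ^+ (height x).+1.
  have := subrXX 1 (1 - f) (height x).+1; rewrite expr1n => ->.
  rewrite subKr mulrC; congr (_ * _).
  by apply: eq_bigr => k _; rewrite expr1n mul1r.
by rewrite lcoefB lcoef_expr_height // subr0.
Qed.

Lemma cone_unit f : cone setT f -> f 0 = 1 -> f \is a GRing.unit.
Proof. by move=> cf f1; apply/asboolP; exists (geometric_series f); exact: geometric_inv. Qed.

Lemma cone_invE f : cone setT f -> f 0 = 1 -> f^-1 = geometric_series f.
Proof.
by move=> cf f1; rewrite -[RHS](mulrK (cone_unit cf f1)) geometric_inv // mul1r.
Qed.

Lemma cone_inv P f : subring_set P -> cone P f -> f 0 = 1 -> cone P f^-1.
Proof.
move=> subP cf f1; have cT := coneW cf.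
by rewrite cone_invE //; exact: geometric_cone.
Qed.

Lemma lcoef0V f : cone setT f -> f 0 = 1 -> f^-1 0 = 1.
Proof.
move=> cf f1; have := congr1 (fun g : laurent n R => g 0) (mulVr (cone_unit cf f1)).
rewrite lcoef0M //; last exact: cone_inv subring_setT cf f1.
by rewrite f1 mulr1 lcoef1 eqxx.
Qed.

Lemma agreeV a f g : cone setT f -> cone setT g -> f 0 = 1 -> g 0 = 1 ->
  agree a f g -> agree a f^-1 g^-1.
Proof.
move=> cf cg f1 g1 fg; have cT := coneT_subring.
have cfV := cone_inv subring_setT cf f1; have cgV := cone_inv subring_setT cg g1.
(* Up to a, this agrees with f^-1 f g^-1 = g^-1. *)
have -> : f^-1 = f^-1 * (g * g^-1) by rewrite mulrV ?mulr1 // cone_unit.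
rewrite -[X in agree _ _ X]mul1r -(mulVr (cone_unit cf f1)) -mulrA.
do 2![apply: agreeM => //; try exact: subring_setM].
exact: agree_sym.
Qed.

(** A multiplicative group, on which the total operation [^-1] is a true inverse. *)
Definition one_cone P : set (laurent n R) := [set f | cone P f /\ f 0 = 1].

Lemma one_coneM P f g : subring_set P -> one_cone P f -> one_cone P g -> one_cone P (f * g).
Proof.
move=> subP [cf f1] [cg g1]; split; first exact: (subring_setM (cone_subring subP)).
have cf' := coneW cf; have cg' := coneW cg.
by rewrite lcoef0M ?f1 ?g1 ?mulr1.
Qed.

Lemma one_cone1 P : subring_set P -> one_cone P 1.
Proof.
by move=> subP; split; [exact: (subring_set1 (cone_subring subP))|rewrite lcoef1 eqxx].
Qed.

Lemma one_coneV P f : subring_set P -> one_cone P f -> one_cone P f^-1.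
Proof. by move=> subP [cf f1]; split; [exact: cone_inv|apply: (lcoef0V (coneW cf))]. Qed.

Lemma one_cone_prod P (I : Type) (s : seq I) (Q : pred I) (F : I -> laurent n R) :
    subring_set P -> (forall i, Q i -> one_cone P (F i)) ->
  one_cone P (\prod_(i <- s | Q i) F i).
Proof.
move=> subP PF; elim/big_ind: _ => //; first exact: one_cone1.
by move=> f g; exact: one_coneM.
Qed.

Lemma one_coneX P f k : subring_set P -> one_cone P f -> one_cone P (f ^+ k).
Proof.
move=> subP Pf; elim: k => [|k IH]; first exact: one_cone1.
by rewrite exprS; exact: one_coneM.
Qed.

Lemma one_coneXz P f (k : int) : subring_set P -> one_cone P f -> one_cone P (f ^ k).
Proof.
move=> subP Pf; case: k => k; first exact: one_coneX.
by rewrite NegzE -exprnN; apply: one_coneV => //; exact: one_coneX.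
Qed.

Lemma one_cone_unit P f : one_cone P f -> f \is a GRing.unit.
Proof. by move=> [/coneW cf]; exact: cone_unit. Qed.

Lemma one_coneW P f : one_cone P f -> one_cone setT f.
Proof. by move=> [/coneW]. Qed.

Lemma agree_one_lmono a x c : Qpos x -> ~~ cvle x a -> agree a (1 - lmono x c) 1.
Proof.
move=> px nxa y ya; rewrite lcoefB lmonoE; case: eqP => [yx|_]; last by rewrite subr0.
by rewrite -yx ya in nxa.
Qed.

Lemma one_cone_lmono P x c : subring_set P -> Qpos x -> x != 0 -> P c ->
  one_cone P (1 - lmono x c).
Proof.
move=> subP px x0 Pc; split.
  have subC := cone_subring subP; apply: subring_setB => //; first exact: subring_set1.
  by apply: cone_lmono => //; exact: subring_set0.
by rewrite lcoefB lcoef1 lmonoE eqxx eq_sym (negbTE x0) subr0.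
Qed.

End ConeSeries.

Section MonomialProducts.
Variables (n : nat) (R : comNzRingType).
Implicit Types (f g h : laurent n R) (P : set R) (x y a : 'cV[int]_n).

Lemma lmonoM x y (c d : R) : lmono x c * lmono y d = lmono (x + y) (c * d).
Proof.
apply: laurentP => z; rewrite [LHS]/(lconv (lmono x c) (lmono y d) z) /lconv.
rewrite (fsbigTE [fset x]%fset) => [|u]; last first.
  by rewrite inE lmonoE => /negbTE ->; rewrite mul0r.
rewrite big_seq_fset1 !lmonoE eqxx subr_eq addrC.
by case: ifP; rewrite ?mulr0.
Qed.

Lemma lmonoX x (c : R) k : lmono x c ^+ k = lmono (x *+ k) (c ^+ k).
Proof.
elim: k => [|k IH]; first by rewrite !expr0.
by rewrite !exprS mulrS IH lmonoM.
Qed.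

Section AgreeProducts.
Variables (I : eqType) (F : I -> laurent n R) (a : 'cV[int]_n).

Lemma agree_prod (s : seq I) (Q : pred I) G :
    (forall i, i \in s -> Q i -> [/\ one_cone setT (F i), one_cone setT (G i) & agree a (F i) (G i)]) ->
  agree a (\prod_(i <- s | Q i) F i) (\prod_(i <- s | Q i) G i).
Proof.
move=> FG; rewrite big_seq_cond [X in agree _ _ X]big_seq_cond.
suff [] : [/\ one_cone setT (\prod_(i <- s | (i \in s) && Q i) F i),
    one_cone setT (\prod_(i <- s | (i \in s) && Q i) G i)
  & agree a (\prod_(i <- s | (i \in s) && Q i) F i) (\prod_(i <- s | (i \in s) && Q i) G i)] by [].
elim/big_rec2: _ => [|i f g /andP[si Qi] [uf og fg]].
  by split=> //; exact/one_cone1/subring_setT.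
have [oF oG FGi] := FG i si Qi.
split; [exact: one_coneM subring_setT oF uf|exact: one_coneM subring_setT oG og|].
by apply: agreeM => //; [case: oF|case: oG|case: uf|case: og].
Qed.

Lemma agree_prod_sub (s t : seq I) : uniq s -> uniq t -> {subset t <= s} ->
    (forall i, i \in s -> one_cone setT (F i)) ->
    (forall i, i \in s -> i \notin t -> agree a (F i) 1) ->
  agree a (\prod_(i <- s) F i) (\prod_(i <- t) F i).
Proof.
move=> us ut ts sF F1.
have -> : \prod_(i <- t) F i = \prod_(i <- s | i \in t) F i.
  rewrite -[RHS]big_filter; apply: perm_big; apply: uniq_perm; rewrite ?filter_uniq // => i.
  by rewrite mem_filter; case it: (i \in t) => //=; rewrite ts.
rewrite [X in agree _ _ X]big_mkcond; apply: agree_prod => i si _.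
have one1 := one_cone1 n (subring_setT (R := R)).
by case: ifPn => it; split=> //; do ?[exact: sF|exact: F1].
Qed.

End AgreeProducts.

Lemma agree_exprz a f (k : int) :
  one_cone setT f -> agree a f 1 -> agree a (f ^ k) 1.
Proof.
move=> o1 f1; have sT := subring_setT (R := R); have [c1 e1] := one_cone1 n sT.
have Xn m : agree a (f ^+ m) 1.
  rewrite -[1 in X in agree _ _ X](expr1n _ m).
  elim: m => [|m IH] //; rewrite !exprS.
  by apply: agreeM => //; [case: o1|case: (one_coneX m sT o1)|
    case: (one_coneX m sT (one_cone1 n sT))].
case: k => k; first exact: Xn.
rewrite NegzE -exprnN -[1 in X in agree _ _ X]invr1.
have [cX X1] := one_coneX k.+1 sT o1.
exact: agreeV.
Qed.

Section InfiniteProduct.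
Variables (Q : pred 'cV[int]_n) (F : 'cV[int]_n -> laurent n R) (P : set R).
Hypotheses (subP : subring_set P) (QF : forall x, Q x -> one_cone P (F x))
  (QQ : forall x, Q x -> Qpos x)
  (F1 : forall a x, Q x -> ~~ cvle x a -> agree a (F x) 1).

Lemma agree_box_prod a s : uniq s -> {in s, forall x, Q x} ->
    (forall x, Q x -> cvle x a -> x \in s) ->
  agree a (\prod_(x <- s) F x) (\prod_(x <- box a | Q x) F x).
Proof.
move=> us sQ as_; rewrite -[X in agree _ _ X]big_filter.
apply: agree_prod_sub => // [|x|x /sQ/QF/one_coneW//|x /sQ Qx].
- exact/filter_uniq/box_uniq.
- by rewrite mem_filter mem_box => /and3P[Qx _ xa]; exact: as_.
- rewrite mem_filter Qx mem_box (QQ Qx) /=; exact: F1.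
Qed.

(** By [F1] a factor whose index is not below x is 1 up to x, so the product over [box x] already
    has the right coefficient at x. *)
Definition iprod_coef x : R :=
  if cvle 0 x then (\prod_(y <- box x | Q y) F y) x else 0.

Lemma iprod_bounded : bounded_below iprod_coef.
Proof. by exists 0 => x /negbTE nx; rewrite /iprod_coef nx. Qed.

Definition iprod := Laurent iprod_bounded.

Lemma one_cone_box_prod a : one_cone P (\prod_(x <- box a | Q x) F x).
Proof. exact: one_cone_prod. Qed.

Lemma agree_iprod a : agree a iprod (\prod_(x <- box a | Q x) F x).
Proof.
move=> x xa; rewrite /= /iprod_coef; case: ifPn => [px|nx]; last first.
  by have [[z _] _] := one_cone_box_prod a; rewrite z.
have ag : agree x (\prod_(y <- filter Q (box a)) F y) (\prod_(y <- box x | Q y) F y).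
  apply: agree_box_prod; first exact/filter_uniq/box_uniq.
    by move=> y; rewrite mem_filter => /andP[].
  move=> y Qy yx; rewrite mem_filter Qy mem_box; have /= -> := QQ Qy.
  exact: cvle_trans xa.
by rewrite -(ag x (cvle_refl x)) big_filter.
Qed.

Lemma one_cone_iprod : one_cone P iprod.
Proof.
have iE a x : cvle x a -> iprod x = (\prod_(x <- box a | Q x) F x) x by exact: agree_iprod.
split; last by rewrite (iE 0) ?cvle_refl //; have [] := one_cone_box_prod 0.
split=> x; first by move=> nx /=; rewrite /iprod_coef (negbTE nx).
by rewrite (iE x) ?cvle_refl //; have [[]] := one_cone_box_prod x.
Qed.

End InfiniteProduct.

End MonomialProducts.

Section LaurentMap.
Variables (n : nat) (R S : comNzRingType) (phi : {rmorphism R -> S}).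
Implicit Types (f g : laurent n R) (x : 'cV[int]_n).

Lemma lmap_bounded f : bounded_below (fun x => phi (f x)).
Proof. by have [a fa] := lcoef_bounded f; exists a => x /fa ->; rewrite rmorph0. Qed.

(** Carries identities over Z[t] to Z((t)) and to Q[t]. *)
Definition lmap f : laurent n S := Laurent (lmap_bounded f).

Lemma lmap1 : lmap 1 = 1.
Proof. by apply: laurentP => x; rewrite lcoef1 -(rmorph_nat phi) -lcoef1. Qed.

Lemma lmapB f g : lmap (f - g) = lmap f - lmap g.
Proof. by apply: laurentP => x; rewrite lcoefB -rmorphB. Qed.

Lemma lmap_lmono x c : lmap (lmono x c) = lmono x (phi c).
Proof. by apply: laurentP => y; rewrite /= (fun_if phi) rmorph0. Qed.

Lemma cone_lmap f : cone setT f -> cone setT (lmap f).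
Proof. by move=> [f0 _]; split=> // x /f0 /= ->; rewrite rmorph0. Qed.

Lemma lmapM f g : cone setT f -> cone setT g -> lmap (f * g) = lmap f * lmap g.
Proof.
move=> cf cg; apply: laurentP => x; rewrite lcoefM; try exact: cone_lmap.
rewrite -[LHS]/(phi ((f * g) x)) lcoefM // rmorph_sum; apply: eq_bigr => y _.
by rewrite rmorphM.
Qed.

Lemma one_cone_lmap f : one_cone setT f -> one_cone setT (lmap f).
Proof. by move=> [cf f1]; split; [exact: cone_lmap|rewrite /= f1 rmorph1]. Qed.

Lemma lmapV f : one_cone setT f -> lmap f^-1 = (lmap f)^-1.
Proof.
move=> uf; have [cf _] := uf; have [cV _] := one_coneV subring_setT uf.
have u := one_cone_unit (one_cone_lmap uf).
by rewrite -[LHS](mulrK u) -lmapM // mulVr ?lmap1 ?mul1r // (one_cone_unit uf).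
Qed.

Lemma lmap_prod (I : Type) (s : seq I) (Q : pred I) (F : I -> laurent n R) :
    (forall i, Q i -> one_cone setT (F i)) ->
  lmap (\prod_(i <- s | Q i) F i) = \prod_(i <- s | Q i) lmap (F i).
Proof.
move=> QF; suff [] : one_cone setT (\prod_(i <- s | Q i) F i) /\
  lmap (\prod_(i <- s | Q i) F i) = \prod_(i <- s | Q i) lmap (F i) by [].
elim/big_rec2: _ => [|i g f Qi [uf fg]].
  by rewrite lmap1; split=> //; exact/one_cone1/subring_setT.
have oF := QF i Qi; split; first exact: one_coneM subring_setT oF uf.
by rewrite lmapM ?fg //; [case: oF|case: uf].
Qed.

Lemma lmapXn f k : one_cone setT f -> lmap (f ^+ k) = lmap f ^+ k.
Proof.
move=> uf; elim: k => [|k IH]; first exact: lmap1.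
rewrite !exprS lmapM ?IH //; first by case: uf.
by have [] := one_coneX k subring_setT uf.
Qed.

Lemma lmapXz f (k : int) : one_cone setT f -> lmap (f ^ k) = lmap f ^ k.
Proof.
move=> uf; case: k => k; first exact: lmapXn.
rewrite NegzE -!exprnN lmapV ?lmapXn //; exact: one_coneX subring_setT uf.
Qed.

End LaurentMap.

Section MultFactor.
Variable n : nat.
Implicit Types (p : {poly int}) (x a : 'cV[int]_n).

(** For p = m_x this is the product over n of (1 - t^n e^x)^(-m(x,n)); exponents from [size p] on
    are 0. The ring and t vary: Z((t)), Z[X] and Q[X] all occur. *)
Definition mult_factor (R : comNzRingType) (t : R) p x : laurent n R :=
  \prod_(i < size p) (1 - lmono x (t ^+ i)) ^ (- p`_i).

Lemma one_cone_mult_factor (R : comNzRingType) P (t : R) p x :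
  subring_set P -> P t -> Qpos x -> x != 0 -> one_cone P (mult_factor t p x).
Proof.
move=> subP Pt px x0; apply: one_cone_prod => // i _; apply: one_coneXz => //.
by apply: one_cone_lmono => //; exact: subring_setX.
Qed.

Lemma agree_mult_factor (R : comNzRingType) (t : R) p x a :
  Qpos x -> x != 0 -> ~~ cvle x a -> agree a (mult_factor t p x) 1.
Proof.
move=> px x0 nxa; have sT := subring_setT (R := R).
have -> : (1 : laurent n R) = \prod_(i < size p) 1 by rewrite big1.
apply: agree_prod => i _ _; have o1 : one_cone setT (1 - lmono x (t ^+ i)).
  exact: one_cone_lmono.
split; [exact: one_coneXz|exact: one_cone1|].
by apply: agree_exprz => //; exact: agree_one_lmono.
Qed.

Lemma lmap_mult_factor (R S : comNzRingType) (phi : {rmorphism R -> S}) (t : R) p x :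
  Qpos x -> x != 0 -> lmap phi (mult_factor t p x) = mult_factor (phi t) p x.
Proof.
move=> px x0; have o1 i : one_cone setT (1 - lmono x (t ^+ i)).
  exact: one_cone_lmono subring_setT _ _ _.
rewrite lmap_prod => [|i _]; last exact: one_coneXz subring_setT (o1 i).
apply: eq_bigr => i _; rewrite lmapXz // lmapB lmap1 lmap_lmono.
by rewrite rmorphXn.
Qed.

Lemma mult_factor0 (R : comNzRingType) (t : R) x : mult_factor t 0 x = 1.
Proof. by rewrite /mult_factor size_poly0 big_ord0. Qed.

End MultFactor.

(** * Coefficientwise limits *)

Section Limits.
Variable r : nat.
Implicit Types (f h : Qseries r) (x a : 'cV[int]_r) (k : int).

Lemma cV1_const (u : 'cV[int]_1) : u = const_mx (u 0 0).
Proof. by apply/colP => i; rewrite mxE ord1. Qed.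

Lemma tecoefP f h : (forall x k, tecoef f x k = tecoef h x k) -> f = h.
Proof.
move=> fh; apply: laurentP => x; apply: laurentP => u.
by rewrite (cV1_const u); exact: fh.
Qed.

Lemma big_cvg_unique op idx (I : choiceType) (D : set I) (F : I -> Qseries r) f h :
  big_cvg op idx D F f -> big_cvg op idx D F h -> f = h.
Proof.
move=> cf ch; apply: tecoefP => x k.
have [X XD Xf] := cf x k; have [Y YD Yh] := ch x k.
have UD : [set` (X `|` Y)%fset] `<=` D.
  by move=> i /=; rewrite in_fsetU => /orP[/XD|/YD].
by rewrite -(Xf _ (fsubsetUl X Y)) // (Yh _ (fsubsetUr X Y)).
Qed.

Lemma big_limE op idx (I : choiceType) (D : set I) (F : I -> Qseries r) f :
  big_cvg op idx D F f -> big_lim op idx D F = f.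
Proof.
move=> cf; apply: (big_cvg_unique _ cf).
exact: (xgetPex 0 (ex_intro _ f cf : [set f | big_cvg op idx D F f] !=set0)).
Qed.

(** 0 is the value of a divergent [big_lim], so a nonzero value certifies convergence. *)
Lemma big_lim_neq0 op idx (I : choiceType) (D : set I) (F : I -> Qseries r) :
  big_lim op idx D F != 0 -> big_cvg op idx D F (big_lim op idx D F).
Proof.
rewrite /big_lim; case: xgetP => [f -> //|_]; by rewrite eqxx.
Qed.

Lemma eq_big_cvg op idx (I : choiceType) (D : set I) (F G : I -> Qseries r) f :
  (forall i, D i -> F i = G i) -> big_cvg op idx D F f -> big_cvg op idx D G f.
Proof.
move=> FG cf x k; have [X XD Xf] := cf x k; exists X => // Y XY YD.
rewrite -(Xf Y) //; congr (tecoef _ _ _); rewrite big_seq [RHS]big_seq.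
by apply: eq_bigr => i iY; rewrite FG //; exact: YD.
Qed.

(* The series supported on x >= 0 whose coefficients are power series in t. *)
Notation nonneg := (cone (cone (@setT int))).

Lemma coneZ_subring n : subring_set (cone (@setT int) : set (laurent n int)).
Proof. exact/cone_subring/subring_setT. Qed.

Lemma nonneg_subring : subring_set (nonneg : set (Qseries r)).
Proof. exact/cone_subring/coneZ_subring. Qed.

Lemma nonnegP f : nonneg f <->
  forall x k, ~~ (cvle 0 x && (0 <= k)) -> tecoef f x k = 0.
Proof.
split=> [[f0 ff] x k|f0].
  rewrite negb_and => /orP[/f0|nk]; first by rewrite /tecoef => ->.
  apply: (proj1 (ff x)); apply: contra nk => /cvleP/(_ 0).
  by rewrite !mxE.
split=> x; first by move=> nx; apply: laurentP => u; rewrite (cV1_const u) [LHS]f0 // (negbTE nx).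
split=> // u nu; rewrite (cV1_const u) [LHS]f0 // negb_and; apply/orP; right.
by apply: contra nu => u0; apply/cvleP => i; rewrite (ord1 i) mxE.
Qed.

Lemma sum_cvg_nonneg (I : choiceType) (D : set I) (F : I -> Qseries r) f :
  (forall i, D i -> nonneg (F i)) -> big_cvg +%R 0 D F f -> nonneg f.
Proof.
move=> NF cf; apply/nonnegP => x k nxk; have [X XD Xf] := cf x k.
rewrite -(Xf X) //; move: x k nxk {Xf}; apply/nonnegP.
by rewrite big_seq; apply: (subring_set_sum nonneg_subring) => i /XD; exact: NF.
Qed.

Lemma sum_cvg_seq (I : choiceType) (D : set I) (F : I -> Qseries r) f
    (l : seq ('cV[int]_r * int)) : big_cvg +%R 0 D F f ->
  exists2 X0 : {fset I}, [set` X0] `<=` D &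
    forall X : {fset I}, (X0 `<=` X)%fset -> [set` X] `<=` D ->
      forall p, p \in l -> tecoef (\sum_(i <- X) F i) p.1 p.2 = tecoef f p.1 p.2.
Proof.
move=> cf; elim: l => [|[x k] l [X0 X0D X0f]]; first by exists fset0.
have [X1 X1D X1f] := cf x k; exists (X0 `|` X1)%fset.
  by move=> i /=; rewrite in_fsetU => /orP[/X0D|/X1D].
move=> X; rewrite fsubUset => /andP[X0X X1X] XD p.
by rewrite inE => /predU1P[->|]; [exact: X1f|exact: X0f].
Qed.

Lemma tecoefM_agree f f' h x k : nonneg f -> nonneg f' -> nonneg h ->
    (forall y j, cvle 0 y -> cvle y x -> 0 <= j -> j <= k -> tecoef f y j = tecoef f' y j) ->
  tecoef (f * h) x k = tecoef (f' * h) x k.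
Proof.
move=> Nf Nf' Nh ff'; have [px|nx] := boolP (cvle 0 x); last first.
  have N g : nonneg g -> tecoef (g * h) x k = 0.
    move=> Ng; have /nonnegP := subring_setM nonneg_subring Ng Nh; apply.
    by rewrite (negbTE nx).
  by rewrite !N.
have [cf cf' ch] := And3 (coneW Nf) (coneW Nf') (coneW Nh).
rewrite /tecoef !lcoefM // !lcoef_sum.
rewrite big_seq [RHS]big_seq; apply: eq_bigr => y; rewrite mem_box => /andP[py yx].
case: Nf Nf' Nh => [_ Nf] [_ Nf'] [_ Nh].
apply: (agreeM (a := const_mx k)) => //; last exact: cvle_refl.
move=> u /cvleP/(_ 0) uk; have [pu|nu] := boolP (cvle 0 u); last first.
  by have [-> //] := Nf y; have [->] := Nf' y.
rewrite (cV1_const u); apply: ff' => //; last by rewrite mxE in uk.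
by move/cvleP/(_ 0): pu; rewrite mxE.
Qed.

(** In Z[[t]][[Q^+]] the coefficient of t^k e^x in a product involves only the t^j e^y with 0 <= j
    <= k and 0 <= y <= x, so one finite index set serves for all of them. *)
Lemma sum_cvgM (I : choiceType) (D : set I) (F : I -> Qseries r) f h :
    (forall i, D i -> nonneg (F i)) -> nonneg h -> big_cvg +%R 0 D F f ->
  big_cvg +%R 0 D (fun i => F i * h) (f * h).
Proof.
move=> NF Nh cf; have Nf := sum_cvg_nonneg NF cf; move=> x k.
have [X0 X0D X0f] := sum_cvg_seq
  [seq (y, j%:Z) | y <- box x, j <- iota 0 `|k|.+1] cf.
exists X0 => // X X0X XD; rewrite -mulr_suml; apply: tecoefM_agree => //.
  by rewrite big_seq; apply: (subring_set_sum nonneg_subring) => i /XD; exact: NF.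
move=> y [j|//] py yx _ jk; apply: (X0f X X0X XD (y, j%:Z)).
by apply/allpairsP; exists (y, j); rewrite mem_box py yx mem_iota /=; split=> //; lia.
Qed.

Lemma te_mul j k x y : te j x * te k y = te (j + k) (x + y).
Proof. by rewrite /te !lmonoM mul1r; congr (lmono _ (lmono _ _)); apply/colP => i; rewrite !mxE. Qed.

Lemma te00 : te 0 0 = 1 :> Qseries r.
Proof. by rewrite /te; congr lmono; apply: laurentP => u; rewrite !lmonoE. Qed.

Definition tvar : laurent 1 int := lmono (const_mx 1) 1.

Lemma tvarX (i : nat) : tvar ^+ i = lmono (const_mx i%:Z) 1.
Proof.
rewrite lmonoX expr1n; congr lmono; apply/colP => j.
by rewrite mulmxnE !mxE -[RHS]natz.
Qed.

Lemma teE (i : nat) x : te i%:Z x = lmono x (tvar ^+ i).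
Proof. by rewrite tvarX. Qed.

Lemma cone_tvar : cone setT tvar.
Proof. by apply: cone_lmono => //; apply/cvleP => i; rewrite !mxE. Qed.

Lemma nonneg_te (i : nat) x : Qpos x -> nonneg (te i%:Z x).
Proof.
move=> px; rewrite teE; apply: cone_lmono => //.
exact: (subring_setX (coneZ_subring 1) _ cone_tvar).
Qed.

Lemma te_unit k x : te k x \is a GRing.unit.
Proof.
apply/asboolP; exists (te (- k) (- x)).
by rewrite [LHS]te_mul !addNr te00.
Qed.

Lemma one_nonneg_te (i : nat) x : Qpos x -> x != 0 ->
  one_cone (cone (@setT int)) (1 - te i%:Z x).
Proof.
move=> px x0; rewrite teE; apply: one_cone_lmono => //; first exact: coneZ_subring.
exact: (subring_setX (coneZ_subring 1) _ cone_tvar).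
Qed.

End Limits.

(** * The correction factor *)

Lemma mulr_div_cancel (R : comUnitRingType) (a b c : R) :
  a \is a GRing.unit -> (a * b) * (c / a) = c * b.
Proof. by move=> ua; rewrite mulrCA -mulrA [b / a]mulrC mulVKr. Qed.

Section DeltaRatio.
Variables (K : fieldType) (K_char0 : [pchar K] =i pred0).
Variables (r : nat) (A : 'M[int]_r) (A_gcm : gcm A) (g : kacMoody K A).
Implicit Types (w : 'M[int]_r) (x y z a : 'cV[int]_r).

Notation nonneg := (cone (cone (@setT int))).

Definition re_factor y : Qseries r := (1 - te 1 y) / (1 - te 0 y).

(** This is t (1 - t^-1 e^y)/(1 - t e^y), written without negative powers of t. *)
Definition twist_factor y : Qseries r := (te 1 0 - te 0 y) / (1 - te 1 y).

Definition absroot y := if cvle 0 y then y else - y.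

Lemma one_te0 y : Qpos y -> y != 0 -> one_cone (cone setT) (1 - te 0 y).
Proof. exact: (@one_nonneg_te _ 0). Qed.

Lemma one_te1 y : Qpos y -> y != 0 -> one_cone (cone setT) (1 - te 1 y).
Proof. exact: (@one_nonneg_te _ 1). Qed.

Lemma one_re_factor y : Qpos y -> y != 0 -> one_cone (cone setT) (re_factor y).
Proof.
move=> py y0; apply: one_coneM; [exact: coneZ_subring|exact: one_te1|].
by apply: one_coneV; [exact: coneZ_subring|exact: one_te0].
Qed.

Lemma nonneg_twist_factor y : Qpos y -> y != 0 -> nonneg (twist_factor y).
Proof.
move=> py y0; apply: (subring_setM (@nonneg_subring r)); last first.
  by have [] := one_coneV (coneZ_subring 1) (one_te1 py y0).
apply: (subring_setB (@nonneg_subring r)); first exact: (nonneg_te 1 (cvle_refl 0)).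
exact: (nonneg_te 0 py).
Qed.

Lemma act_ratio_pos w x : Qpos (w *m x) ->
  act_factor w 1 x / act_factor w 0 x = re_factor (w *m x).
Proof. by rewrite /act_factor /Qpos /= => ->. Qed.

(** With y = - w x > 0 the monomials - e^(-y) cancel, and (t - e^y)/(1 - e^y) remains. *)
Lemma act_ratio_neg w x : Qpos (- (w *m x)) -> w *m x != 0 ->
  act_factor w 1 x / act_factor w 0 x
    = re_factor (- (w *m x)) * twist_factor (- (w *m x)).
Proof.
set y := w *m x => ny y0; have y0' : - y != 0 by rewrite oppr_eq0.
have nyP : cvle 0 y = false.
  by apply/negP => py; case/eqP: y0; exact: Qpos_anti.
have u0 := one_cone_unit (one_te0 ny y0'); have u1 := one_cone_unit (one_te1 ny y0').
have uy : - te 0 y \is a GRing.unit by rewrite unitrN te_unit.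
have fE n : act_factor w n x = - te 0 y * (te n%:Z 0 - te 0 (- y)).
  rewrite /act_factor -/y nyP !mulNr !mulrBr mulr1 !te_mul.
  by rewrite !subrr !addr0 !add0r.
have f0 : te 0%:Z 0 = 1 :> Qseries r by exact: te00.
rewrite !fE f0 invrM // [_^-1 / _]mulrC mulrACA mulrV // mul1r.
by rewrite /re_factor /twist_factor (mulr_div_cancel _ _ u1).
Qed.

End DeltaRatio.

Section DeltaRatioLimit.
Variables (K : fieldType) (K_char0 : [pchar K] =i pred0).
Variables (r : nat) (A : 'M[int]_r) (A_gcm : gcm A) (g : kacMoody K A).
Implicit Types (w : 'M[int]_r) (x y z a : 'cV[int]_r).

Notation nonneg := (cone (cone (@setT int))).
Notation pos_real := (fun x => `[< pos_real_roots A x >]).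

Lemma pos_realP x : pos_real_roots A x -> [/\ real_roots A x, Qpos x & x != 0].
Proof. by move=> [rx px]; split=> //; exact: (real_root_neq0 K_char0 A_gcm g rx). Qed.

Lemma agree_re_factor a y : pos_real_roots A y -> ~~ cvle y a -> agree a (re_factor y) 1.
Proof.
move=> /pos_realP[_ py y0] nya.
have [c1 e1] := one_coneW (one_te1 py y0); have [c0 e0] := one_coneW (one_te0 py y0).
have [cV eV] := one_coneV subring_setT (conj c0 e0).
have [i1 i2] := one_cone1 r (subring_setT (R := laurent 1 int)).
rewrite -[1 in X in agree _ _ X](mulr1 1) -[X in agree _ _ (_ * X)]invr1.
apply: agreeM => //; first by rewrite invr1.
  exact: agree_one_lmono.
by apply: agreeV => //; exact: agree_one_lmono.
Qed.

(** This is Delta_t,re / Delta_re. *)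
Definition re_product : Qseries r := iprod pos_real (@re_factor r).

Lemma pos_real_re_factor x : pos_real x -> one_cone (cone setT) (re_factor x).
Proof. by move=> /asboolP/pos_realP[_ px x0]; exact: one_re_factor. Qed.

Lemma one_re_product : one_cone (cone setT) re_product.
Proof.
apply: one_cone_iprod => [||x /asboolP/pos_realP[]//|a x /asboolP]; first exact: coneZ_subring.
  exact: pos_real_re_factor.
exact: agree_re_factor.
Qed.

Lemma agree_re_product a (s : seq 'cV[int]_r) : uniq s ->
    {in s, forall x, pos_real_roots A x} ->
    (forall x, pos_real_roots A x -> cvle x a -> x \in s) ->
  agree a (\prod_(x <- s) re_factor x) re_product.
Proof.
have QF x : pos_real x -> one_cone setT (re_factor x).
  by move=> /pos_real_re_factor; exact: one_coneW.
have QQ x : pos_real x -> Qpos x by move=> /asboolP/pos_realP[].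
have F1 b x : pos_real x -> ~~ cvle x b -> agree b (re_factor x) 1.
  by move=> /asboolP; exact: agree_re_factor.
move=> us sQ sa; apply: agree_trans (agree_sym _); last first.
  exact: (agree_iprod subring_setT QF QQ F1).
apply: (agree_box_prod QF QQ F1) => // x.
  by move=> /sQ ?; exact/asboolP.
by move=> /asboolP; exact: sa.
Qed.

(** The summand T_w of [Sigma]. *)
Definition twist w : Qseries r := te (wlength A w)%:Z 0 *
  \big[*%R/1]_(x \in inversions g (invmx w)) ((1 - te (-1) x) / (1 - te 1 x)).

Lemma twistE w (l : seq 'cV[int]_r) : uniq l -> size l = wlength A w ->
    inversions g (invmx w) = [set` l] ->
  twist w = \prod_(x <- l) twist_factor x.
Proof.
move=> ul sl inv; rewrite /twist inv -(fsbig_seq _ _ ul) -sl.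
(* The power t^l(w) supplies one t for each inversion, which clears its t^-1. *)
have -> : te (size l)%:Z 0 = \prod_(x <- l) te 1 0 :> Qseries r.
  elim: (l) => [|x l' IH]; first by rewrite big_nil -te00.
  by rewrite big_cons -IH te_mul addr0 intS.
rewrite -big_split; apply: eq_bigr => x _ /=.
have num : te 1 0 * (1 - te (- 1) x) = te 1 0 - te 0 x.
  by rewrite mulrBr mulr1 te_mul subrr add0r.
by rewrite /twist_factor -num mulrA.
Qed.

(** Hence z |-> |w z| permutes the positive real roots, which reindexes [re_product]. *)
Lemma absrootK w y : w \in unitmx -> Qpos y ->
  absroot (w *m absroot (invmx w *m y)) = y.
Proof.
move=> uw py; rewrite {2}/absroot; case: ifP => _.
  by rewrite mulKVmx // /absroot; have /= -> := py.
rewrite mulmxN mulKVmx // /absroot opprK; case: ifP => // ny.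
by have -> : y = 0; [exact: Qpos_anti|rewrite oppr0].
Qed.

Lemma pos_real_absroot y : real_roots A y -> pos_real_roots A (absroot y).
Proof.
move=> ry; rewrite /absroot; case: ifPn => py; first by [].
split; first exact: real_rootN.
by have [/(negP py)|] := real_roots_signed K_char0 A_gcm g ry.
Qed.

(** Every z contributes [re_factor] at |w z|; those with w z < 0, that is the finitely many z in
    Phi(w), contribute a twist factor besides. *)
Lemma act_Delta_ratio_cvg w : weyl A w ->
  big_cvg *%R 1 (pos_real_roots A)
    (fun x => act_factor w 1 x / act_factor w 0 x) (re_product * twist w).
Proof.
move=> Ww x k; have uw := weyl_unit A_gcm Ww; have Wv := weyl_inv A_gcm Ww.
have [l [ul sl invl rl]] := inversionsP K_char0 A_gcm g Wv.
have [l' [ul' _ invl' rl']] := inversionsP K_char0 A_gcm g Ww.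
have {}sl : size l = wlength A w by rewrite sl wlength_inv.
(* Enough z for |w z| to reach every positive real root below x, together with Phi(w), listed by
   [l'], so that the whole twist appears. *)
pose s0 := [seq absroot (invmx w *m y) | y <- box x & pos_real y] ++ l'.
pose X0 := [fset z in s0]%fset.
have X0D : [set` X0] `<=` pos_real_roots A.
  move=> z /=; rewrite !inE => /orP[/mapP[y]|/rl'//].
  rewrite mem_filter => /andP[/asboolP[ry _] _] ->.
  exact/pos_real_absroot/real_roots_weyl.
exists X0 => // X X0X XD.
have XP z : z \in enum_fset X -> pos_real_roots A z by move=> zX; exact: XD.
have sX z : z \in s0 -> z \in enum_fset X.
  by move=> zs; apply: (fsubsetP X0X); rewrite !inE -mem_cat.
have -> : \prod_(z <- X) (act_factor w 1 z / act_factor w 0 z)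
  = (\prod_(z <- X) re_factor (absroot (w *m z)))
    * \prod_(z <- X | ~~ cvle 0 (w *m z)) twist_factor (- (w *m z)).
  rewrite [X in _ = _ * X]big_mkcond -big_split /= big_seq [RHS]big_seq.
  apply: eq_bigr => z /XP[rz pz]; rewrite /absroot; case: ifPn => pwz.
    by rewrite mulr1 act_ratio_pos.
  have rwz := real_roots_weyl Ww rz.
  rewrite act_ratio_neg //; last exact: (real_root_neq0 K_char0 A_gcm g rwz).
  by have [/(negP pwz)|] := real_roots_signed K_char0 A_gcm g rwz.
(* z |-> - w z maps Phi(w) bijectively onto Phi(w^-1). *)
have -> : \prod_(z <- X | ~~ cvle 0 (w *m z)) twist_factor (- (w *m z)) = twist w.
  rewrite (twistE ul sl invl) -big_filter.
  rewrite -(big_map (fun z => - (w *m z)) xpredT (@twist_factor r)).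
  apply: perm_big; apply: uniq_perm => // [|y].
    rewrite map_inj_uniq ?filter_uniq ?fset_uniq // => z z' /oppr_inj.
    exact: (can_inj (mulKmx uw)).
  apply/mapP/idP => [[z]|yl].
    rewrite mem_filter => /andP[nwz /XP[rz pz] ->].
    have [/(negP nwz)//|nwz'] := real_roots_signed K_char0 A_gcm g (real_roots_weyl Ww rz).
    have : inversions g (invmx w) (- (w *m z)); last by rewrite invl.
    split; first split=> //.
      exact/(real_roots_roots K_char0 A_gcm)/(real_rootN A_gcm)/real_roots_weyl.
    rewrite /= mulmxN mulKmx //; split; last by rewrite /= opprK.
    exact/(real_roots_roots K_char0 A_gcm)/(real_rootN A_gcm).
  have [[gy py] /= [gvy nvy]] : inversions g (invmx w) y by rewrite invl.
  have wvy : w *m - (invmx w *m y) = - y by rewrite mulmxN mulKVmx.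
  exists (- (invmx w *m y)); last by rewrite wvy opprK.
  rewrite mem_filter wvy; apply/andP; split.
    by apply/negP => ny; have [/eqP y0 _] := gy; apply: y0; exact: Qpos_anti.
  apply: sX; rewrite mem_cat; apply/orP; right.
  have : inversions g w (- (invmx w *m y)); last by rewrite invl'.
  have ry := rl _ yl.
  split; first split=> //.
    exact/(real_roots_roots K_char0 A_gcm)/(real_rootN A_gcm)/real_roots_weyl/(proj1 ry).
  rewrite /= wvy; split; last by rewrite /= opprK.
  exact/(real_roots_roots K_char0 A_gcm)/(real_rootN A_gcm)/(proj1 ry).
rewrite -(big_map (fun z => absroot (w *m z)) xpredT (@re_factor r)).
rewrite /tecoef; congr (lcoef _ _).
have ctw : cone setT (twist w).
  rewrite (twistE ul sl invl) big_seq.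
  apply: (subring_set_prod (coneT_subring _ _)) => y /rl/pos_realP[_ py y0].
  exact/coneW/nonneg_twist_factor.
have [cD _] := one_coneW one_re_product.
have wX z : z \in enum_fset X -> pos_real_roots A (absroot (w *m z)).
  by move=> /XP[rz _]; apply/pos_real_absroot/real_roots_weyl.
have cX : cone setT (\prod_(y <- [seq absroot (w *m z) | z <- X]) re_factor y).
  rewrite big_map big_seq; apply: (subring_set_prod (coneT_subring _ _)) => z /wX.
  by move=> /pos_realP[_ py y0]; have [/coneW] := one_re_factor py y0.
apply: (agreeM cX cD ctw ctw _ (agree_refl _) (cvle_refl x)).
apply: agree_re_product.
- rewrite map_inj_in_uniq ?fset_uniq // => z z' zX z'X e.
  have := absrootK (w := invmx w) (y := z); rewrite invmxK unitmx_inv uw => zK.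
  have := absrootK (w := invmx w) (y := z'); rewrite invmxK unitmx_inv uw => z'K.
  have [_ pz] := XP _ zX; have [_ pz'] := XP _ z'X.
  by rewrite -zK // e z'K.
- by move=> _ /mapP[z zX ->]; exact: wX.
- move=> y ry yx; apply/mapP; exists (absroot (invmx w *m y)); last first.
    by rewrite absrootK //; case: ry.
  apply: sX; rewrite mem_cat; apply/orP; left; apply: map_f.
  rewrite mem_filter mem_box yx; have [_ /= ->] := ry.
  by rewrite !andbT; exact/asboolP.
Qed.

Lemma act_Delta_ratioE w : weyl A w -> act_Delta_ratio A w = twist w * re_product.
Proof. by move=> Ww; rewrite mulrC; apply/big_limE/act_Delta_ratio_cvg. Qed.

Lemma nonneg_twist w : weyl A w -> nonneg (twist w).
Proof.
move=> Ww; have [l [ul sl invl rl]] := inversionsP K_char0 A_gcm g (weyl_inv A_gcm Ww).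
rewrite (twistE ul _ invl) ?sl ?wlength_inv // big_seq.
apply: (subring_set_prod (@nonneg_subring r)) => y /rl/pos_realP[_ py y0].
exact: nonneg_twist_factor.
Qed.

End DeltaRatioLimit.

Lemma mulr_cancel_two (R : comUnitRingType) (a b c d : R) :
    b \is a GRing.unit -> d \is a GRing.unit -> a * c = d ->
  a * b * (d^-1 * (c / b)) = 1.
Proof. by move=> ub ud acd; rewrite [d^-1 * _]mulrC mulrA mulrACA mulrV // mulr1 acd mulrV. Qed.

(** * The Poincare series *)

Section Poincare.
Variables (r : nat) (A : 'M[int]_r).
Hypothesis A_gcm : gcm A.

Definition short_words n : {fset 'M[int]_r} :=
  fset_set (weyl A `&` [set w | (wlength A w <= n)%N]).

Lemma mem_short_words n w :
  (w \in short_words n) <-> weyl A w /\ (wlength A w <= n)%N.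
Proof.
rewrite /short_words in_fset_set; last exact: finite_wlength_le.
by rewrite inE.
Qed.

(** The number of w of length u; [short_words] provides a finite set containing them, and a negative
    u matches no length. *)
Definition poincare_coef (u : 'cV[int]_1) : int :=
  \sum_(w <- short_words `|u 0 0|) (if u == const_mx (wlength A w)%:Z then 1 else 0).

Lemma poincare_coef_bounded : bounded_below poincare_coef.
Proof.
exists 0 => u nu; apply: big1 => w _; case: eqP => // uE.
by case/negP: nu; rewrite uE; apply/cvleP => i; rewrite !mxE.
Qed.

Definition poincare_series : laurent 1 int := Laurent poincare_coef_bounded.

Lemma tecoef_te (j k : int) (x y : 'cV[int]_r) :
  tecoef (te j y) x k = if (x == y) && (const_mx k == const_mx j :> 'cV[int]_1) then 1 else 0.
Proof. by rewrite /tecoef /te /=; case: ifP. Qed.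

Lemma tecoef_sum (I : Type) (s : seq I) (F : I -> Qseries r) x k :
  tecoef (\sum_(i <- s) F i) x k = \sum_(i <- s) tecoef (F i) x k.
Proof. by rewrite /tecoef !lcoef_sum. Qed.

Lemma poincareE : poincare A = lmono 0 poincare_series.
Proof.
apply: big_limE => x k; exists (short_words `|k|).
  by move=> w /mem_short_words[].
move=> X X0X XD; rewrite tecoef_sum.
under eq_bigr => w _ do rewrite tecoef_te.
rewrite /tecoef lmonoE; case: eqP => [_|_] /=; last by rewrite big1.
rewrite /poincare_coef mxE; apply/esym; apply: big_fset_incl => // w wX nw.
case: eqP => // /colP/(_ 0); rewrite !mxE => kw.
by case/negP: nw; apply/mem_short_words; split; [exact: XD|rewrite kw].
Qed.

Lemma one_poincare_series : one_cone setT poincare_series.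
Proof.
split.
  split=> // u nu; apply: big1 => w _; case: eqP => // uE.
  by case/negP: nu; rewrite uE; apply/cvleP => i; rewrite !mxE.
have W1 : weyl A 1%:M by exists [::]; rewrite word_prod_nil.
have l1 : wlength A 1%:M = 0%N.
  by apply/eqP; rewrite -leqn0 -(word_prod_nil A); exact: wlength_le.
rewrite /= /poincare_coef mxE (_ : short_words _ = [fset 1%:M]%fset).
  rewrite big_seq_fset1 l1; case: eqP => // -[].
apply/fsetP => w; rewrite inE; apply/idP/eqP => [/mem_short_words[Ww]|->].
  have [s -> [_ <-]] := wlengthP Ww; case: s => // _; exact: word_prod_nil.
by apply/mem_short_words; rewrite l1.
Qed.

(** Besides giving sense to the inverse in [Sigma], it forces the Weyl sum in the definition of the
    correction factor to be nonzero. *)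
Lemma poincare_unit : poincare A \is a GRing.unit.
Proof.
apply/asboolP; exists (lmono 0 poincare_series^-1).
rewrite poincareE lmonoM addr0 mulVr //.
exact: one_cone_unit one_poincare_series.
Qed.

End Poincare.

(** * The product formula for Sigma *)

Section CorrectionSeries.
Variables (K : fieldType) (K_char0 : [pchar K] =i pred0).
Variables (r : nat) (A : 'M[int]_r) (A_gcm : gcm A) (g : kacMoody K A).
Variables (m : 'cV[int]_r -> {poly int}).
Implicit Types (x y a : 'cV[int]_r).

Notation imag := (fun y => `[< Qim g y >] && (y != 0)).

Lemma one_tvar_factor p y : Qpos y -> y != 0 -> one_cone setT (mult_factor tvar p y).
Proof. exact: one_cone_mult_factor subring_setT _. Qed.

Lemma prod_cvg_iprod mm :
    prod_cvg [set p : 'cV[int]_r * nat | Qim g p.1 /\ p.1 != 0]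
      (fun p => (1 - te p.2%:Z p.1) ^ (- (m p.1)`_p.2)) mm ->
  mm = iprod imag (fun y => mult_factor tvar (m y) y).
Proof.
move=> cm; apply: tecoefP => x k; have [X0 X0D X0m] := cm x k.
(* All pairs that matter at x: if y is not below x the factor is 1 up to x, and for n >=
   [size (m y)] the exponent is 0. *)
pose s := [seq (y, n) | y <- filter imag (box x), n <- iota 0 (size (m y))].
pose F (p : 'cV[int]_r * nat) : Qseries r := (1 - te p.2%:Z p.1) ^ (- (m p.1)`_p.2).
pose X := (X0 `|` [fset p in s])%fset.
have sD p : p \in s -> Qim g p.1 /\ p.1 != 0.
  move=> /allpairsPdep[y [n [ys _ ->]]] /=.
  by move: ys; rewrite mem_filter => /andP[/andP[/asboolP]].
have XD : [set` X] `<=` [set p | Qim g p.1 /\ p.1 != 0].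
  by move=> p /=; rewrite !inE => /orP[/X0D//|/sD].
rewrite -(X0m X) ?fsubsetUl //.
have oneF p : p \in enum_fset X -> one_cone setT (1 - te p.2%:Z p.1 : Qseries r).
  by move=> /XD[/Qim_Qpos pp p0]; exact/one_coneW/one_nonneg_te.
have ag : agree x (\prod_(p <- X) F p) (\prod_(p <- s) F p).
  apply: agree_prod_sub; first exact: fset_uniq.
  - apply: allpairs_uniq_dep; first exact/filter_uniq/box_uniq.
      by move=> y _; exact: iota_uniq.
    by move=> [y n] [y' n'] _ _ /= [-> ->].
  - by move=> p ps; rewrite !inE ps orbT.
  - by move=> p /oneF; exact: one_coneXz subring_setT.
  move=> [y n] pX pns; have [/= imy y0] := XD _ pX; have py := Qim_Qpos imy.
  have [yx|nyx] := boolP (cvle y x); last first.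
    apply: agree_exprz; first exact: (oneF _ pX).
    by rewrite teE; exact: agree_one_lmono.
  rewrite /F /= nth_default ?oppr0 ?expr0z // leqNgt; apply: contra pns => ns.
  apply/allpairsPdep; exists y, n; split=> //; last by rewrite mem_iota add0n.
  by rewrite mem_filter mem_box yx y0 /= !andbT; apply/andP; split; [exact/asboolP|].
rewrite /tecoef -/(F _) (ag x (cvle_refl x)).
have QF y : imag y -> one_cone setT (mult_factor tvar (m y) y).
  by move=> /andP[/asboolP/Qim_Qpos py y0]; exact: one_tvar_factor.
have QQ y : imag y -> Qpos y by move=> /andP[/asboolP/Qim_Qpos].
have F1 b y : imag y -> ~~ cvle y b -> agree b (mult_factor tvar (m y) y) 1.
  by move=> /andP[/asboolP/Qim_Qpos py y0]; exact: agree_mult_factor.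
rewrite (agree_iprod subring_setT QF QQ F1 (cvle_refl x)).
congr (lcoef (lcoef _ _) _); rewrite -[RHS]big_filter big_allpairs_dep /=.
apply: eq_bigr => y _; rewrite /mult_factor -(big_mkord xpredT
  (fun i => (1 - lmono y (tvar ^+ i)) ^ (- (m y)`_i))) /index_iota subn0.
by apply: eq_bigr => n _; rewrite /F /= teE.
Qed.

(** The truncation at a of the full product over nonzero y in Q^+, real roots included. *)
Definition mult_product (R : comNzRingType) (t : R) a : laurent r R :=
  \prod_(y <- box a | y != 0) mult_factor t (m y) y.

Lemma one_mult_product (R : comNzRingType) (t : R) a :
  one_cone setT (mult_product t a).
Proof.
rewrite /mult_product big_seq_cond; apply: one_cone_prod subring_setT _ => y.
rewrite mem_box => /andP[/andP[py _] y0].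
exact: one_cone_mult_factor subring_setT _ py y0.
Qed.

Lemma lmap_mult_product (R S : comNzRingType) (phi : {rmorphism R -> S}) (t : R) a :
  lmap phi (mult_product t a) = mult_product (phi t) a.
Proof.
rewrite /mult_product big_seq_cond [in RHS]big_seq_cond lmap_prod => [|y]; last first.
  rewrite mem_box => /andP[/andP[py _] y0].
  exact: one_cone_mult_factor subring_setT _ py y0.
apply: eq_bigr => y; rewrite mem_box => /andP[/andP[py _] y0].
exact: lmap_mult_factor.
Qed.

(** The convention m_y = 1 - t at real roots lets real and imaginary factors enter one product. *)
Lemma re_factorE y : Qpos y -> y != 0 -> re_factor y = mult_factor tvar (1 - 'X) y.
Proof.
move=> py y0; rewrite /mult_factor.
have sz : size (1 - 'X : {poly int}) = 2%N.
  by rewrite -opprB size_polyN size_XsubC.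
rewrite sz !big_ord_recl big_ord0 mulr1 /= !coefB !coef1 !coefX /=.
by rewrite /re_factor mulrC; congr (_ * _).
Qed.

Hypotheses (m_real : forall x, pos_real_roots A x -> m x = 1 - 'X)
  (m_other : forall x, Qpos x -> x != 0 -> ~ Qim g x -> ~ real_roots A x -> m x = 0).

(** A nonzero y in the box is in Q_im, or a real root, or neither, with no overlap by
    [Qim_not_real]; in the last case m y = 0 and the factor is 1. *)
Lemma agree_correction_product mm a :
    prod_cvg [set p : 'cV[int]_r * nat | Qim g p.1 /\ p.1 != 0]
      (fun p => (1 - te p.2%:Z p.1) ^ (- (m p.1)`_p.2)) mm ->
  one_cone setT mm /\ agree a (mm * re_product A) (mult_product tvar a).
Proof.
move=> /prod_cvg_iprod ->.
have QF y : imag y -> one_cone setT (mult_factor tvar (m y) y).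
  by move=> /andP[/asboolP/Qim_Qpos py y0]; exact: one_tvar_factor.
have QQ y : imag y -> Qpos y by move=> /andP[/asboolP/Qim_Qpos].
have F1 b y : imag y -> ~~ cvle y b -> agree b (mult_factor tvar (m y) y) 1.
  by move=> /andP[/asboolP/Qim_Qpos py y0]; exact: agree_mult_factor.
have oi : one_cone setT (iprod imag (fun y => mult_factor tvar (m y) y)).
  exact: (one_cone_iprod subring_setT QF QQ F1).
split=> //.
have ore := one_coneW (one_re_product K_char0 A_gcm g).
pose re_box := \prod_(y <- box a | `[< pos_real_roots A y >]) @re_factor r y.
pose im_box := \prod_(y <- box a | imag y) mult_factor tvar (m y) y.
have reP y : pos_real_roots A y -> [/\ real_roots A y, Qpos y & y != 0].
  exact: (pos_realP K_char0 A_gcm g).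
have are : agree a (re_product A) re_box.
  apply/agree_sym; rewrite /re_box -big_filter.
  apply: (agree_re_product K_char0 A_gcm g); first exact/filter_uniq/box_uniq.
    by move=> y; rewrite mem_filter => /andP[/asboolP].
  move=> y ry ya; rewrite mem_filter mem_box ya; have [_ /= -> _] := reP _ ry.
  by rewrite !andbT; exact/asboolP.
have orb : one_cone setT re_box.
  by apply: one_cone_prod subring_setT _ => y /asboolP/reP[_ py y0];
    exact/one_coneW/one_re_factor.
have oib : one_cone setT im_box by exact: one_cone_prod.
suff <- : im_box * re_box = mult_product tvar a.
  apply: agreeM => //; [by case: oi|by case: oib|by case: ore|by case: orb|].
  exact: (agree_iprod subring_setT QF QQ F1).
rewrite /im_box /re_box /mult_product big_mkcond [X in _ * X]big_mkcond -big_split.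
rewrite [RHS]big_mkcond big_seq [RHS]big_seq; apply: eq_bigr => y /=.
rewrite mem_box => /andP[py _]; have [->|y0] := eqVneq y 0.
  rewrite andbF mul1r; case: asboolP => // /reP[_ _]; by rewrite eqxx.
rewrite andbT /=; case: asboolP => im; case: asboolP => re.
- by have [ry _ _] := reP _ re; case: (Qim_not_real K_char0 A_gcm im ry).
- by rewrite mulr1.
- by rewrite mul1r m_real // re_factorE.
- rewrite mulr1 m_other // ?mult_factor0 // => ry; exact: re.
Qed.

Lemma Sigma_inverse mm : is_correction_factor A mm -> mm * re_product A * Sigma g = 1.
Proof.
move=> corr; have Pu : poincare A \is a GRing.unit by exact: poincare_unit.
have oD := one_re_product K_char0 A_gcm g; have uD := one_cone_unit oD.
have ND := one_coneV (coneZ_subring 1) oD.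
pose S := sum_lim (weyl A) (act_Delta_ratio A).
(* Convergence of the Weyl sum comes from here: S divides the unit [poincare], so it is not the
   default 0. *)
have S0 : S != 0.
  by apply/eqP => S0; move: Pu; rewrite -corr -/S S0 mulr0 unitr0.
have cS : big_cvg +%R 0 (weyl A) (fun w => twist g w * re_product A) S.
  apply: eq_big_cvg (big_lim_neq0 S0) => w Ww.
  exact: act_Delta_ratioE.
have NT w : weyl A w -> cone (cone setT) (twist g w * re_product A).
  move=> Ww; apply: (subring_setM (@nonneg_subring r)); first exact: nonneg_twist.
  by case: oD.
(* Multiplying termwise by the inverse of [re_product] shows that the T_w sum to S / re_product. *)
have := sum_cvgM NT (proj1 ND) cS => /(eq_big_cvg (G := twist g)).
move=> /(_ (fun w Ww => mulrK uD _)) cT.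
rewrite /Sigma -[X in sum_lim _ X]/(twist g) (big_limE cT).
exact: mulr_cancel_two corr.
Qed.

End CorrectionSeries.

(** * Polynomiality of the coefficients of Sigma *)

Section PolynomialCoefficients.

(** The embedding of Z[t] in Z((t)), given as a ring morphism so that [lmap] applies. *)
Definition poly_laurent : {rmorphism {poly int} -> laurent 1 int} :=
  horner_eval tvar \o map_poly intr.

Lemma lmono_intr (x : 'cV[int]_1) (c : int) : lmono x c = c%:~R * lmono x 1.
Proof.
apply: laurentP => u; rewrite mulrzl lcoefMz /=.
by case: ifP; rewrite ?mul0rz // intz.
Qed.

Lemma poly_laurentE p :
  poly_laurent p = \sum_(i < size p) lmono (const_mx i%:Z) p`_i.
Proof.
rewrite -[LHS]/(map_poly intr p).[tvar] (@horner_coef_wide _ (size p)).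
  by apply: eq_bigr => i _; rewrite coef_map tvarX [RHS]lmono_intr.
exact: size_poly.
Qed.

Lemma poly_laurentX : poly_laurent 'X = tvar.
Proof. by rewrite -[LHS]/(map_poly intr 'X).[tvar] map_polyX hornerX. Qed.

Lemma poly_laurent_inj : injective poly_laurent.
Proof.
have coef p (k : nat) : poly_laurent p (const_mx k%:Z) = p`_k.
  have eqk (i : nat) : (const_mx k%:Z == const_mx i%:Z :> 'cV[int]_1) = (k == i).
    apply/eqP/eqP => [/colP/(_ 0)|-> //]; rewrite !mxE => -[].
    exact.
  rewrite poly_laurentE lcoef_sum; have [kp|kp] := ltnP k (size p).
    rewrite (bigD1 (Ordinal kp)) //= eqxx big1 ?addr0 // => i ik.
    by rewrite eqk eq_sym; case: eqP => // ki; case/eqP: ik; exact: val_inj.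
  rewrite nth_default // big1 // => i _; rewrite lmonoE eqk.
  by case: eqP => // ki; have := ltn_ord i; rewrite -ki ltnNge kp.
by move=> p q pq; apply/polyP => k; rewrite -!coef pq.
Qed.

Variables (K : fieldType) (K_char0 : [pchar K] =i pred0).
Variables (r : nat) (A : 'M[int]_r) (A_gcm : gcm A) (g : kacMoody K A).
Variables (m : 'cV[int]_r -> {poly int}) (m_mult : is_multiplicity g m).
Implicit Types x a : 'cV[int]_r.

(** Up to a, Sigma is the inverse of a finite product defined over Z[X], so its coefficients are
    polynomials and the [xget] in [Pcoef] succeeds; injectivity of [poly_laurent] identifies its
    choice. *)
Lemma PcoefE a x : cvle x a ->
  Pcoef g x = (mult_product m 'X a)^-1 x.
Proof.
move=> xa; set p := (RHS).
have Sx : Sigma g x = poly_laurent p.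
  have [mm [corr cvg mreal mother]] := m_mult.
  have [omm ag] := agree_correction_product K_char0 A_gcm mreal mother a cvg.
  have Sinv := Sigma_inverse K_char0 A_gcm g corr.
  have oD := one_coneW (one_re_product K_char0 A_gcm g).
  have omD := one_coneM subring_setT omm oD.
  have -> : Sigma g = (mm * re_product A)^-1.
    by rewrite -[RHS]mulr1 -Sinv mulKr // (one_cone_unit omD).
  have om := one_mult_product m tvar a.
  rewrite (agreeV (proj1 omD) (proj1 om) (proj2 omD) (proj2 om) ag xa).
  have om' := one_mult_product m 'X a.
  rewrite -[RHS]/(lmap poly_laurent (mult_product m 'X a)^-1 x) lmapV //.
  congr (lcoef _^-1 _); have := lmap_mult_product m poly_laurent 'X a.
  by rewrite poly_laurentX => e; exact: esym e.
have ex : [set q : {poly int} |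
    Sigma g x = \sum_(i < size q) lmono (const_mx i%:Z) q`_i] !=set0.
  by exists p; exact: etrans Sx (poly_laurentE p).
have SP : Sigma g x = \sum_(i < size (Pcoef g x)) lmono (const_mx i%:Z) (Pcoef g x)`_i.
  by have := xgetPex 0 ex; exact.
by apply: poly_laurent_inj; rewrite -Sx SP poly_laurentE.
Qed.

End PolynomialCoefficients.

(** * Moebius inversion *)

Section Moebius.
Local Open Scope nat_scope.

(** If p divides n, the square of p divides p n; otherwise p is one additional simple prime
    factor. *)
Lemma moebius_mul_prime p n : prime p -> 0 < n ->
  moebius (p * n) = if p %| n then 0%R else (- moebius n)%R.
Proof.
move=> pp n0; have pn0 : 0 < p * n by rewrite muln_gt0 prime_gt0.
case: ifPn => [pn|npn]; rewrite /moebius.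
  case: allP => // sqf; have := sqf p; rewrite mem_primes pp pn0 dvdn_mulr // => /(_ isT) /=.
  rewrite (lognM _ (prime_gt0 pp) n0) logn_prime // eqxx eqSS -leqn0 leqNgt.
  by rewrite logn_gt0 mem_primes pp n0 pn.
have lp : logn p n = 0 by apply/eqP; rewrite -leqn0 leqNgt logn_gt0 mem_primes pp n0 npn.
have pP : perm_eq (primes (p * n)) (p :: primes n).
  apply: uniq_perm; rewrite /= ?primes_uniq ?mem_primes ?(negbTE npn) ?andbF // => q.
  by rewrite primesM ?(prime_gt0 pp) // primes_prime // !inE.
rewrite (perm_all _ pP) (perm_size pP) /=.
rewrite (lognM _ (prime_gt0 pp) n0) logn_prime // eqxx lp addn0 eqxx /=.
rewrite (@eq_in_all _ _ (fun q => logn q n == 1)) => [|q].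
  by case: ifP; rewrite ?oppr0 // exprS mulN1r.
rewrite mem_primes => /and3P[pq _ qn]; rewrite (lognM _ (prime_gt0 pp) n0) logn_prime //.
by rewrite (_ : (q == p) = false) ?add0n //; apply: contraNF npn => /eqP <-.
Qed.

(** For a prime p dividing n, each divisor k prime to p cancels against p k, and the divisors
    divisible by p^2 contribute 0. *)
Lemma sum_moebius n : 0 < n ->
  (\sum_(k <- divisors n) moebius k)%R = (n == 1)%:R%R.
Proof.
move=> n0; have [->|n1] := eqVneq n 1.
  by rewrite (_ : divisors 1 = [:: 1]) // big_seq1.
have {}n1 : 1 < n by rewrite ltn_neqAle eq_sym n1.
pose p := pdiv n; have pp : prime p by exact: pdiv_prime.
have pn : p %| n by exact: pdiv_dvd.
have nE : n = p * (n %/ p) by rewrite mulnC divnK.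
have np0 : 0 < n %/ p by rewrite divn_gt0 ?(prime_gt0 pp) //; exact: dvdn_leq (ltnW n1) pn.
rewrite (bigID (fun k => p %| k)) /=.
have -> : (\sum_(k <- divisors n | (p %| k)%N) moebius k
    = \sum_(j <- divisors (n %/ p)%N) moebius (p * j)%N)%R.
  rewrite -(big_map (muln p) xpredT moebius) -[LHS]big_filter; apply: perm_big.
  have injp : injective (muln p) by move=> a b /eqP; rewrite eqn_pmul2l ?(prime_gt0 pp) // => /eqP.
  apply: uniq_perm; rewrite ?filter_uniq ?map_inj_uniq ?divisors_uniq // => k.
  rewrite mem_filter -dvdn_divisors //; apply/andP/mapP => [[pk kn]|[j]].
    exists (k %/ p); last by rewrite mulnC divnK.
    by rewrite -dvdn_divisors // -(dvdn_pmul2l (prime_gt0 pp)) -nE mulnC divnK.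
  rewrite -dvdn_divisors // => jn ->; rewrite dvdn_mulr //.
  by rewrite [X in _ %| X]nE dvdn_pmul2l ?(prime_gt0 pp).
have -> : (\sum_(j <- divisors (n %/ p)%N) moebius (p * j)%N
    = \sum_(j <- divisors (n %/ p)%N | ~~ (p %| j)%N) - moebius j)%R.
  rewrite [RHS]big_mkcond big_seq [RHS]big_seq; apply: eq_bigr => j.
  rewrite -dvdn_divisors // => jn; rewrite moebius_mul_prime ?(dvdn_gt0 np0 jn) //.
  by case: (p %| j).
rewrite sumrN addrC; apply/eqP; rewrite subr_eq0; apply/eqP.
rewrite -[LHS]big_filter -[RHS]big_filter; apply: perm_big.
apply: uniq_perm; rewrite ?filter_uniq ?divisors_uniq // => k.
rewrite !mem_filter -!dvdn_divisors //; case: (boolP (p %| k)) => //= pk.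
rewrite [in LHS]nE Gauss_dvdr // coprime_sym prime_coprime //.
Qed.

End Moebius.

(** * Logarithmic derivatives and powers of series *)

Section EulerDerivation.
Variables (n : nat) (R : comNzRingType).
Implicit Types (f h : laurent n R) (x y a : 'cV[int]_n).

Lemma euler_bounded f : bounded_below (fun x => f x *+ height x).
Proof. by have [a fa] := lcoef_bounded f; exists a => x /fa ->; rewrite mul0rn. Qed.

(* The derivation e^x |-> height x * e^x. *)
Definition euler f : laurent n R := Laurent (euler_bounded f).

Lemma cone_euler f : cone setT f -> cone setT (euler f).
Proof. by move=> [f0 _]; split=> // x /f0 /= ->; rewrite mul0rn. Qed.

Lemma eulerB f h : euler (f - h) = euler f - euler h.
Proof. by apply: laurentP => x; rewrite lcoefB -mulrnBl. Qed.

Lemma euler1 : euler 1 = 0.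
Proof. by apply: laurentP => x /=; case: eqP => [->|_]; rewrite ?height0 // mul0rn. Qed.

Lemma eulerM f h : cone setT f -> cone setT h ->
  euler (f * h) = euler f * h + f * euler h.
Proof.
move=> cf ch; have [cEf cEh] := (cone_euler cf, cone_euler ch).
apply: laurentP => x; rewrite lcoefD !lcoefM // -big_split.
rewrite -[LHS]/((f * h) x *+ height x) lcoefM // -sumrMnl big_seq [RHS]big_seq.
apply: eq_bigr => y; rewrite mem_box => /andP[py yx] /=.
have -> : height x = (height y + height (x - y))%N.
  by rewrite -heightD ?subrKC // cvle_subr subr0.
by rewrite mulrnDr mulrnAl mulrnAr.
Qed.

Lemma eulerXS f k : cone setT f -> euler (f ^+ k.+1) = (f ^+ k * euler f) *+ k.+1.
Proof.
move=> cf; have cX j : cone setT (f ^+ j) by exact: (subring_setX (coneT_subring _ _)).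
elim: k => [|k IH]; first by rewrite expr0 mul1r mulr1n expr1.
rewrite exprS eulerM // IH mulrnAr mulrA -exprS [euler f * _]mulrC.
by rewrite -mulrS.
Qed.

(** Takes products to sums over any commutative ring, where a logarithm would need denominators. *)
Definition dlog f := euler f / f.

Lemma dlogM f h : one_cone setT f -> one_cone setT h -> dlog (f * h) = dlog f + dlog h.
Proof.
move=> uf uh; have [uuf uuh] := (one_cone_unit uf, one_cone_unit uh).
have [cf _] := uf; have [ch _] := uh.
rewrite /dlog eulerM // (invrM uuf uuh) mulrDl; congr (_ + _).
  by rewrite mulrA mulrK.
by rewrite [f * _]mulrC [h^-1 * _]mulrC mulrA mulrK.
Qed.

Lemma dlog1 : dlog 1 = 0. Proof. by rewrite /dlog euler1 mul0r. Qed.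

Lemma dlogV f : one_cone setT f -> dlog f^-1 = - dlog f.
Proof.
move=> uf; have uV := one_coneV subring_setT uf.
apply/eqP; rewrite -addr_eq0 -dlogM // mulVr ?dlog1 //.
exact: one_cone_unit uf.
Qed.

Lemma dlogXz f (k : int) : one_cone setT f -> dlog (f ^ k) = dlog f *~ k.
Proof.
move=> uf; have Xn j : dlog (f ^+ j) = dlog f *+ j.
  elim: j => [|j IH]; first by rewrite expr0 dlog1.
  by rewrite exprS dlogM ?IH ?mulrS //; exact: one_coneX subring_setT uf.
case: k => k; first exact: Xn.
by rewrite NegzE -exprnN dlogV ?Xn ?mulrNz //; exact: one_coneX subring_setT uf.
Qed.

Lemma dlog_prod (I : Type) (s : seq I) (Q : pred I) (F : I -> laurent n R) :
    (forall i, Q i -> one_cone setT (F i)) ->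
  dlog (\prod_(i <- s | Q i) F i) = \sum_(i <- s | Q i) dlog (F i).
Proof.
move=> QF; suff [] : one_cone setT (\prod_(i <- s | Q i) F i) /\
  dlog (\prod_(i <- s | Q i) F i) = \sum_(i <- s | Q i) dlog (F i) by [].
elim/big_rec2: _ => [|i d f Qi [uf fd]].
  by rewrite dlog1; split=> //; exact/one_cone1/subring_setT.
by split; [exact: one_coneM subring_setT (QF i Qi) uf|rewrite dlogM ?fd //; exact: QF].
Qed.

(** For u = c e^y, dlog (1 - u) is - height(y) u/(1 - u). Allowing any N above the height of x lets
    one summation range serve all divisors in the Moebius inversion. *)
Lemma dlog_one_lmono y (c : R) x N : Qpos y -> y != 0 -> Qpos x -> (height x < N)%N ->
  dlog (1 - lmono y c) x = - (\sum_(1 <= k < N | x == y *+ k) c ^+ k) *+ height y.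
Proof.
move=> py y0 px xN; have o1 := one_cone_lmono (subring_setT (R := R)) py y0 (I : setT c).
have u1 := one_cone_unit o1; set u := lmono y c in o1 u1 *.
have -> : dlog (1 - u) = - ((1 - u)^-1 - 1) *+ height y.
  rewrite /dlog eulerB euler1 sub0r.
  have -> : euler u = u *+ height y.
    apply: laurentP => z; rewrite lcoefMn /=; case: eqP => [->|_] //.
    by rewrite !mul0rn.
  rewrite mulNr mulrnAl mulNrn; congr (- (_ *+ _)).
  by rewrite -[X in _ = _ - X](divrr u1) -[X in _ = X - _]mul1r -mulrBl subKr.
have gE : geometric_series (1 - u) x = \sum_(k < (height x).+1) (u ^+ k) x.
  by rewrite /= /geometric; have /= -> := px; rewrite subKr.
rewrite lcoefMn lcoefN lcoefB (cone_invE (proj1 o1) (proj2 o1)) gE; congr (- _ *+ _).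
rewrite big_ord_recl expr0 !lcoef1 addrC addKr.
under eq_bigr => k _ do rewrite lmonoX lmonoE.
rewrite -(big_mkord xpredT (fun k => if x == y *+ k.+1 then c ^+ k.+1 else 0)).
rewrite -(big_add1 _ _ 0 (height x).+1 xpredT (fun k => if x == y *+ k then c ^+ k else 0)).
(* No k beyond the height of x satisfies x = y *+ k, because y has height at least 1. *)
rewrite -big_mkcond [in RHS](big_cat_nat _ (n := (height x).+1)) //=.
rewrite [X in _ = _ + X]big_nat_cond [X in _ = _ + X]big1 ?addr0 // => k.
move=> /andP[/andP[xk _] /eqP xy]; have : (0 < height y)%N by rewrite lt0n height_eq0.
by move: xk; rewrite xy heightMn; case: (height y) => // h; rewrite mulnS; lia.
Qed.

(** Summing over the exponents i first turns the terms p_i (t^i)^k into p(t^k). *)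
Lemma dlog_mult_factor (t : R) p y x N :
    Qpos y -> y != 0 -> Qpos x -> (height x < N)%N ->
  dlog (mult_factor t p y) x =
    (\sum_(1 <= k < N | x == y *+ k) (map_poly intr p).[t ^+ k]) *+ height y.
Proof.
move=> py y0 px xN.
have o1 i : one_cone setT (1 - lmono y (t ^+ i)).
  exact: one_cone_lmono subring_setT _ _ _.
rewrite dlog_prod => [|i _]; last exact: one_coneXz subring_setT (o1 i).
rewrite lcoef_sum.
under eq_bigr => i _ do rewrite dlogXz // lcoefMz (dlog_one_lmono _ py y0 px xN).
have step i : (- (\sum_(1 <= k < N | x == y *+ k) (t ^+ i) ^+ k) *+ height y) *~ (- p`_i)
    = (\sum_(1 <= k < N | x == y *+ k) (p`_i)%:~R * (t ^+ k) ^+ i) *+ height y.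
  rewrite mulrNz mulNrn mulNrz opprK pmulrn mulrzAC -pmulrn -mulrzl mulr_sumr.
  by congr (_ *+ _); apply: eq_bigr => k _; rewrite exprAC.
under eq_bigr => i _ do rewrite step.
rewrite sumrMnl exchange_big /=; congr (_ *+ _); apply: eq_bigr => k _.
rewrite (@horner_coef_wide _ (size p)); last exact: size_poly.
by apply: eq_bigr => i _; rewrite coef_map.
Qed.

(* log f = \sum_(k >= 1) (-1)^(k+1) (f - 1)^k / k has euler (log f) = dlog f. *)
Lemma dlog_expand f x : one_cone setT f -> Qpos x ->
  dlog f x = \sum_(k < (height x).+1) (-1) ^+ k * ((f - 1) ^+ k * euler f) x.
Proof.
move=> [cf f1] px; have cT := coneT_subring n R.
have cu : cone setT (f - 1) by exact: (subring_setB cT cf (subring_set1 cT)).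
have cX k (h : laurent n R) : cone setT h -> cone setT (h ^+ k).
  by move=> ch; exact: (subring_setX cT).
have cE := cone_euler cf.
have cN : cone setT (1 - f) by exact: (subring_setB cT (subring_set1 cT) cf).
have cS : cone setT (\sum_(k < (height x).+1) (1 - f) ^+ k).
  by apply: (subring_set_sum cT) => k _; exact: cX.
have cV := cone_inv subring_setT cf f1.
have ag : agree x f^-1 (\sum_(k < (height x).+1) (1 - f) ^+ k).
  by rewrite cone_invE //; exact: agree_geometric.
rewrite /dlog (agreeM cE cE cV cS (agree_refl _) ag (cvle_refl x)).
rewrite mulr_sumr lcoef_sum; apply: eq_bigr => k _.
rewrite -(opprB f 1) [in LHS]exprNn [euler f * _]mulrC -[in LHS]mulrA.
have signM j (h : laurent n R) : ((-1) ^+ j * h) x = (-1) ^+ j * h x.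
  elim: j => [|j IH]; first by rewrite !expr0 !mul1r.
  by rewrite !exprS !mulN1r !mulNr lcoefN IH.
exact: signM.
Qed.

End EulerDerivation.

(** * Multinomial coefficients of multisets *)

Section Multinomial.
Local Open Scope mset_scope.
Variable T : choiceType.
Implicit Types (M : {mset T}) (y : T).

Lemma mem_enum_mset y M : (y \in M) = (y \in enum_mset M). Proof. by []. Qed.

Lemma perm_enum_msetD1 y M : perm_eq (enum_mset (y +` M)) (y :: enum_mset M).
Proof.
by apply/allP => z _; rewrite /= !count_mem_mset mset1DE (eq_sym y).
Qed.

Lemma size_msetD1 y M : size (enum_mset (y +` M)) = (size (enum_mset M)).+1.
Proof. by rewrite (perm_size (perm_enum_msetD1 y M)). Qed.

Lemma size_mset_eq0 M : size (enum_mset M) = 0%N -> M = mset0.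
Proof.
move=> /size0nil e; apply/msetP => y; rewrite mset0E.
by apply/mset_eq0P; rewrite mem_enum_mset e.
Qed.

Lemma sum_mset_mult M : (\sum_(y <- finsupp M) M y)%N = size (enum_mset M).
Proof.
rewrite -sum1_size sum_mset; apply: eq_bigr => y _; exact: esym (muln1 _).
Qed.

(** B(M) as a fraction, for which the recursion is plain algebra; [multinomial_quotient] ties it to
    the integer quotient. *)
Definition multinomial M : rat :=
  (size (enum_mset M))`!%:R / (\prod_(y <- finsupp M) (M y)`!)%:R.

Lemma prod_fact_gt0 (s : seq T) M : (0 < \prod_(y <- s) (M y)`!)%N.
Proof. by apply: prodn_gt0 => y; exact: fact_gt0. Qed.

(** Splitting off one y leaves a binomial coefficient. *)
Lemma dvdn_prod_fact (s : seq T) (F : T -> nat) :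
  (\prod_(y <- s) (F y)`! %| (\sum_(y <- s) F y)`!)%N.
Proof.
elim: s => [|y s IH]; first by rewrite !big_nil.
rewrite !big_cons; set n := (\sum_(z <- s) F z)%N in IH *.
rewrite -(@bin_fact (F y + n) (F y)) ?leq_addr // addKn dvdn_mull //.
exact: dvdn_mul.
Qed.

Lemma multinomial_quotient M :
  multinomial M = ((size (enum_mset M))`! %/ \prod_(y <- finsupp M) (M y)`!)%N%:R.
Proof.
have dv := dvdn_prod_fact (finsupp M) M; rewrite sum_mset_mult in dv.
rewrite /multinomial -[in LHS](divnK dv) natrM mulfK //.
by rewrite pnatr_eq0 -lt0n prod_fact_gt0.
Qed.

Lemma prod_fact_wide (s : seq T) M : uniq s -> {subset finsupp M <= s} ->
  (\prod_(y <- s) (M y)`! = \prod_(y <- finsupp M) (M y)`!)%N.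
Proof.
move=> us Ms; rewrite (bigID (mem (finsupp M))) /= [X in (_ * X)%N]big1 ?muln1.
  rewrite -[LHS]big_filter; apply: perm_big.
  apply: uniq_perm; rewrite ?filter_uniq ?fset_uniq // => y.
  by rewrite mem_filter /=; case yM: (y \in finsupp M) => //=; rewrite Ms.
by move=> y; rewrite msuppE => /mset_eq0P ->.
Qed.

(** Puts the terms of [multinomial_rec] over a common denominator. *)
Lemma multinomialD1 y M : multinomial M =
  (size (enum_mset M))`!%:R * ((y +` M) y)%:R
    / (\prod_(z <- finsupp (y +` M)) ((y +` M) z)`!)%:R.
Proof.
set M' := y +` M; have yM' : y \in finsupp M' by rewrite msuppE mset1D1.
have sub : {subset finsupp M <= finsupp M'}.
  by move=> z; rewrite !msuppE => zM; exact: mset1Dr.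
rewrite /multinomial -(prod_fact_wide _ sub) ?fset_uniq //.
rewrite !(big_fsetD1 y yM') /=.
have -> : (\prod_(z <- (finsupp M' `\ y)%fset) (M z)`!
    = \prod_(z <- (finsupp M' `\ y)%fset) (M' z)`!)%N.
  apply: eq_fbigr => z; rewrite !inE => /andP[/negbTE zy _] _.
  by rewrite /M' mset1DE zy.
rewrite /M' mset1DE eqxx add1n factS !natrM -mulf_div.
set c := (\prod_(z <- _) _)%N; have c0 : c%:R != 0 :> rat.
  by rewrite pnatr_eq0 -lt0n prod_fact_gt0.
have f0 : (M y)`!%:R != 0 :> rat by rewrite pnatr_eq0 -lt0n fact_gt0.
have s0 : (M y).+1%:R != 0 :> rat by rewrite pnatr_eq0.
rewrite -!mulrA; congr (_ * _); rewrite !invfM mulrCA.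
by rewrite !mulrA mulfV // mul1r.
Qed.

(** Sorts the orderings of M by their first entry; in the proof, the multiplicities add up to the
    size. *)
Lemma multinomial_rec M : M != mset0 ->
  multinomial M = \sum_(y <- finsupp M) multinomial (M `\ y).
Proof.
move=> M0; have sM : (0 < size (enum_mset M))%N.
  by rewrite lt0n; apply: contra M0 => /eqP/size_mset_eq0/eqP.
have -> : \sum_(y <- finsupp M) multinomial (M `\ y)
    = \sum_(y <- finsupp M) ((size (enum_mset M)).-1`!%:R
      / (\prod_(z <- finsupp M) (M z)`!)%:R) * (M y)%:R.
  rewrite big_seq [RHS]big_seq; apply: eq_bigr => y; rewrite msuppE => yM.
  have := size_msetD1 y (M `\ y); rewrite (multinomialD1 y) msetB1K // => ->.
  by rewrite /= mulrAC.
rewrite -mulr_sumr -natr_sum sum_mset_mult /multinomial mulrAC -natrM mulnC.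
by rewrite -[X in (X * _)%N](prednK sM) -factS prednK.
Qed.

End Multinomial.

(** * Vector partitions and powers of a series *)

Section VectorPartitions.
Local Open Scope mset_scope.
Variable r : nat.
Implicit Types (x y : 'cV[int]_r) (M : {mset 'cV[int]_r}).

(** Built by choosing a first part; [undup] is needed since a multiset arises once from each of its
    distinct entries. *)
Fixpoint partitions n x : seq {mset 'cV[int]_r} :=
  if n is n'.+1 then
    undup [seq y +` M | y <- filter (fun y => y != 0) (box x), M <- partitions n' (x - y)]
  else if x == 0 then [:: mset0] else [::].

Lemma partitions_uniq n x : uniq (partitions n x).
Proof. by case: n => [|n] /=; [case: ifP|exact: undup_uniq]. Qed.

Lemma Par_msetD1 y x M :
  Par x (y +` M) <-> [/\ Qpos y, y != 0 & Par (x - y) M].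
Proof.
have sumE : \sum_(z <- enum_mset (y +` M)) z = y + \sum_(z <- enum_mset M) z.
  by rewrite (perm_big _ (perm_enum_msetD1 y M)) big_cons.
split=> [[MP Mx]|[py y0 [MP Mx]]].
  have [py y0] := MP y (mset1D1 _ _); split=> //; split.
    by move=> z zM; apply: MP; exact: mset1Dr.
  by rewrite -[x]Mx sumE [y + _]addrC addrK.
split; last by rewrite [LHS]sumE Mx subrKC.
by move=> z; rewrite in_mset1D => /predU1P[->|/MP].
Qed.

Lemma Par_Qpos x M : Par x M -> Qpos x.
Proof.
by move=> [MP <-]; apply: cvle_sum => y /MP[].
Qed.

Lemma mem_partitions n x M :
  (M \in partitions n x) <-> Par x M /\ size (enum_mset M) = n.
Proof.
elim: n x M => [|n IH] x M.
  rewrite /=; case: eqP => [->|x0]; rewrite ?inE; split=> //.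
  - by move=> /eqP ->; split; [split|]; rewrite ?enum_mset0 ?big_nil // => y; rewrite in_mset0.
  - by move=> [_ /size_mset_eq0 ->].
  - by move=> [[_ Mx] /size_mset_eq0 M0]; case: x0; rewrite -Mx M0 enum_mset0 big_nil.
rewrite /= mem_undup; split.
  move=> /allpairsPdep[y [M' [yx /IH[parM' sM'] ->]]].
  move: yx; rewrite mem_filter mem_box => /andP[y0 /andP[py _]].
  by rewrite size_msetD1 sM'; split=> //; exact/Par_msetD1.
move=> [parM sM]; have [y yM] : exists y, y \in M.
  have : (0 < size (enum_mset M))%N by rewrite sM.
  by case e: (enum_mset M) => [|y s] // _; exists y; rewrite mem_enum_mset e mem_head.
have ME := msetB1K yM; rewrite -ME size_msetD1 in parM sM.
have [py y0 parM'] := (Par_msetD1 _ _ _).1 parM.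
apply/allpairsPdep; exists y, (M `\ y); split=> //; last exact/IH/(conj parM' (succn_inj sM)).
rewrite mem_filter y0 mem_box; have /= -> := py => /=.
by rewrite -[y]addr0 -(subrK y x) addrC cvleD ?cvle_refl //; exact: Par_Qpos parM'.
Qed.

Variable R : comAlgType rat.

(** The multinomial theorem: splitting one factor off V^(n+1) singles out an entry y, and
    [multinomial_rec] sums over the choices. *)
Lemma lcoef_expr_partitions (V : laurent r R) n x : cone setT V -> V 0 = 0 -> Qpos x ->
  (V ^+ n) x = \sum_(M <- partitions n x) multinomial M *: \prod_(y <- enum_mset M) V y.
Proof.
move=> cV V0; have cT := coneT_subring r R.
elim: n x => [|n IH] x px.
  rewrite expr0 lcoef1 /=; case: eqP => _; last by rewrite big_nil.
  by rewrite big_seq1 /multinomial enum_mset0 finsupp0 !big_nil /= divr1 scale1r.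
rewrite exprS lcoefM //; last exact: (subring_setX cT).
pose W M := \prod_(y <- enum_mset M) V y.
transitivity (\sum_(y <- box x | y != 0)
    \sum_(M <- partitions n (x - y)) multinomial M *: W (y +` M)).
  rewrite [LHS](bigID (fun y => y == 0)) /= big1 ?add0r => [|y /eqP ->]; last first.
    by rewrite V0 mul0r.
  rewrite big_seq_cond [RHS]big_seq_cond; apply: eq_bigr => y.
  rewrite mem_box => /andP[/andP[py yx] y0].
  rewrite IH; last by rewrite /Qpos /= cvle_subr subr0.
  rewrite mulr_sumr; apply: eq_bigr => M _; rewrite -scalerAr; congr (_ *: _).
  by rewrite /W (perm_big _ (perm_enum_msetD1 y M)) big_cons.
(* A nonzero y with a partition of x - y into n parts is the same as a partition of x into n + 1
   parts with a chosen entry y. *)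
transitivity (\sum_(M <- partitions n.+1 x)
    \sum_(y <- box x | (y != 0) && (y \in M)) multinomial (M `\ y) *: W M).
  rewrite (exchange_big_dep (fun y => y != 0)) /=; last by move=> M y _ /andP[].
  rewrite big_seq_cond [RHS]big_seq_cond; apply: eq_bigr => y.
  rewrite mem_box => /andP[/andP[py yx] y0].
  under [RHS]eq_bigl => M do rewrite y0 /=.
  transitivity (\sum_(M <- [seq y +` M | M <- partitions n (x - y)])
      multinomial (M `\ y) *: W M).
    by rewrite big_map; apply: eq_bigr => M _; rewrite msetD1K.
  rewrite -[RHS]big_filter; apply: perm_big; apply: uniq_perm.
  - by rewrite map_inj_uniq ?partitions_uniq // => M M' /(congr1 (fun N => N `\ y));
      rewrite !msetD1K.
  - exact/filter_uniq/(partitions_uniq n.+1).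
  move=> M; rewrite mem_filter; apply/mapP/andP => [[M' /mem_partitions[parM sM] ->]|].
    rewrite mset1D1; split=> //; apply/(mem_partitions n.+1).
    by rewrite size_msetD1 sM; split=> //; exact/Par_msetD1.
  move=> [yM /(mem_partitions n.+1)[parM sM]]; exists (M `\ y); last by rewrite msetB1K.
  rewrite -(msetB1K yM) size_msetD1 in parM sM.
  by apply/mem_partitions; have /Par_msetD1[_ _] := parM; split=> //; case: sM.
rewrite big_seq [RHS]big_seq; apply: eq_bigr => M /(mem_partitions n.+1)[parM sM].
rewrite -scaler_suml (multinomial_rec (M := M)); last first.
  by apply/eqP => M0; rewrite M0 enum_mset0 in sM.
congr (_ *: _); rewrite -[LHS]big_filter; apply: perm_big.
apply: uniq_perm; rewrite ?filter_uniq ?box_uniq ?fset_uniq // => y.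
rewrite mem_filter msuppE.
case: (boolP (y \in (M : {mset 'cV[int]_r}))) => yM; rewrite ?andbF //= andbT.
have [py y0 parM'] : [/\ Qpos y, y != 0 & Par (x - y) (M `\ y)].
  by apply/Par_msetD1; rewrite msetB1K.
rewrite y0 mem_box; have /= -> := py => /=.
by rewrite -[y]addr0 -(subrK y x) addrC cvleD ?cvle_refl //; exact: Par_Qpos parM'.
Qed.

(** Each part has height at least 1. *)
Lemma size_Par x M : Par x M -> (size (enum_mset M) <= height x)%N.
Proof.
move sn: (size _) => n; elim: n x M sn => // n IH x M sM parM.
have [y yM] : exists y, y \in M.
  by case e: (enum_mset M) sM => [|y s] // _; exists y; rewrite mem_enum_mset e mem_head.
rewrite -(msetB1K yM) size_msetD1 in parM sM; case: sM => sM.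
have [py y0 parM'] := (Par_msetD1 _ _ _).1 parM.
rewrite -(subrK y x) heightD //; last exact: Par_Qpos parM'.
rewrite -addn1 leq_add //; first exact: IH sM parM'.
by rewrite lt0n height_eq0.
Qed.

(** Sorts by the number of parts; as x != 0 there is at least one part, and there are at most
    [height x]. *)
Lemma sum_Par x N (F : {mset 'cV[int]_r} -> R) : x != 0 -> (height x < N)%N ->
  \sum_(M \in Par x) F M = \sum_(1 <= n < N) \sum_(M <- partitions n x) F M.
Proof.
move=> x0 xN; pose s := [seq M | n <- index_iota 1 N, M <- partitions n x].
have -> : Par x = [set` s].
  apply/seteqP; split=> M /=.
    move=> parM; apply/allpairsPdep; exists (size (enum_mset M)), M; split=> //.
      rewrite mem_index_iota (leq_ltn_trans (size_Par parM) xN) andbT lt0n.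
      apply/eqP => /size_mset_eq0 M0; case/eqP: x0; case: parM => _ <-.
      by rewrite M0 enum_mset0 big_nil.
    exact/mem_partitions.
  by move=> /allpairsPdep[n [M' [_ /mem_partitions[parM _] ->]]].
rewrite -fsbig_seq; first by rewrite big_allpairs_dep.
apply: allpairs_uniq_dep => [|n _|]; [exact: iota_uniq|exact: partitions_uniq|].
move=> [n M] [n' M'] /allpairsPdep[n1 [M1 [_ /mem_partitions[_ s1] e1]]].
move=> /allpairsPdep[n2 [M2 [_ /mem_partitions[_ s2] e2]]] /= MM.
case: e1 e2 => -> e1 [-> e2]; rewrite -s1 -s2 -e1 -e2 MM //.
Qed.

End VectorPartitions.

(** * Divisors in the root lattice *)

Section QuotientVectors.
Variable r : nat.
Implicit Types (x y : 'cV[int]_r).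

(** A total x/k with rounded coordinates; the test x == quotv x k *+ k singles out the k that divide
    x. *)
Definition quotv x (k : nat) : 'cV[int]_r := \col_i (x i ord0 %/ k%:Z)%Z.

Lemma mulmnE0 x k i : (x *+ k) i 0 = x i 0 * k%:Z.
Proof. by rewrite mulmxnE -mulr_natr natz. Qed.

Lemma quotvK y k : (0 < k)%N -> quotv (y *+ k) k = y.
Proof.
move=> k0; apply/colP => i; rewrite mxE mulmnE0 mulzK //.
by rewrite -lt0n in k0 *; case: k k0.
Qed.

Lemma height_multiple x y k : x = y *+ k -> x != 0 -> (0 < k <= height x)%N.
Proof.
move=> -> x0; have : (0 < height (y *+ k))%N by rewrite lt0n height_eq0.
by rewrite heightMn muln_gt0 => /andP[-> h0] /=; rewrite leq_pmulr.
Qed.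

Lemma multiple_inj x y k k' : x != 0 -> x = y *+ k -> x = y *+ k' -> k = k'.
Proof.
move=> x0 e e'; have : (height x != 0)%N by rewrite height_eq0.
rewrite {1}e heightMn muln_eq0 negb_or => /andP[_ hy].
have : (k * height y = k' * height y)%N by rewrite -!heightMn -e -e'.
by move=> /eqP; rewrite eqn_pmul2r ?lt0n // => /eqP.
Qed.

Lemma Qquot_multiple x y k : x != 0 -> (0 < k)%N -> x = y *+ k -> Qquot x y = k.
Proof.
move=> x0 k0 e; have ex : [set k | (0 < k)%N /\ x = y *+ k] !=set0 by exists k.
by have [_ e'] := xgetPex 0%N ex; exact: multiple_inj x0 e' e.
Qed.

Lemma Qpos_multiple y k : (0 < k)%N -> Qpos (y *+ k) -> Qpos y.
Proof.
move=> k0 /cvleP py; apply/cvleP => i; have := py i.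
by rewrite mulmnE0 !mxE pmulr_lge0.
Qed.

Lemma cvle_multiple y k : (0 < k)%N -> Qpos y -> cvle y (y *+ k).
Proof.
move=> k0 /cvleP py; apply/cvleP => i; rewrite mulmnE0 -[leLHS]mulr1.
by apply: ler_wpM2l; [have := py i; rewrite mxE|rewrite lez_nat].
Qed.

Lemma QdivisorsE x : x != 0 -> Qpos x ->
  Qdivisors x = [set` [seq quotv x k | k <- index_iota 1 (height x).+1 & x == quotv x k *+ k]].
Proof.
move=> x0 px; apply/seteqP; split=> y /=.
  move=> [py y0 [k k0 e]]; have /andP[_ kx] := height_multiple e x0.
  have qy : quotv x k = y by rewrite e quotvK.
  apply/mapP; exists k; last by rewrite qy.
  by rewrite mem_filter qy -e eqxx mem_index_iota k0 ltnS.
move=> /mapP[k]; rewrite mem_filter mem_index_iota => /andP[/eqP e /andP[k0 _]] ->.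
split; first by apply: (Qpos_multiple k0); rewrite -e.
  by apply: contraNneq x0 => q0; rewrite e q0 mul0rn.
by exists k.
Qed.

Lemma sum_Qdivisors (V : zmodType) x (F : 'cV[int]_r -> V) : x != 0 -> Qpos x ->
  \sum_(y \in Qdivisors x) F y =
    \sum_(1 <= k < (height x).+1 | x == quotv x k *+ k) F (quotv x k).
Proof.
move=> x0 px; rewrite QdivisorsE // -fsbig_seq ?big_map ?big_filter //.
rewrite map_inj_in_uniq ?filter_uniq ?iota_uniq // => k k'.
rewrite !mem_filter => /andP[/eqP e _] /andP[/eqP e' _] q.
by apply: (multiple_inj x0 e); rewrite q.
Qed.

End QuotientVectors.

(** * Coefficients of the logarithm and their inversion *)

Section LogarithmCoefficients.
Variables (r : nat) (m : 'cV[int]_r -> {poly int}) (a : 'cV[int]_r).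
Implicit Types (x y : 'cV[int]_r) (M : {mset 'cV[int]_r}%mset).

Lemma horner_comp_Xn (p : {poly int}) k :
  (map_poly intr p : {poly {poly rat}}).['X ^+ k] = (map_poly intr p : {poly rat}) \Po 'X^k.
Proof.
rewrite -[RHS]/((map_poly polyC (map_poly intr p)).['X^k]) -map_poly_comp.
by congr (_.[_]); apply: eq_map_poly => z /=; rewrite rmorph_int.
Qed.

(** The coefficient of e^x in minus the logarithm of the series with constant term 1 and
    coefficients P. *)
Definition log_coef (P : 'cV[int]_r -> {poly rat}) x : {poly rat} :=
  \sum_(M \in Par x) ((-1) ^+ size (enum_mset M)
    * ((Bcoef M)%:R / (size (enum_mset M))%:R) : rat) *: \prod_(y <- enum_mset M) P y.

Lemma log_coef_comp P k x : x != 0 ->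
  log_coef (fun y => P y \Po 'X^k) x = log_coef P x \Po 'X^k.
Proof.
move=> x0; rewrite /log_coef !(sum_Par _ x0 (ltnSn _)).
rewrite [RHS](raddf_sum (comp_poly 'X^k)); apply: eq_bigr => n _.
rewrite [RHS](raddf_sum (comp_poly 'X^k)); apply: eq_bigr => M _.
by rewrite [RHS]comp_polyZ [in RHS](rmorph_prod (comp_poly 'X^k)).
Qed.

Variable P : 'cV[int]_r -> {poly rat}.
Hypothesis PE : forall x, cvle x a -> P x = (mult_product m 'X a)^-1 x.

(** Both sides, multiplied by the height of x, are the coefficient of e^x in [dlog] of the
    product. *)
Lemma log_coefE x N : Qpos x -> x != 0 -> cvle x a -> (height x < N)%N ->
  log_coef P x = \sum_(y <- box a | y != 0) \sum_(1 <= k < N | x == y *+ k)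
    (k%:R^-1 : rat) *: (map_poly intr (m y) \Po 'X^k).
Proof.
move=> px x0 xa xN; pose Om : laurent r {poly rat} := mult_product m 'X a.
have oOm : one_cone setT Om := one_mult_product m 'X a.
have oS := one_coneV subring_setT oOm; pose S : laurent r {poly rat} := Om^-1; rewrite -/S in oS.
have cT := coneT_subring r ({poly rat} : comNzRingType).
have cV : cone setT (S - 1) by apply: (subring_setB cT); [case: oS|exact: subring_set1 cT].
have V0 : (S - 1) 0 = 0 by rewrite lcoefB lcoef1 eqxx (proj2 oS) subrr.
have h0 : ((height x)%:R : rat) != 0 by rewrite pnatr_eq0 height_eq0.
have LV : log_coef P x = \sum_(j < (height x).+1)
    ((-1) ^+ j.+1 / j.+1%:R : rat) *: ((S - 1) ^+ j.+1) x.
  (* The bound height x + 2 matches the range of [dlog_expand]; there is no partition of x into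
     height x + 1 parts. *)
  rewrite /log_coef (sum_Par _ x0 (ltnW (ltnSn (height x).+1))) big_add1 /= big_mkord.
  apply: eq_bigr => j _; rewrite lcoef_expr_partitions // scaler_sumr big_seq [RHS]big_seq.
  apply: eq_bigr => M /(mem_partitions j.+1)[parM sM]; have [MP _] := parM.
  rewrite scalerA sM multinomial_quotient; congr (_ *: _).
    by rewrite mulrA mulrAC.
  rewrite big_seq [RHS]big_seq; apply: eq_bigr => y yM; have [py y0] := MP y yM.
  rewrite lcoefB lcoef1 (negbTE y0) subr0 PE //.
  apply: cvle_trans xa; have /Par_msetD1[_ _ /Par_Qpos pxy] : Par x (y +` (M `\ y))%mset.
    by rewrite msetB1K.
  by rewrite -[y]addr0 -(subrK y x) addrC cvleD ?cvle_refl.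
have LD : log_coef P x *+ height x = dlog Om x.
  have -> : Om = S^-1 by rewrite invrK.
  rewrite dlogV // lcoefN (dlog_expand oS px) LV -sumrMnl -sumrN.
  apply: eq_bigr => j _.
  have -> : euler S = euler (S - 1) by rewrite eulerB euler1 subr0.
  have -> : ((S - 1) ^+ j * euler (S - 1)) x
      = (j.+1%:R^-1 : rat) *: (((S - 1) ^+ j.+1) x *+ height x).
    rewrite -[_ *+ height x]/(euler ((S - 1) ^+ j.+1) x) eulerXS // lcoefMn.
    by rewrite -scaler_nat scalerA mulVf ?scale1r // pnatr_eq0.
  rewrite -scalerMnr exprS mulN1r mulNr scaleNr -scalerA mulNrn; congr (- _).
  by rewrite -[in RHS](rmorph_sign (@polyC rat)) mul_polyC -scalerMnr.
have -> : log_coef P x = ((height x)%:R^-1 : rat) *: (log_coef P x *+ height x).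
  by rewrite -scaler_nat scalerA mulVf // scale1r.
rewrite LD /Om /mult_product big_seq_cond dlog_prod => [|y]; last first.
  rewrite mem_box => /andP[/andP[py _] y0].
  exact: one_cone_mult_factor subring_setT _ py y0.
rewrite lcoef_sum scaler_sumr [RHS]big_seq_cond; apply: eq_bigr => y.
rewrite mem_box => /andP[/andP[py _] y0].
rewrite (dlog_mult_factor _ _ py y0 px xN) -sumrMnl scaler_sumr.
apply: eq_bigr => k /eqP xy; rewrite horner_comp_Xn -scaler_nat scalerA; congr (_ *: _).
(* The height of y divided by that of x = y *+ k is 1/k. *)
move: h0; rewrite xy heightMn natrM mulf_eq0 negb_or => /andP[k0 y0'].
by rewrite invfM -mulrA mulVf // mulr1.
Qed.

(* Moebius inversion: log_coef P x = \sum_(k | x) m_(x/k)(X^k) / k. *)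
Lemma log_coef_moebius : Qpos a -> a != 0 ->
  \sum_(1 <= k < (height a).+1 | a == quotv a k *+ k)
    ((moebius k)%:~R * k%:R^-1 : rat) *: (log_coef P (quotv a k) \Po 'X^k)
  = map_poly intr (m a).
Proof.
move=> pa a0; set N := (height a).+1.
pose G y n : {poly rat} := (n%:R^-1 : rat) *: (map_poly intr (m y) \Po 'X^n).
transitivity (\sum_(1 <= k < N) \sum_(y <- box a | y != 0)
    \sum_(1 <= n < N | (k %| n)%N && (a == y *+ n)) ((moebius k)%:~R : rat) *: G y n).
  rewrite big_mkcond big_nat_cond [RHS]big_nat_cond; apply: eq_bigr => k /andP[/andP[k0 kN] _].
  (* With n = j k, the condition a/k = j y becomes a = n y. *)
  have reindex y (H : nat -> {poly rat}) :
      \sum_(1 <= n < N | (k %| n)%N && (a == y *+ n)) H n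
      = \sum_(1 <= j < N | a == y *+ (j * k)%N) H (j * k)%N.
    rewrite -[LHS]big_filter -[RHS]big_filter -(big_map (fun j => (j * k)%N) xpredT H).
    apply: perm_big; apply: uniq_perm; rewrite ?filter_uniq ?iota_uniq //.
      rewrite map_inj_uniq ?filter_uniq ?iota_uniq // => i j /eqP.
      by rewrite eqn_pmul2r // => /eqP.
    move=> n; rewrite mem_filter mem_index_iota.
    apply/idP/mapP => [/andP[/andP[kn /eqP e] /andP[n0 nN]]|[j]].
      exists (n %/ k)%N; last by rewrite divnK.
      rewrite mem_filter divnK // -e eqxx mem_index_iota divn_gt0 // dvdn_leq //=.
      by rewrite (leq_ltn_trans (leq_div _ _) nN).
    rewrite mem_filter mem_index_iota => /andP[/eqP e /andP[j0 jN]] ->.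
    rewrite dvdn_mull // -e eqxx /=; have /andP[-> ] := height_multiple e a0.
    by rewrite ltnS.
  case: ifPn => [/eqP e|ne].
    have q0 : quotv a k != 0 by apply: contraNneq a0 => q0; rewrite e q0 mul0rn.
    have pq : Qpos (quotv a k) by apply: (Qpos_multiple k0); rewrite -e.
    have qa : cvle (quotv a k) a by rewrite {2}e cvle_multiple.
    have qN : (height (quotv a k) < N)%N by rewrite ltnS cvle_height.
    rewrite (log_coefE pq q0 qa qN) (raddf_sum (comp_poly 'X^k)) scaler_sumr.
    apply: eq_bigr => y _; rewrite reindex (raddf_sum (comp_poly 'X^k)) scaler_sumr.
    apply: eq_big => [j|j _].
      apply/eqP/eqP => [qy|e']; first by rewrite {1}e qy mulrnA.
      by rewrite e' mulrnA quotvK.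
    rewrite [X in _ *: X]comp_polyZ /G !scalerA -mulrA; congr (_ *: _).
      by rewrite natrM invfM [_^-1 * _]mulrC.
    by rewrite -comp_polyA comp_Xn_poly -exprM mulnC.
  (* If k does not divide a, neither does any multiple of k, so both sides are 0. *)
  rewrite big1 // => y _; rewrite reindex big1 // => j /eqP e.
  by case/eqP: ne; rewrite {2}e mulrnA quotvK // -mulrnA -e.
rewrite exchange_big /=.
(* For fixed y and n, [sum_moebius] sums over the k dividing n and leaves only n = 1, hence y =
   a. *)
transitivity (\sum_(y <- box a | y != 0)
    \sum_(1 <= n < N | a == y *+ n) ((n == 1)%N%:R : rat) *: G y n).
  apply: eq_bigr => y _.
  rewrite (exchange_big_dep (fun n => a == y *+ n)) /=; last by move=> k n _ /andP[].
  rewrite big_nat_cond [RHS]big_nat_cond; apply: eq_bigr => n /andP[/andP[n0 nN] e].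
  rewrite -scaler_suml; congr (_ *: _).
  rewrite -[X in _ = X](rmorph_nat (intr : int -> rat)) -sum_moebius // rmorph_sum.
  rewrite -[LHS]big_filter; apply: perm_big.
  apply: uniq_perm; rewrite ?filter_uniq ?iota_uniq ?divisors_uniq // => k.
  rewrite mem_filter e andbT mem_index_iota -dvdn_divisors //.
  apply/andP/idP => [[]//|kn]; split=> //.
  by rewrite (dvdn_gt0 n0 kn) (leq_ltn_trans (dvdn_leq n0 kn) nN).
have -> : \sum_(y <- box a | y != 0)
    \sum_(1 <= n < N | a == y *+ n) ((n == 1)%N%:R : rat) *: G y n
  = \sum_(y <- box a | y == a) map_poly intr (m y).
  rewrite [LHS]big_mkcond [RHS]big_mkcond; apply: eq_bigr => y _.
  have [->|y0] := eqVneq y 0; first by rewrite eq_sym (negbTE a0).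
  rewrite big_mkcond big_ltn /=; last by rewrite ltnS lt0n height_eq0.
  rewrite mulr1n eq_sym big_nat_cond big1 ?addr0 => [|n /andP[/andP[n1 _] _]]; last first.
    by case: ifP => // _; rewrite gtn_eqF // scale0r.
  case: eqP => // _; rewrite scale1r /G invr1 scale1r expr1 comp_polyXr //.
rewrite -big_filter (_ : [seq y <- box a | y == a] = [:: a]) ?big_seq1 //.
apply: perm_small_eq => //; apply: uniq_perm; rewrite ?filter_uniq ?box_uniq // => y.
rewrite mem_filter mem_box inE; case: eqP => // ->.
by have /= -> := pa; rewrite cvle_refl.
Qed.

End LogarithmCoefficients.

Theorem theorem6p5 (K : fieldType) (K_char0 : [pchar K] =i pred0)
    (r : nat) (A : 'M[int]_r) (A_gcm : gcm A) (g : kacMoody K A)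
    (m : 'cV[int]_r -> {poly int}) (m_mult : is_multiplicity g m)
    (lam : 'cV[int]_r) (lam_pos : Qpos lam) (lam_neq0 : lam != 0) :
  map_poly intr (m lam) =
    \sum_(kap \in Qdivisors lam)
      ((moebius (Qquot lam kap))%:~R * (Qquot lam kap)%:R^-1 : rat) *:
      \sum_(M \in Par kap)
        ((-1) ^+ size (enum_mset M)
           * ((Bcoef M)%:R / (size (enum_mset M))%:R) : rat) *:
        \prod_(x <- enum_mset M)
          (map_poly intr (Pcoef g x) \Po 'X^(Qquot lam kap) : {poly rat}).
Proof.
pose P y : {poly rat} := map_poly intr (Pcoef g y).
have PE x : cvle x lam -> P x = (mult_product m 'X lam)^-1 x.
  move=> xl; rewrite /P (PcoefE K_char0 A_gcm m_mult xl).
  (* Transports [PcoefE] from Z[X] to Q[X], where the denominators of the formula exist. *)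
  pose phi : {rmorphism {poly int} -> {poly rat}} := map_poly intr.
  have om := one_mult_product m ('X : {poly int}) lam.
  rewrite -[LHS]/(lmap phi (mult_product m 'X lam)^-1 x) lmapV //.
  by have := lmap_mult_product m phi 'X lam; rewrite [phi 'X]map_polyX => ->.
rewrite -(log_coef_moebius PE lam_pos lam_neq0) sum_Qdivisors //.
rewrite big_nat_cond [RHS]big_nat_cond; apply: eq_bigr => k /andP[/andP[k0 _] /eqP e].
rewrite (Qquot_multiple lam_neq0 k0 e); congr (_ *: _).
have q0 : quotv lam k != 0 by apply: contraNneq lam_neq0 => q0; rewrite e q0 mul0rn.
by rewrite -log_coef_comp.
Qed.
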